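(* Let $M$ be a closed connected (real) hyperbolic $n$-manifold, $n>2$. Then $M$ contains a geometric closed geodesic $\gamma$ such that $o(\gamma)=1$, i.e. the group $G_\gamma$ is trivial.
   Context: A geometric closed geodesic of $M$ is the image $\gamma$ of a totally geodesic immersion $\mathbb{S}^1\to M$. $G=ISO(M)$ is the (finite) isometry group of $M$, $G_\gamma=\{f\in G: f(\gamma)=\gamma\}$, and $o(\gamma)=|G_\gamma|$. *)

(* Defs.v *)
From HB Require Import structures.
From mathcomp Require Import all_boot all_order all_algebra finmap.
From mathcomp Require Import all_classical all_reals all_analysis.

Set Implicit Arguments.
Unset Strict Implicit.
Unset Printing Implicit Defensive.

Import Order.TTheory GRing.Theory Num.Theory.
Import numFieldNormedType.Exports.

Local Open Scope classical_set_scope.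
Local Open Scope ring_scope.

(* Hyperboloid model of real hyperbolic space (curvature -1): coordinate 0 is
   the time coordinate, and cosh d(x, y) = - <x, y> for the Lorentz form. *)

Definition lorentz (R : realType) (n : nat) (x y : 'rV[R]_n.+1) : R :=
  \sum_(i < n) x ord0 (lift ord0 i) * y ord0 (lift ord0 i)
  - x ord0 ord0 * y ord0 ord0.

Definition hyperbolic_space (R : realType) (n : nat) : set 'rV[R]_n.+1 :=
  [set x | lorentz x x = -1 /\ 0 < x ord0 ord0].

(* Inverse of cosh on [1, +oo[. *)
Definition arcosh (R : realType) (t : R) : R :=
  ln (t + Num.sqrt (t ^+ 2 - 1)).

Definition hdist (R : realType) (n : nat) (x y : 'rV[R]_n.+1) : R :=
  arcosh (- lorentz x y).

Definition hball (R : realType) (n : nat) (p : 'rV[R]_n.+1) (r : R) :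
    set 'rV[R]_n.+1 :=
  [set q | hyperbolic_space q /\ hdist p q < r].

Definition polygonal_length (R : realType) (M : metricType R) (c : R -> M)
    (a b : R) (s : seq R) : R :=
  \sum_(0 <= i < size s)
    mdist (c (nth b (a :: s) i)) (c (nth b (a :: s) i.+1)).

Definition curve_length (R : realType) (M : metricType R) (c : R -> M)
    (a b : R) : \bar R :=
  ereal_sup [set (polygonal_length c a b s)%:E | s in itv_partition a b].

Definition curves (R : realType) (M : metricType R) (x y : M) : set (R -> M) :=
  [set c : R -> M | [/\ {within `[(0 : R), 1], continuous c}, c 0 = x & c 1 = y]].

Definition length_metric (R : realType) (M : metricType R) : Prop :=
  forall x y : M,
    ereal_inf [set curve_length c 0 1 | c in curves x y] = (mdist x y)%:E.

Definition locally_hyperbolic (R : realType) (M : metricType R) (n : nat) :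
    Prop :=
  forall x : M, exists (p : 'rV[R]_n.+1) (r : R) (phi : M -> 'rV[R]_n.+1),
    [/\ hyperbolic_space p, 0 < r,
        set_bij (ball x r) (hball p r) phi &
        forall y z : M, ball x r y -> ball x r z ->
          hdist (phi y) (phi z) = mdist y z].

(* A hyperbolic n-manifold is a Riemannian manifold locally isometric to
   hyperbolic n-space. It is represented by its Riemannian distance, i.e. as a
   length metric space locally isometric to hyperbolic n-space: the local
   isometries are charts that determine the smooth and Riemannian structures.
   Being metric, M is Hausdorff, and being compact, second countable. *)
Definition closed_connected_hyperbolic_manifold (R : realType)
    (M : metricType R) (n : nat) : Prop :=
  [/\ [set: M] !=set0, compact [set: M], connected [set: M],
      length_metric M & locally_hyperbolic M n].

(* ISO(M) *)
Definition isometry_group (R : realType) (M : metricType R) : set (M -> M) :=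
  [set f | bijective f /\ forall x y : M, mdist (f x) (f y) = mdist x y].

(* A totally geodesic immersion S^1 -> M, parametrized proportionally to arc
   length, where S^1 = R / Z and maps on it are 1-periodic maps on R. The image
   of the immersion is the range of c. Constants are excluded by 0 < v. *)
Definition geodesic_immersion_of_circle (R : realType) (M : metricType R)
    (c : R -> M) : Prop :=
  (forall t : R, c (t + 1) = c t) /\
  exists2 v : R, 0 < v &
    forall t : R, exists2 e : R, 0 < e &
      forall s u : R, `|s - t| < e -> `|u - t| < e ->
        mdist (c s) (c u) = v * `|s - u|.

Definition geometric_closed_geodesic (R : realType) (M : metricType R)
    (gamma : set M) : Prop :=
  exists2 c : R -> M, geodesic_immersion_of_circle c & gamma = range c.

(* G_gamma *)
Definition geodesic_stabilizer (R : realType) (M : metricType R)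
    (gamma : set M) : set (M -> M) :=
  [set f | isometry_group f /\ f @` gamma = gamma].

(* o(gamma) = |G_gamma|; fset_set A is empty when A is infinite, so a positive
   value entails that G_gamma is finite. *)
Definition geodesic_order (R : realType) (M : metricType R) (gamma : set M) :
    nat :=
  #|` fset_set (geodesic_stabilizer gamma)|%fset.

(* Main.v *)
(* M is the quotient of hyperbolic space by a lattice G of Lorentz matrices, and
   isometries of M lift to elements of the normalizer of G. Closed geodesics are
   images of axes of elements w <> 1 of G, and a lift E preserving the axis of w
   can be chosen to commute with w or to invert it: one needs w in G such that
   every such E lies in G.

   If a, b are in G and k is large, the axis of w = b a^k follows the axis of a
   during more than half of its period. As E acts on the axis of w by a
   translation or a reflection, it maps some point of this good stretch, modulo
   the period, to another one; so E^-1 a E and a (or a^-1) almost agree there,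
   hence are equal by discreteness. Thus, up to a power of w, an E commuting with
   w commutes with a and b. Iterating over finitely many b such that the points
   o b span the space yields an a whose centralizer in the normalizer lies in G.

   To get rid of inversions, take x in G not commuting with such an a. If the
   geodesics of x a^k and of (x^-1 a x) a^k were both reversed by lifts, there
   would be E inverting a and x, and E' inverting a and x^-1 a x; comparing them
   gives c, d in G commuting with a such that x^-1 c x^-1 = d. Then c x^-1
   commutes with its square c d, hence with a, a contradiction. *)
Require Import Defs.
From mathcomp Require Import all_boot all_order all_algebra finmap.
From mathcomp Require Import all_classical all_reals all_analysis.
From mathcomp Require Import lra.

Set Implicit Arguments.
Unset Strict Implicit.
Unset Printing Implicit Defensive.

Import Order.TTheory GRing.Theory Num.Theory.
Import numFieldNormedType.Exports.

Local Open Scope classical_set_scope.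
Local Open Scope ring_scope.

(** Distances enter as hyperbolic cosines [- [<x, y>]], and a geodesic with ends [p], [q] is
    parametrized by the exponential of arc length. The geometric estimates become polynomial
    inequalities, and a translation multiplies the parameter. A stretch [[u, v]] covers at least
    half of a period when [u ^+ 2 * m <= v ^+ 2]. Half is what is needed: modulo the period a
    translation moves by at most half a period, and the centres of the reflections obtained from one
    of them by powers of [w] are half a period apart.

    The covering map is obtained by continuing charts along the radii from a base point of
    hyperbolic space. That the result does not depend on the path is due to radial projection onto a
    ball being a contraction. Lifts of isometries then come from two facts: local isometries of
    hyperbolic space are matrices, and they are determined by any ball.

    The stabilizer of a closed geodesic is defined through its image as a set, so an isometry in it
    respects no parametrization a priori. A pigeonhole argument on sample points produces a lift
    that preserves the axis. *)

Lemma discriminant_le (R : realFieldType) (A B C : R) :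
  (forall a b : R, 0 <= a ^+ 2 * A + 2 * (a * b) * C + b ^+ 2 * B) ->
  C ^+ 2 <= A * B.
Proof.
move=> H.
have B0 : 0 <= B by have := H 0 1; lra.
have [B1|B1] := ltP 0 B.
  have := H B (- C).
  have -> : B ^+ 2 * A + 2 * (B * - C) * C + (- C) ^+ 2 * B = B * (A * B - C ^+ 2) by lra.
  by rewrite pmulr_rge0// subr_ge0.
have -> : B = 0 by apply/le_anti; rewrite B0 B1.
rewrite mulr0; have [->|C0] := eqVneq C 0; first by rewrite expr0n.
have C2 : 2 * C != 0 by rewrite mulf_neq0// pnatr_eq0.
(* With [B = 0] the form is affine in [b]; this choice gives it the value -1. *)
have := H 1 (- (A + 1) / (2 * C)).
have -> : 2 * (1 * (- (A + 1) / (2 * C))) * C = - (A + 1).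
  by rewrite -[RHS](divfK C2); lra.
by have -> : B = 0; [apply/le_anti; rewrite B0 B1|rewrite mulr0; lra].
Qed.


Local Notation "[< x , y >]" := (lorentz x y) (at level 0, format "[<  x ,  y  >]").

(** * The Lorentz form and the hyperboloid *)

Section Lorentz.
Context {R : realType} {n : nat}.
Local Notation V := 'rV[R]_n.+1.
Local Notation X := (@hyperbolic_space R n).
Implicit Types (x y z u v p q : V) (a : R).

Lemma lfC x y : [<x, y>] = [<y, x>].
Proof.
by rewrite /lorentz mulrC; congr (_ - _); apply: eq_bigr => i _; rewrite mulrC.
Qed.

Lemma lfDl x y z : [<x + y, z>] = [<x, z>] + [<y, z>].
Proof.
rewrite /lorentz mxE mulrDl; under eq_bigr do rewrite mxE mulrDl.
by rewrite big_split/=; lra.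
Qed.

Lemma lfZl a x y : [<a *: x, y>] = a * [<x, y>].
Proof.
rewrite /lorentz mxE mulrBr mulrA mulr_sumr; congr (_ - _).
by apply: eq_bigr => i _; rewrite mxE mulrA.
Qed.

Lemma lfDr x y z : [<x, y + z>] = [<x, y>] + [<x, z>].
Proof. by rewrite lfC lfDl !(lfC _ x). Qed.

Lemma lfZr a x y : [<x, a *: y>] = a * [<x, y>].
Proof. by rewrite lfC lfZl lfC. Qed.

Lemma lfNl x y : [<- x, y>] = - [<x, y>].
Proof. by rewrite -scaleN1r lfZl mulN1r. Qed.

Lemma lfNr x y : [<x, - y>] = - [<x, y>].
Proof. by rewrite lfC lfNl lfC. Qed.

Lemma lfBl x y z : [<x - y, z>] = [<x, z>] - [<y, z>].
Proof. by rewrite lfDl lfNl. Qed.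

Lemma lfBr x y z : [<x, y - z>] = [<x, y>] - [<x, z>].
Proof. by rewrite lfDr lfNr. Qed.

Lemma lf0l x : [<0, x>] = 0.
Proof. by rewrite -(scale0r 0) lfZl mul0r. Qed.

Lemma lf0r x : [<x, 0>] = 0.
Proof. by rewrite lfC lf0l. Qed.

Definition lfE := (lfDl, lfDr, lfBl, lfBr, lfZl, lfZr, lfNl, lfNr, lf0l, lf0r).

Lemma lf_nondeg x : (forall y, [<x, y>] = 0) -> x = 0.
Proof.
move=> H; apply/rowP => j; rewrite mxE.
have := H (delta_mx 0 j); rewrite /lorentz.
case: (unliftP ord0 j) => [i ->|->].
  rewrite (bigD1 i)//= !mxE !eqxx/= mulr1 big1 ?addr0; last first.
    by move=> k ki; rewrite mxE/= (inj_eq lift_inj) (negbTE ki) mulr0.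
  by rewrite mulr0 subr0.
rewrite big1 ?sub0r; last by move=> i _; rewrite mxE/= mulr0.
by rewrite mxE eqxx mulr1 => /eqP; rewrite oppr_eq0 => /eqP.
Qed.

(** The Euclidean product of the space coordinates, written through the form so that [lfE] applies
    to it. *)
Definition spatial x y : R := [<x, y>] + x ord0 ord0 * y ord0 ord0.

Lemma spatial_ge0 x : 0 <= spatial x x.
Proof.
by rewrite /spatial /lorentz subrK; apply: sumr_ge0 => i _; rewrite -expr2 sqr_ge0.
Qed.

Lemma spatial_eq0 x : x ord0 ord0 = 0 -> spatial x x = 0 -> x = 0.
Proof.
rewrite /spatial /lorentz subrK => x0 /eqP; rewrite psumr_eq0; last first.
  by move=> i _; rewrite -expr2 sqr_ge0.
move=> /allP H; apply/rowP => j; rewrite mxE.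
case: (unliftP ord0 j) => [i ->|->//].
have /= := H i (mem_index_enum _); rewrite -expr2 sqrf_eq0 => /eqP <-.
by [].
Qed.

Lemma spatial_CS x y : spatial x y ^+ 2 <= spatial x x * spatial y y.
Proof.
apply: discriminant_le => a b.
have := spatial_ge0 (a *: x + b *: y).
rewrite /spatial !lfE !mxE (lfC y x) => /le_trans; apply.
rewrite le_eqVlt; apply/orP; left; apply/eqP; lra.
Qed.

(** Orthogonality equates [spatial o z] with the product of the time coordinates. Cauchy-Schwarz
    then bounds [spatial z z] by [[<z, z>]] times the squared time coordinate of [o]. *)
Lemma timelike_orth o z : X o -> [<o, z>] = 0 ->
  0 <= [<z, z>] /\ ([<z, z>] = 0 -> z = 0).
Proof.
move=> [oo o0] oz.
have := spatial_CS o z; have := spatial_ge0 z.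
rewrite /spatial oo oz add0r; set s := [<z, z>] + _ => s0 H.
have H2 : s <= o ord0 ord0 ^+ 2 * [<z, z>] by rewrite /s in H *; nra.
have o2 : 0 < o ord0 ord0 ^+ 2 by rewrite exprn_gt0.
split; first by rewrite -(pmulr_rge0 _ o2) (le_trans s0).
move=> zz; have s00 : s = 0.
  by apply/le_anti; rewrite s0 (le_trans H2)// zz mulr0.
have z0 : z ord0 ord0 = 0.
  by move: s00; rewrite /s zz add0r -expr2 => /eqP; rewrite sqrf_eq0 => /eqP.
by apply: spatial_eq0 => //; rewrite /spatial zz z0 mulr0 addr0.
Qed.

Lemma orth_CS o z w : X o -> [<o, z>] = 0 -> [<o, w>] = 0 ->
  [<z, w>] ^+ 2 <= [<z, z>] * [<w, w>].
Proof.
move=> Xo oz ow; apply: discriminant_le => a b.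
have [] := @timelike_orth o (a *: z + b *: w) Xo.
  by rewrite !lfE oz ow !mulr0 addr0.
move=> /le_trans H _; apply: H.
rewrite !lfE (lfC w z) le_eqVlt; apply/orP; left; apply/eqP; lra.
Qed.

(* Points of the hyperboloid and future null vectors at once. *)
Definition causal u := [<u, u>] <= 0 /\ 0 < u ord0 ord0.

Definition null u := [<u, u>] = 0 /\ 0 < u ord0 ord0.

Lemma null_causal u : null u -> causal u.
Proof. by move=> [uu u0]; split; rewrite ?uu. Qed.

Lemma hyp_causal x : X x -> causal x.
Proof. by move=> [xx x0]; split; rewrite ?xx; lra. Qed.

Lemma hyp_self x : X x -> [<x, x>] = -1.
Proof. by case. Qed.

(** The space part of a causal vector is no longer than its time coordinate, so the product of the
    times dominates the spatial product. *)
Lemma causal_ge0 u v : causal u -> causal v -> 0 <= - [<u, v>].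
Proof.
move=> [uu u0] [vv v0]; have := spatial_CS u v.
have := spatial_ge0 u; have := spatial_ge0 v; rewrite /spatial.
move: [<u, v>] [<u, u>] [<v, v>] (u ord0 ord0) (v ord0 ord0) uu vv u0 v0 => c a b s t.
move=> a0 b0 s0 t0 H1 H2 H3.
have st : 0 < s * t by rewrite mulr_gt0.
have : (c + s * t) ^+ 2 <= (s * t) ^+ 2.
  by apply: (le_trans H3); rewrite exprMn -!expr2; apply: ler_pM => //; lra.
rewrite leNgt => H4; apply/negP => c0; move: H4 => /negP; apply.
by rewrite ltr_pXn2r ?nnegrE//; lra.
Qed.

Lemma hyp_causal_gt0 x u : X x -> causal u -> 0 < - [<x, u>].
Proof.
move=> Xx cu; rewrite lt_neqAle (causal_ge0 (hyp_causal Xx) cu) andbT.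
apply/eqP => H; have xu : [<x, u>] = 0 by lra.
have [H1 H2] := timelike_orth Xx xu; case: cu => uu u0.
have u1 : u = 0 by apply: H2; lra.
by move: u0; rewrite u1 mxE ltxx.
Qed.

(** The combination of [u] and [v] with vanishing time coordinate is null, hence zero. *)
Lemma null_orth u v : null u -> null v -> [<u, v>] = 0 ->
  exists2 mu : R, 0 < mu & v = mu *: u.
Proof.
move=> [uu u0] [vv v0] uv; exists (v ord0 ord0 / u ord0 ord0); first by rewrite divr_gt0.
suff : v ord0 ord0 *: u - u ord0 ord0 *: v = 0.
  move=> /eqP; rewrite subr_eq0 => /eqP H.
  by rewrite mulrC -scalerA H scalerA mulVf ?scale1r// gt_eqF.
apply: spatial_eq0; first by rewrite !mxE; lra.
by rewrite /spatial !lfE !mxE uu vv (lfC v) uv; lra.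
Qed.

Lemma hyp_ge1 x y : X x -> X y -> 1 <= - [<x, y>].
Proof.
move=> Xx Xy; have b0 := hyp_causal_gt0 Xx (hyp_causal Xy).
have [|H _] := @timelike_orth x (y + [<x, y>] *: x) Xx.
  by rewrite !lfE (hyp_self Xx); lra.
by move: H; rewrite !lfE (hyp_self Xx) (hyp_self Xy) (lfC y x); nra.
Qed.

Lemma hyp_eq1 x y : X x -> X y -> - [<x, y>] = 1 -> x = y.
Proof.
move=> Xx Xy xy; have {}xy : [<x, y>] = -1 by lra.
have [|_ H] := @timelike_orth x (y - x) Xx.
  by rewrite !lfE (hyp_self Xx) xy; lra.
apply/eqP; rewrite eq_sym -subr_eq0; apply/eqP; apply: H.
by rewrite !lfE (hyp_self Xx) (hyp_self Xy) (lfC y x) xy; lra.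
Qed.

Lemma sqr_le_abs (a b : R) : 0 <= b -> a ^+ 2 <= b ^+ 2 -> - b <= a /\ a <= b.
Proof.
move=> b0 H; split; rewrite leNgt; apply/negP => H1; nra.
Qed.

(* Decomposing along [y]: the orthogonal parts obey Cauchy-Schwarz. *)
Lemma lf_perp x y u : X y ->
  ([<x, u>] + [<x, y>] * [<y, u>]) ^+ 2 <=
  ([<x, x>] + [<x, y>] ^+ 2) * ([<u, u>] + [<y, u>] ^+ 2).
Proof.
move=> Xy.
have := @orth_CS y (x + [<x, y>] *: y) (u + [<y, u>] *: y) Xy.
rewrite !lfE (hyp_self Xy) (lfC y x) (lfC u y).
have -> : [<x, y>] + [<x, y>] * -1 = 0 by lra.
have -> : [<y, u>] + [<y, u>] * -1 = 0 by lra.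
move=> /(_ erefl erefl) H.
apply: le_trans (le_trans H _); rewrite le_eqVlt; apply/orP; left; apply/eqP; lra.
Qed.

Lemma lf_perp_ge0 x y : X y -> 0 <= [<x, x>] + [<x, y>] ^+ 2.
Proof.
move=> Xy; have [|H _] := @timelike_orth y (x + [<x, y>] *: y) Xy.
  by rewrite !lfE (hyp_self Xy) (lfC y x); lra.
by move: H; rewrite !lfE (hyp_self Xy) (lfC y x); lra.
Qed.

(** The inequality cosh (a + b) <= 2 cosh a cosh b, in a form that also admits null vectors at both
    ends. *)
Lemma causal_triangle x y u : causal x -> X y -> causal u ->
  - [<x, u>] <= 2 * ([<x, y>] * [<y, u>]).
Proof.
move=> cx Xy cu; have H := @lf_perp x y u Xy.
have P1 := lf_perp_ge0 x Xy; have := lf_perp_ge0 u Xy.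
rewrite (lfC u y) => P2.
have k0 := causal_ge0 (hyp_causal Xy) cx; rewrite lfC in k0.
have n0 := causal_ge0 (hyp_causal Xy) cu; case: cx cu => xx _ [uu _].
move: H k0 n0 P1 P2 xx uu.
move: [<x, u>] [<x, y>] [<y, u>] [<x, x>] [<u, u>] => xu xy yu xx uu H k0 n0 P1 P2 x0 u0.
have [] // := @sqr_le_abs (xu + xy * yu) (xy * yu); [nra| |lra].
apply: le_trans H _; rewrite exprMn.
by apply: ler_pM => //; lra.
Qed.

(** The triangle inequality for two distances at most r with [b] = cosh r, since cosh 2r = 2 cosh^2
    r - 1. *)
Lemma hyp_close x y z b : X x -> X y -> X z ->
  - [<x, y>] <= b -> - [<y, z>] <= b -> - [<x, z>] <= 2 * b ^+ 2 - 1.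
Proof.
move=> Xx Xy Xz.
have H := @lf_perp x y z Xy; have := hyp_ge1 Xx Xy; have := hyp_ge1 Xy Xz.
move: H; rewrite (hyp_self Xx) (hyp_self Xz).
move: [<x, z>] [<x, y>] [<y, z>] => xz xy yz H H1 H2 H3 H4.
have b2 : 0 <= b ^+ 2 - 1 by nra.
have b3 : 0 <= (b + xy) * (b - xy) by apply: mulr_ge0; lra.
have b4 : 0 <= (b + yz) * (b - yz) by apply: mulr_ge0; lra.
have b5 : 0 <= xy ^+ 2 - 1 by nra.
have b6 : 0 <= yz ^+ 2 - 1 by nra.
have [//||] := @sqr_le_abs (xz + xy * yz) (b ^+ 2 - 1).
  apply: le_trans H _; rewrite [X in _ <= X]expr2; by apply: ler_pM; lra.
by nra.
Qed.

Lemma causal_sign o x : X o -> [<x, x>] <= 0 -> [<o, x>] < 0 -> causal x.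
Proof.
move=> Xo xx ox; split=> //; rewrite ltNge; apply/negP => x0.
have [x1|x1] := ltP (x ord0 ord0) 0.
  have : causal (- x) by split; rewrite ?lfE ?mxE; lra.
  by move=> /(hyp_causal_gt0 Xo); rewrite lfNr opprK; lra.
have x00 : x ord0 ord0 = 0 by lra.
have := spatial_ge0 x; rewrite /spatial x00 mul0r addr0 => x2.
have := @spatial_eq0 x x00; rewrite /spatial x00 mul0r addr0 => H.
by move: ox; rewrite H ?lf0r ?ltxx//; lra.
Qed.

Lemma hyp_scale o z t : X o -> [<o, z>] = 0 ->
  X (Num.sqrt (1 + t ^+ 2 * [<z, z>]) *: o + t *: z).
Proof.
move=> Xo oz; have [zz _] := timelike_orth Xo oz.
have H0 : 0 <= t ^+ 2 * [<z, z>] by rewrite mulr_ge0 ?sqr_ge0.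
have H1 : 0 <= 1 + t ^+ 2 * [<z, z>] by lra.
set s := Num.sqrt _.
have ss : s ^+ 2 = 1 + t ^+ 2 * [<z, z>] by rewrite sqr_sqrtr.
have s0 : 0 <= s by rewrite sqrtr_ge0.
(* The body must stay hidden: [rewrite lfE] would unfold a local definition. *)
have [w wE] : exists w, w = s *: o + t *: z := ex_intro _ _ erefl.
have xx : [<w, w>] = -1 by rewrite wE !lfE (hyp_self Xo) (lfC z o) oz; lra.
have ow : - [<o, w>] = s by rewrite wE !lfE oz (hyp_self Xo); lra.
have s1 : 0 < s by rewrite lt_neqAle s0 andbT; apply/eqP => s00; move: ss; rewrite -s00; lra.
by rewrite -wE; split=> //; have [] // := @causal_sign o w Xo; lra.
Qed.

End Lorentz.

(** * Isometries of hyperbolic space as matrices *)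

Section Isometries.
Context {R : realType} {n : nat}.
Local Notation V := 'rV[R]_n.+1.
Local Notation X := (@hyperbolic_space R n).
Implicit Types (x y z u v p q : V) (a : R) (g h : 'M[R]_n.+1).

(** Vectors are rows and matrices act on the right, so [g * h] applies [g] first. The second clause
    keeps the two sheets from being exchanged. *)
Definition isol g := (forall x y, [<x *m g, y *m g>] = [<x, y>]) /\
  (forall x, X x -> X (x *m g)).

Lemma actM x g h : x *m (g * h) = x *m g *m h.
Proof. exact: mulmxA. Qed.

Lemma act1 x : x *m (1 : 'M[R]_n.+1) = x.
Proof. exact: mulmx1. Qed.

Lemma isol_lf g x y : isol g -> [<x *m g, y *m g>] = [<x, y>].
Proof. by case. Qed.

Lemma isol_hyp g x : isol g -> X x -> X (x *m g).
Proof. by case=> _; apply. Qed.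

Lemma lf_unit g : (forall x y, [<x *m g, y *m g>] = [<x, y>]) -> g \is a GRing.unit.
Proof.
move=> H; rewrite -[_ \is a _]/(g \in unitmx) -row_free_unit.
apply: inj_row_free => v vg; apply: lf_nondeg => y.
by rewrite -H vg lf0l.
Qed.

Lemma isol_unit g : isol g -> g \is a GRing.unit.
Proof. by case=> /lf_unit. Qed.

Lemma actK g x : isol g -> x *m g *m g^-1 = x.
Proof. by move=> /isol_unit gu; rewrite -actM divrr// act1. Qed.

Lemma actVK g x : isol g -> x *m g^-1 *m g = x.
Proof. by move=> /isol_unit gu; rewrite -actM mulVr// act1. Qed.

Lemma isol_intro g p : (forall x y, [<x *m g, y *m g>] = [<x, y>]) ->
  X p -> X (p *m g) -> isol g.
Proof.
move=> H Xp Xpg; split=> // x Xx.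
have [] // := @causal_sign _ _ (p *m g) (x *m g) Xpg.
- by rewrite H (hyp_self Xx); lra.
- by rewrite H; have := hyp_ge1 Xp Xx; lra.
by move=> _ x0; split=> //; rewrite H (hyp_self Xx).
Qed.

Lemma isol1 : isol 1.
Proof. by split=> *; rewrite !act1. Qed.

Lemma isolM g h : isol g -> isol h -> isol (g * h).
Proof.
move=> [g1 g2] [h1 h2]; split=> [x y|x Xx]; first by rewrite !actM h1 g1.
by rewrite actM; apply/h2/g2.
Qed.

Lemma isolV g : isol g -> isol g^-1.
Proof.
move=> ig; have H x y : [<x *m g^-1, y *m g^-1>] = [<x, y>].
  by rewrite -(isol_lf _ _ ig) !actVK.
split=> // x Xx.
have Xxg := isol_hyp ig Xx.
have [| |c1 c2] := @causal_sign _ _ x (x *m g^-1) Xx.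
- by rewrite H (hyp_self Xx); lra.
- rewrite -(isol_lf _ _ ig) actVK//.
  by have := hyp_ge1 Xxg Xx; lra.
by split=> //; rewrite H (hyp_self Xx).
Qed.

Lemma isolX g k : isol g -> isol (g ^+ k).
Proof.
move=> ig; elim: k => [|k IH]; first by rewrite expr0; exact: isol1.
by rewrite exprS; apply: isolM.
Qed.

Lemma isol_exprz g (k : int) : isol g -> isol (g ^ k).
Proof.
move=> ig; case: k => k; first exact: isolX.
by rewrite NegzE -exprnN; apply/isolV/isolX.
Qed.

Lemma lf_moveV g x y : isol g -> [<x *m g, y>] = [<x, y *m g^-1>].
Proof. by move=> ig; rewrite -[in RHS](isol_lf _ _ ig) actVK. Qed.

Lemma exists_hyp : exists x, X x.
Proof.
exists (delta_mx 0 0); split; last by rewrite mxE ltr01.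
by rewrite /lorentz big1 ?sub0r => [|i _]; rewrite !mxE /= ?mulr1// mulr0.
Qed.

Lemma isol_null g u : isol g -> null u -> null (u *m g).
Proof.
move=> ig nu; have [e0 Xo] := exists_hyp.
have [] // := @causal_sign _ _ (e0 *m g) (u *m g) (isol_hyp ig Xo).
- by rewrite isol_lf//; case: nu => ->.
- by rewrite isol_lf//; have := hyp_causal_gt0 Xo (null_causal nu); lra.
by move=> _ u0; split=> //; rewrite isol_lf//; case: nu.
Qed.

Lemma lf_suml (I : finType) (F : I -> V) y : [<\sum_i F i, y>] = \sum_i [<F i, y>].
Proof.
elim/big_rec2 : _ => [|i a c _ <-]; first by rewrite lf0l.
by rewrite lfDl.
Qed.

(** Any ball spans the whole space: the part of [v] orthogonal to [p] is shrunk by [t] until the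
    point of the hyperboloid above it lies in the ball. *)
Lemma ball_comb p v b : X p -> 1 < b ->
  exists x c d, [/\ X x, - [<p, x>] < b & v = c *: x + d *: p].
Proof.
move=> Xp b1; have [z zE] : exists z, z = v + [<v, p>] *: p := ex_intro _ _ erefl.
have pz : [<p, z>] = 0 by rewrite zE !lfE (hyp_self Xp) (lfC v); lra.
have [zz _] := timelike_orth Xp pz.
pose t := (b - 1) / ([<z, z>] + 1 + (b - 1)).
have D0 : 0 < [<z, z>] + 1 + (b - 1) by lra.
have t0 : 0 < t by rewrite divr_gt0//; lra.
have tD : t * ([<z, z>] + 1 + (b - 1)) = b - 1 by rewrite divfK ?gt_eqF.
have t1 : t <= 1 by nra.
have := @hyp_scale _ _ p z t Xp pz.
set s := Num.sqrt _ => Xx.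
have ss : s ^+ 2 = 1 + t ^+ 2 * [<z, z>].
  by rewrite sqr_sqrtr// addr_ge0// mulr_ge0// sqr_ge0.
have s0 : 0 <= s by rewrite sqrtr_ge0.
exists (s *: p + t *: z), t^-1, (- t^-1 * s - [<v, p>]); split=> //.
  rewrite !lfE pz (hyp_self Xp).
  suff : s < b by lra.
  have tz : t * [<z, z>] < b - 1 by nra.
  have : s ^+ 2 < b ^+ 2 by nra.
  by nra.
rewrite scalerDr !scalerA mulVf ?gt_eqF// scale1r zE.
by apply/rowP => j; rewrite !mxE; lra.
Qed.

Lemma isol_ext g h p b : X p -> 1 < b ->
  (forall x, X x -> - [<p, x>] < b -> x *m g = x *m h) -> g = h.
Proof.
move=> Xp b1 H; apply/row_matrixP => i; rewrite !rowE.
have [x [c [d [Xx xb ->]]]] := ball_comb (delta_mx 0 i) Xp b1.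
rewrite !mulmxDl -!scalemxAl !H//.
by rewrite (hyp_self Xp); lra.
Qed.

(** Writing a vector as a combination of [p] and a point of the ball prescribes an image [G v]; what
    matters is that its product with every [f y] is [[<v, y>]]. The matrix with rows the images of
    the basis vectors inherits this, so it preserves the form, and nondegeneracy makes it agree with
    [f]. *)
Lemma rigidity (f : V -> V) p b : X p -> 1 < b ->
  (forall x, X x -> - [<p, x>] < b -> X (f x)) ->
  (forall x y, X x -> X y -> - [<p, x>] < b -> - [<p, y>] < b ->
     [<f x, f y>] = [<x, y>]) ->
  exists2 g, isol g & forall x, X x -> - [<p, x>] < b -> f x = x *m g.
Proof.
move=> Xp b1 fX fi.
have pb : - [<p, p>] < b by rewrite (hyp_self Xp); lra.
have E v : exists G : V, (forall y, X y -> - [<p, y>] < b -> [<G, f y>] = [<v, y>])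
    /\ exists x c d, [/\ X x, - [<p, x>] < b & G = c *: f x + d *: f p].
  have [x [c [d [Xx xb vE]]]] := ball_comb v Xp b1.
  exists (c *: f x + d *: f p); split; last by exists x, c, d.
  by move=> y Xy yb; rewrite vE !lfE !fi.
have [G GP] := choice E.
pose g : 'M[R]_n.+1 := \matrix_i G (delta_mx 0 i).
have gf v y : X y -> - [<p, y>] < b -> [<v *m g, f y>] = [<v, y>].
  move=> Xy yb; rewrite [v in RHS]row_sum_delta mulmx_sum_row !lf_suml.
  apply: eq_bigr => i _; rewrite rowK !lfZl; congr (_ * _).
  by have [->] := GP (delta_mx 0 i).
have gi x y : [<x *m g, y *m g>] = [<x, y>].
  rewrite [y *m g]mulmx_sum_row [y in RHS]row_sum_delta lfC (lfC x) !lf_suml.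
  apply: eq_bigr => i _; rewrite rowK !lfZl; congr (_ * _).
  have [H [z [c [d [Xz zb E']]]]] := GP (delta_mx 0 i).
  rewrite lfC E' !lfDr !lfZr !gf//.
  have [w [c' [d' [Xw wb xE]]]] := ball_comb x Xp b1.
  have -> : [<delta_mx 0 i, x>] = c' * [<G (delta_mx 0 i), f w>] + d' * [<G (delta_mx 0 i), f p>].
    by rewrite !H// xE !lfE.
  rewrite E' xE !lfE !fi//.
  by rewrite (lfC w z) (lfC p z) (lfC w p); lra.
have gE x : X x -> - [<p, x>] < b -> f x = x *m g.
  move=> Xx xb; apply/eqP; rewrite -subr_eq0; apply/eqP; apply: lf_nondeg => y.
  have gu := lf_unit gi.
  have -> : y = y *m g^-1 *m g by rewrite -actM mulVr// act1.
  by rewrite lfBl (lfC (f x)) gf// gi (lfC x) subrr.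
exists g => //; apply: (isol_intro gi Xp).
by rewrite -gE//; apply: fX.
Qed.

(** For distinct points the witness is the reflection in the hyperplane orthogonal to the spacelike
    vector [p - q]. *)
Lemma isol_transitive p q : X p -> X q -> exists2 g, isol g & p *m g = q.
Proof.
move=> Xp Xq; have [pq|pq] := eqVneq p q.
  by exists 1; [exact: isol1|rewrite act1].
have [u uE] : exists u, u = p - q := ex_intro _ _ erefl.
have b1 := hyp_ge1 Xp Xq.
have uu : [<u, u>] = 2 * (- [<p, q>] - 1).
  by rewrite uE !lfE (hyp_self Xp) (hyp_self Xq) (lfC q); lra.
have b2 : - [<p, q>] != 1 by apply: contra_neq pq; apply: hyp_eq1.
have b3 : 1 < - [<p, q>] by rewrite lt_neqAle eq_sym b2 b1.
have u0 : 0 < [<u, u>] by lra.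
pose k x := 2 * [<x, u>] / [<u, u>].
have kE x : k x * [<u, u>] = 2 * [<x, u>] by rewrite /k divfK// gt_eqF.
pose g : 'M[R]_n.+1 := \matrix_i (delta_mx 0 i - k (delta_mx 0 i) *: u).
have gE x : x *m g = x - k x *: u.
  rewrite mulmx_sum_row [in RHS](row_sum_delta x) /k lf_suml mulr_sumr mulr_suml.
  rewrite scaler_suml -sumrB; apply: eq_bigr => i _.
  rewrite rowK lfZl scalerBr scalerA; congr (_ - _ *: _).
  by rewrite /k; lra.
have gi x y : [<x *m g, y *m g>] = [<x, y>].
  rewrite !gE !lfE (lfC u y).
  have := congr1 (fun c => k y * c) (kE x); have := congr1 (fun c => k x * c) (kE y).
  by rewrite /=; lra.
have pg : p *m g = q.
  have k1 : k p = 1.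
    by apply: (mulIf (lt0r_neq0 u0)); rewrite kE mul1r uu uE !lfE (hyp_self Xp); lra.
  by rewrite gE k1 scale1r uE opprB addrC subrK.
by exists g => //; apply: (isol_intro gi Xp); rewrite pg.
Qed.

End Isometries.

(** * Growth of powers *)

Section PowerLemmas.
Context {R : realType}.
Implicit Types l x y C r t : R.

Lemma bernoulli l k : 1 <= l -> 1 + k%:R * (l - 1) <= l ^+ k.
Proof.
move=> l1; elim: k => [|k IH]; first by rewrite expr0; lra.
rewrite exprS -natr1; have k0 : 0 <= k%:R :> R by rewrite ler0n.
have k1 : 0 <= k%:R * (l - 1) ^+ 2 by rewrite mulr_ge0// sqr_ge0.
have := ler_wpM2l (le_trans ler01 l1) IH; nra.
Qed.

Lemma pow_large l C : 1 < l -> exists K, forall k, (K <= k)%N -> C <= l ^+ k.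
Proof.
move=> l1; exists (Num.bound (`|C| / (l - 1))) => k Kk.
have l0 : 0 < l - 1 by lra.
apply: (le_trans _ (bernoulli k (ltW l1))).
have : `|C| / (l - 1) < k%:R.
  apply: (@lt_le_trans _ _ (Num.bound (`|C| / (l - 1)))%:R).
    by rewrite archi_boundP// divr_ge0// ltW.
  by rewrite ler_nat.
by rewrite ltr_pdivrMr//; have := ler_norm C; lra.
Qed.

(** Brings [x] into a fundamental domain of multiplication by [l]; later this corrects a lift by a
    power of [w]. The exponent is the least one reaching [y], counted from a power that is small
    enough. *)
Lemma pow_adjust l x y : 1 < l -> 0 < x -> 0 < y ->
  exists j : int, y <= x * l ^ j /\ x * l ^ j < y * l.
Proof.
move=> l1 x0 y0; have l0 : 0 < l by lra.
have [N NP] := pow_large (x / y + 1) l1.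
have {}NP := NP N (leqnn N).
have lN : 0 < l ^+ N by rewrite exprn_gt0.
have xN : x / l ^+ N < y.
  rewrite ltr_pdivrMr// mulrC -ltr_pdivrMr//; lra.
have xN0 : 0 < x / l ^+ N by rewrite divr_gt0.
have ex : exists m, y <= x / l ^+ N * l ^+ m.
  have [m mP] := pow_large (y / (x / l ^+ N)) l1.
  by exists m; rewrite mulrC -ler_pdivrMr//; exact: mP.
case: (ex_minnP ex) => -[|m] mP min; first by move: mP; rewrite expr0; lra.
have E : x * l ^ (m.+1%:Z - N%:Z) = x / l ^+ N * l ^+ m.+1.
  by rewrite expfzDr ?gt_eqF// -exprnP -exprnN mulrA -mulrA mulrC; lra.
exists (m.+1%:Z - N%:Z); rewrite E; split=> //.
have : ~~ (y <= x / l ^+ N * l ^+ m) by apply/negP => /min; rewrite ltnn.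
by rewrite -ltNge exprS => H; have := ltr_pM2r l0 (x / l ^+ N * l ^+ m) y; rewrite H; lra.
Qed.

(** Constants disappear when growth rates are compared; this converts the growth of an orbit into a
    bound on a translation length. *)
Lemma pow_le_base r t C : 0 < r -> 0 < t -> (forall i, r ^+ i <= C * t ^+ i) -> r <= t.
Proof.
move=> r0 t0 H; rewrite leNgt; apply/negP => tr.
have [|K KP] := @pow_large (r / t) (C + 1).
  by rewrite ltr_pdivlMr// mul1r.
have := KP K (leqnn K); have := H K; rewrite expr_div_n.
have tK : 0 < t ^+ K by rewrite exprn_gt0.
by rewrite ler_pdivlMr//; nra.
Qed.

End PowerLemmas.

(** * Axes of hyperbolic isometries *)

Section Axis.
Context {R : realType} {n : nat}.
Local Notation V := 'rV[R]_n.+1.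
Local Notation X := (@hyperbolic_space R n).
Implicit Types (x y z u v p q : V) (l s t k : R) (a b g h : 'M[R]_n.+1).

(** The normalization puts [s *: p + s^-1 *: q] on the hyperboloid for every positive [s]. *)
Definition null_pair p q := [/\ null p, null q & [<p, q>] = - 2^-1].

(* [s |-> gpt p q s] is the geodesic with end points [p], [q], its unit speed
   parameter being [ln s]. *)
Definition gpt p q s := s *: p + s^-1 *: q.

(** [p] is the attracting end, [q] the repelling one, and [l] is the exponential of the translation
    length. *)
Definition axis a p q l :=
  [/\ null_pair p q, 1 < l, p *m a = l *: p & q *m a = l^-1 *: q].

Lemma null_pairC p q : null_pair p q -> null_pair q p.
Proof. by case=> np nq pq; split=> //; rewrite lfC. Qed.

Lemma gptC p q s : gpt q p s = gpt p q s^-1.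
Proof. by rewrite /gpt invrK addrC. Qed.

Lemma lf_gpt p q s t : null_pair p q -> 0 < s -> 0 < t ->
  - [<gpt p q s, gpt p q t>] = (s / t + t / s) / 2.
Proof.
move=> [[pp _] [qq _] pq] s0 t0.
by rewrite /gpt !lfE pp qq (lfC q) pq; lra.
Qed.

Lemma gpt_hyp p q s : null_pair p q -> 0 < s -> X (gpt p q s).
Proof.
move=> npq s0; have := lf_gpt npq s0 s0; rewrite divff ?gt_eqF// => H.
split; first by lra.
case: npq => [[_ p0] [_ q0] _]; rewrite !mxE.
by rewrite addr_gt0// mulr_gt0// invr_gt0.
Qed.

Lemma gpt1 p q : gpt p q 1 = p + q.
Proof. by rewrite /gpt invr1 !scale1r. Qed.

Lemma gpt_act g p q p' q' s t : p *m g = t *: p' -> q *m g = t^-1 *: q' ->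
  gpt p q s *m g = gpt p' q' (s * t).
Proof. by move=> pg qg; rewrite /gpt mulmxDl -!scalemxAl pg qg !scalerA invfM. Qed.

Lemma gpt_axis a p q l s : axis a p q l -> gpt p q s *m a = gpt p q (s * l).
Proof. by case=> _ _; exact: gpt_act. Qed.

Lemma eig_inv g v k : isol g -> k != 0 -> v *m g = k *: v -> v *m g^-1 = k^-1 *: v.
Proof.
move=> ig k0 H; rewrite -[in LHS](scale1r v) -(mulVf k0) -scalerA -H.
by rewrite -scalemxAl actK.
Qed.

Lemma axisV a p q l : isol a -> axis a p q l -> axis a^-1 q p l.
Proof.
move=> ia [npq l1 pa qa]; have l0 : l != 0 by rewrite gt_eqF//; lra.
split=> //; first exact: null_pairC.
  by rewrite (eig_inv ia _ qa) ?invr_eq0// invrK.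
by rewrite (eig_inv ia l0 pa).
Qed.

Lemma eig_act g v k m : v *m g = k *: v -> v *m g ^+ m = k ^+ m *: v.
Proof.
move=> H; elim: m => [|m IH]; first by rewrite !expr0 act1 scale1r.
by rewrite !exprS actM H -scalemxAl IH scalerA.
Qed.

Lemma axisX a p q l m : (0 < m)%N -> axis a p q l -> axis (a ^+ m) p q (l ^+ m).
Proof.
move=> m0 [npq l1 pa qa]; split=> //; first by rewrite exprn_egt1// -lt0n.
  exact: eig_act.
by rewrite -exprVn; exact: eig_act.
Qed.

(** Invariance of the form gives [[<p, v>] = k * l * [<p, v>]], so [v] is orthogonal to [p], and
    orthogonal null vectors are proportional. *)
Lemma eig_p a p q l v k : isol a -> axis a p q l -> null v -> v *m a = k *: v ->
  k * l != 1 -> exists2 t, 0 < t & v = t *: p.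
Proof.
move=> ia [[np _ _] _ pa _] nv va kl; apply: null_orth => //.
have := isol_lf p v ia; rewrite pa va !lfE => H.
have /eqP : [<p, v>] * (k * l - 1) = 0 by lra.
by rewrite mulf_eq0 => /orP[/eqP//|]; rewrite subr_eq0 (negbTE kl).
Qed.

Lemma eig_q a p q l v k : isol a -> axis a p q l -> null v -> v *m a = k *: v ->
  k != l -> exists2 t, 0 < t & v = t *: q.
Proof.
move=> ia ax nv va kl; have [_ l1 _ _] := ax.
have [k0|k0] := eqVneq k 0.
  have : null (v *m a) by apply: isol_null.
  by rewrite va k0 scale0r => -[_]; rewrite mxE ltxx.
apply: (@eig_p a^-1 q p l v k^-1); [exact: isolV|exact: axisV|by []| |].
  exact: eig_inv.
apply: contra kl => /eqP H; rewrite eq_sym; apply/eqP.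
by rewrite -[LHS]mul1r -(mulfV k0) -mulrA H mulr1.
Qed.

Lemma act_pair g p q p' q' t t' : isol g -> null_pair p q -> null_pair p' q' ->
  p *m g = t *: p' -> q *m g = t' *: q' -> t' = t^-1.
Proof.
move=> ig [_ _ pq] [_ _ pq'] pg qg; have := isol_lf p q ig.
rewrite pg qg !lfE pq pq' => H; have tt : t' * t = 1 by lra.
have t0 : t != 0 by apply: contra_eq_neq tt => ->; rewrite mulr0 eq_sym oner_neq0.
by rewrite -[LHS]mulr1 -(mulfV t0) mulrA tt mul1r.
Qed.

(** [g] preserves the null eigenvectors of [a] together with their eigenvalues, which tell [p] from
    [q]; the two factors are inverse because [[<p, q>]] is preserved. *)
Lemma commute_axis a g p q l : isol a -> isol g -> axis a p q l -> a * g = g * a ->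
  exists2 t, 0 < t & p *m g = t *: p /\ q *m g = t^-1 *: q.
Proof.
move=> ia ig ax ag; have [npq l1 pa qa] := ax; have [np nq _] := npq.
have [| |t t0 pt] := @eig_p a p q l (p *m g) l ia ax (isol_null ig np).
  by rewrite -actM -ag actM pa scalemxAl.
  by rewrite gt_eqF//; nra.
have [| |t' _ qt] := @eig_q a p q l (q *m g) l^-1 ia ax (isol_null ig nq).
  by rewrite -actM -ag actM qa scalemxAl.
  by rewrite lt_eqF//; apply: (@lt_trans _ _ 1) => //; rewrite invf_lt1//; lra.
by exists t => //; rewrite -(act_pair ig npq npq pt qt).
Qed.

Lemma invert_axis a g p q l : isol a -> isol g -> axis a p q l ->
  a * g = g * a^-1 -> exists2 t, 0 < t & p *m g = t *: q /\ q *m g = t^-1 *: p.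
Proof.
move=> ia ig ax ag; have [npq l1 pa qa] := ax; have [np nq _] := npq.
have [_ _ qaV paV] := axisV ia ax.
have ll : l != l^-1 by rewrite gt_eqF//; apply: (@lt_trans _ _ 1) => //; rewrite invf_lt1//; lra.
have iaV := isolV ia.
have [| |t t0 pt] := @eig_p a^-1 q p l (p *m g) l iaV (axisV ia ax) (isol_null ig np).
  by rewrite -actM -ag actM pa scalemxAl.
  by rewrite gt_eqF//; nra.
have [| |t' _ qt] := @eig_q a^-1 q p l (q *m g) l^-1 iaV (axisV ia ax) (isol_null ig nq).
  by rewrite -actM -ag actM qa scalemxAl.
  by rewrite eq_sym.
by exists t => //; rewrite -(act_pair ig npq (null_pairC npq) pt qt).
Qed.

End Axis.

(** * How long the axis of b a^k follows the axis of a *)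

Section Shadow.
Context {R : realType} {n : nat}.
Local Notation V := 'rV[R]_n.+1.
Local Notation X := (@hyperbolic_space R n).
Implicit Types (x y z u v p q : V) (l s t k : R) (a b g h : 'M[R]_n.+1).

(* Lorentz product of the components orthogonal to the plane of [p] and [q]. *)
Definition perp_lf p q x y :=
  [<x, y>] + 2 * ([<x, q>] * [<y, p>]) + 2 * ([<x, p>] * [<y, q>]).

Lemma perp_lfE p q x : null_pair p q ->
  let P z := z + (2 * [<z, q>]) *: p + (2 * [<z, p>]) *: q in
  [<gpt p q 1, P x>] = 0 /\ forall y, [<P x, P y>] = perp_lf p q x y.
Proof.
move=> [[pp _] [qq _] pq] P; rewrite /P gpt1 /perp_lf; split.
  by rewrite !lfE pp qq (lfC q p) pq (lfC p x) (lfC q x); lra.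
move=> y; rewrite !lfE pp qq (lfC q p) pq (lfC p y) (lfC q y); lra.
Qed.

Lemma perp_lf_ge0 p q x : null_pair p q -> 0 <= perp_lf p q x x.
Proof.
move=> npq; have [H1 H2] := perp_lfE x npq.
by have [] := timelike_orth (gpt_hyp npq ltr01) H1; rewrite H2.
Qed.

Lemma perp_lf_CS p q x y : null_pair p q ->
  perp_lf p q x y ^+ 2 <= perp_lf p q x x * perp_lf p q y y.
Proof.
move=> npq; have [H1 H2] := perp_lfE x npq; have [H3 H4] := perp_lfE y npq.
by rewrite -!H2 -H4; apply: orth_CS (gpt_hyp npq ltr01) _ _.
Qed.

(** Compares applying [a] with moving by [l] along another geodesic. Along the plane of [p] and [q]
    the product of the two points is an explicit polynomial in the products of the ends; the
    perpendicular part is handled by Cauchy-Schwarz. The error is small at parameters where the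
    geodesic is close to the axis of [a]. *)
Lemma shadow_core a p q l p' q' s : isol a -> axis a p q l -> null_pair p' q' ->
  0 < s ->
  - [<gpt p' q' s *m a, gpt p' q' (s * l)>] <=
  1 + 16 * l ^+ 2 * (s ^+ 2 * ([<p', p>] * [<p', q>]) +
     s^-1 ^+ 2 * ([<q', p>] * [<q', q>]) + [<p', p>] * [<q', q>]).
Proof.
move=> ia ax npq' s0; have [npq l1 pa qa] := ax.
have l0 : 0 < l by lra.
have l0' : l != 0 by rewrite gt_eqF.
have [np nq pq] := npq; have [np' nq' pq'] := npq'.
have P1 := causal_ge0 (null_causal np') (null_causal np).
have P2 := causal_ge0 (null_causal np') (null_causal nq).
have Q1 := causal_ge0 (null_causal nq') (null_causal np).
have Q2 := causal_ge0 (null_causal nq') (null_causal nq).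
(* This is the tangent vector at parameter [s]. Positivity of its perpendicular part gives
   [4 * (C + E) <= 1 + 4 * (A + B)] below, the origin of the leading [1] in the bound. *)
have H1 := perp_lf_ge0 (s *: p' - s^-1 *: q') npq.
have [x xE] : exists x, x = gpt p' q' s *m a := ex_intro _ _ erefl.
have [y yE] : exists y, y = gpt p' q' (s * l) := ex_intro _ _ erefl.
have H2 := perp_lf_CS x y npq.
have Xx : X x by rewrite xE; apply/isol_hyp/gpt_hyp.
have Xy : X y by rewrite yE; apply: gpt_hyp => //; rewrite mulr_gt0.
have xq : [<x, q>] = l * (s * [<p', q>] + s^-1 * [<q', q>]).
  by rewrite xE lf_moveV// (eig_inv ia _ qa) ?invr_eq0// invrK /gpt !lfE; lra.
have xp : [<x, p>] = l^-1 * (s * [<p', p>] + s^-1 * [<q', p>]).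
  by rewrite xE lf_moveV// (eig_inv ia _ pa)// /gpt !lfE; lra.
have yq : [<y, q>] = s * l * [<p', q>] + s^-1 * l^-1 * [<q', q>].
  by rewrite yE /gpt !lfE invfM; lra.
have yp : [<y, p>] = s * l * [<p', p>] + s^-1 * l^-1 * [<q', p>].
  by rewrite yE /gpt !lfE invfM; lra.
rewrite -xE -yE.
have xy : - [<x, y>] = 2 * ([<x, q>] * [<y, p>]) + 2 * ([<x, p>] * [<y, q>]) - perp_lf p q x y.
  by rewrite /perp_lf; lra.
have px : perp_lf p q x x = 4 * ([<x, q>] * [<x, p>]) - 1.
  by rewrite /perp_lf (hyp_self Xx); lra.
have py : perp_lf p q y y = 4 * ([<y, p>] * [<y, q>]) - 1.
  by rewrite /perp_lf (hyp_self Xy); lra.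
have H3 := perp_lf_ge0 x npq; have H4 := perp_lf_ge0 y npq.
move: H1 H2 H3 H4; rewrite xy px py xp xq yp yq.
move: (perp_lf p q x y) => W; rewrite /perp_lf.
clear px py xp xq yp yq xy Xx Xy xE yE.
case: np' nq' => [pp' _] [qq' _].
rewrite !lfE pp' qq' (lfC q' p') pq'.
have su : s * s^-1 = 1 by rewrite divff// gt_eqF.
have lm : l * l^-1 = 1 by rewrite divff// gt_eqF.
have u0 : 0 < s^-1 by rewrite invr_gt0.
have m0 : 0 < l^-1 by rewrite invr_gt0.
have m1 : l^-1 <= 1 by rewrite invf_le1//; lra.
move: s^-1 l^-1 su lm u0 m0 m1 P1 P2 Q1 Q2.
move: [<p', p>] [<p', q>] [<q', p>] [<q', q>] => c1 c2 d1 d2 w m su lm w0 m0 m1 P1 P2 Q1 Q2.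
have [A AE] : exists A, A = s ^+ 2 * (c1 * c2) := ex_intro _ _ erefl.
have [B BE] : exists B, B = w ^+ 2 * (d1 * d2) := ex_intro _ _ erefl.
have [C CE] : exists C, C = c1 * d2 := ex_intro _ _ erefl.
have [E EE] : exists E, E = c2 * d1 := ex_intro _ _ erefl.
have A0 : 0 <= A by rewrite AE mulr_ge0 ?sqr_ge0//; nra.
have B0 : 0 <= B by rewrite BE mulr_ge0 ?sqr_ge0//; nra.
have C0 : 0 <= C by nra.
have E0 : 0 <= E by nra.
rewrite -AE -BE -CE => H1 H2 H3 H4.
have e1 : l * (s * c2 + w * d2) * (s * l * c1 + w * m * d1) =
    l ^+ 2 * A + E + l ^+ 2 * C + B.
  transitivity (l ^+ 2 * A + (s * w) * (l * m) * E + l ^+ 2 * (s * w) * C + (l * m) * B).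
    by rewrite AE BE CE EE; lra.
  by rewrite su lm; clear; lra.
have e2 : m * (s * c1 + w * d1) * (s * l * c2 + w * m * d2) =
    A + E + m ^+ 2 * C + m ^+ 2 * B.
  transitivity ((l * m) * A + (s * w) * (l * m) * E + m ^+ 2 * (s * w) * C + m ^+ 2 * B).
    by rewrite AE BE CE EE; clear; lra.
  by rewrite su lm; clear; lra.
have e3 : l * (s * c2 + w * d2) * (m * (s * c1 + w * d1)) = A + B + C + E.
  transitivity ((l * m) * (A + B + (s * w) * (C + E))).
    by rewrite AE BE CE EE; clear; lra.
  by rewrite su lm; clear; lra.
have e4 : (s * l * c1 + w * m * d1) * (s * l * c2 + w * m * d2) =
   l ^+ 2 * A + m ^+ 2 * B + C + E.
  transitivity (l ^+ 2 * A + m ^+ 2 * B + (s * w) * (l * m) * (C + E)).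
    by rewrite AE BE CE EE; clear; lra.
  by rewrite su lm; clear; lra.
have h1 : 4 * (C + E) <= 1 + 4 * (A + B).
  have : 0 <= (s * w) * 1 + 4 * (A + B) - (s * w) * 4 * (C + E).
    by rewrite AE BE CE EE; move: H1; clear; lra.
  by rewrite su; clear; lra.
rewrite e1 e2; rewrite e3 e4 in H2; rewrite e3 in H3; rewrite e4 in H4.
clear e1 e2 e3 e4 AE BE CE EE H1 su lm.
have l2 : 1 <= l ^+ 2 by nra.
have m2 : m ^+ 2 <= 1 by nra.
have l2A := ler_wpM2r A0 l2; have l2B := ler_wpM2r B0 l2.
have l2C := ler_wpM2r C0 l2.
have m2C := ler_wpM2r C0 m2; have m2B := ler_wpM2r B0 m2.
(* The squares of the two perpendicular parts are at most [8 * (A + B)] and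
   [8 * l ^+ 2 * (A + B)]. *)
have h2 : W ^+ 2 <= (8 * l * (A + B)) ^+ 2.
  apply: le_trans H2 _.
  have -> : (8 * l * (A + B)) ^+ 2 = (8 * (A + B)) * (8 * l ^+ 2 * (A + B)) by clear; lra.
  by clear -H3 H4 h1 l2A l2B l2C m2C m2B A0 B0 C0 E0; apply: ler_pM; lra.
have [|h3 _] := sqr_le_abs _ h2; first by rewrite !mulr_ge0 ?addr_ge0// ltW.
have h4 : l * (A + B) <= l ^+ 2 * (A + B).
  by have : 0 <= l * (A + B) * (l - 1); [apply: mulr_ge0; [rewrite mulr_ge0 ?addr_ge0// ltW|rewrite subr_ge0 ltW]|clear; lra].
by clear -h1 h3 h4 l2A l2B l2C m2C m2B A0 B0 C0; lra.
Qed.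

End Shadow.

(** * Displacement and the translation length of b a^k *)

Section Displacement.
Context {R : realType} {n : nat}.
Local Notation V := 'rV[R]_n.+1.
Local Notation X := (@hyperbolic_space R n).
Implicit Types (x y z u v p q : V) (l s t m : R) (a b g h w : 'M[R]_n.+1).

(* [4 * ([<x, p>] * [<x, q>])] is the squared hyperbolic cosine of the distance
   from [x] to the axis. *)
Lemma displacement w p q m x : isol w -> axis w p q m -> X x ->
  let e := 4 * ([<x, p>] * [<x, q>]) in
  [/\ 1 <= e, e * ((m + m^-1) / 2) - (e - 1) <= - [<x *m w, x>] &
     - [<x *m w, x>] <= e * ((m + m^-1) / 2) + (e - 1)].
Proof.
move=> iw [npq m1 pw qw] Xx e.
have m0 : m != 0 by rewrite gt_eqF//; lra.
have := perp_lf_CS (x *m w) x npq; have := perp_lf_ge0 x npq.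
have xp : [<x *m w, p>] = m^-1 * [<x, p>].
  by rewrite lf_moveV// (eig_inv iw m0 pw) lfZr.
have xq : [<x *m w, q>] = m * [<x, q>].
  by rewrite lf_moveV// (eig_inv iw _ qw) ?invr_eq0// lfZr invrK.
have -> : perp_lf p q x x = e - 1 by rewrite /perp_lf (hyp_self Xx) /e; lra.
have -> : perp_lf p q (x *m w) (x *m w) = (m * m^-1) * e - 1.
  by rewrite /perp_lf isol_lf// (hyp_self Xx) /e xp xq; lra.
rewrite divff// mul1r => e1; rewrite -expr2 => H.
have [|h1 h2] := sqr_le_abs _ H; first by [].
have xw : - [<x *m w, x>] = e * ((m + m^-1) / 2) - perp_lf p q (x *m w) x.
  by rewrite /perp_lf xp xq /e; lra.
by rewrite xw; split; lra.
Qed.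

Lemma translation_le w p q m x : isol w -> axis w p q m -> X x ->
  m <= 2 * (- [<x *m w, x>]).
Proof.
move=> iw ax Xx; have [e1 H _] := displacement iw ax Xx.
have [_ m1 _ _] := ax; move: e1 H; set e := 4 * _ => e1 H.
have mm : m * m^-1 = 1 by rewrite divff// gt_eqF//; lra.
have i0 : 0 < m^-1 by rewrite invr_gt0; lra.
have : 0 <= (e - 1) * ((m + m^-1) / 2 - 1).
  by apply: mulr_ge0; first lra; nra.
by lra.
Qed.

Lemma close_to_axis w p q m x : isol w -> axis w p q m -> X x -> 4 <= m ->
  exists2 s, 0 < s & - [<gpt p q s, x>] <= 4 * (- [<x *m w, x>]) / m.
Proof.
move=> iw ax Xx m4; have [e1 H _] := displacement iw ax Xx.
have [[np nq _] m1 _ _] := ax.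
have P := hyp_causal_gt0 Xx (null_causal np).
have Q := hyp_causal_gt0 Xx (null_causal nq).
have i0 : 0 < m^-1 by rewrite invr_gt0; lra.
have s0 : 0 < 2 * (- [<x, q>]) by lra.
(* The foot of the perpendicular from [x] would cost a square root; this parameter gives the product
   [(e + 1) / 2], which suffices. *)
exists (2 * (- [<x, q>])) => //.
rewrite ler_pdivlMr; last by lra.
have -> : - [<gpt p q (2 * (- [<x, q>])), x>] = 2 * ([<x, p>] * [<x, q>]) + 2^-1.
  rewrite /gpt !lfE (lfC p) (lfC q).
  have := mulVf (lt0r_neq0 s0); set c := (2 * _)^-1; lra.
move: H e1; set e := 4 * _; set D := - [<x *m w, x>] => H e1.
have -> : 2 * ([<x, p>] * [<x, q>]) + 2^-1 = (e + 1) / 2 by rewrite /e; lra.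
have h1 : 0 <= e * m^-1 by rewrite mulr_ge0; lra.
have h2 : 0 <= (e - 1) * m by rewrite mulr_ge0; lra.
have h3 : 0 <= e * (m - 4) by rewrite mulr_ge0; lra.
by lra.
Qed.

(** The cone of points [x] with [c * (- [<x, e>]) <= - [<x *m b, q>]], those whose image under [b]
    stays away from the repelling end [q], is mapped into itself by [b * a ^+ k], and [- [<x, e>]]
    is multiplied by at least [c * l ^+ k]. Along the axis of translation [l'] an orbit grows only
    like the powers of [l'], so the rates compare. *)
Lemma translation_ge a b p q l : isol a -> isol b -> axis a p q l ->
  0 < - [<p *m b, q>] ->
  exists2 c, 0 < c & exists K, forall k, (K <= k)%N -> forall p' q' l',
    axis (b * a ^+ k) p' q' l' -> c * l ^+ k <= l'.
Proof.
move=> ia ib ax m0; have [npq l1 pa qa] := ax; have [np nq pq] := npq.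
have ibV := isolV ib.
have l0 : l != 0 by rewrite gt_eqF//; lra.
have Xe := gpt_hyp npq ltr01; move: (gpt1 p q) Xe.
move: (gpt p q 1) => e eE Xe.
have m1 := hyp_causal_gt0 (isol_hyp ib Xe) (null_causal nq).
have C2 := hyp_ge1 Xe (isol_hyp ibV Xe).
have nr : null (q *m b^-1) by apply: isol_null.
have rq := causal_ge0 (null_causal nr) (null_causal nq).
set M0 := - [<p *m b, q>] in m0.
have rp : - [<q *m b^-1, p>] = M0 by rewrite lf_moveV// invrK lfC.
set M1 := - [<e *m b, q>] in m1; set RQ := - [<q *m b^-1, q>] in rq.
set CC := - [<e, e *m b^-1>] in C2.
set c := Num.min M0 M1.
have c0 : 0 < c by rewrite lt_min m0 m1.
have cM0 : c <= M0 by rewrite ge_min lexx.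
have cM1 : c <= M1 by rewrite ge_min lexx orbT.
(* In the cone [- [<x *m b, p>]] is at most [C3] times [- [<x *m b, q>]]. The summand 1 makes the
   square of [C4] dominate [16 * C3 * M0 * RQ], so that [C4] bounds the perpendicular term [W]. *)
pose C3 := 2 * CC / c; pose C4 := 16 * C3 * M0 * RQ + 1.
have C30 : 0 <= C3 by rewrite divr_ge0//; lra.
have C40 : 0 <= 16 * C3 * M0 * RQ by apply: mulr_ge0 => //; apply: mulr_ge0; [apply: mulr_ge0|]; lra.
have [K KP] := pow_large ((C4 + c * C3) / M0) l1.
exists c => //; exists K => k Kk p' q' l' ax'.
have {KP} := KP k Kk; rewrite ler_pdivrMr//.
have L1 : 1 <= l ^+ k by rewrite exprn_ege1// ltW.
have pk := eig_inv (isolX k ia) (expf_neq0 k l0) (eig_act k pa).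
have qk := eig_inv (isolX k ia) (expf_neq0 k (invr_neq0 l0)) (eig_act k qa).
rewrite exprVn invrK in qk.
set L := l ^+ k in L1 pk qk * => LM.
have iL : 0 < L^-1 <= 1 by apply/andP; split; [rewrite invr_gt0|rewrite invf_le1]; lra.
have iw : isol (b * a ^+ k) by apply: isolM => //; apply: isolX.
have step x : X x -> c * (- [<x, e>]) <= - [<x *m b, q>] ->
    let y := x *m (b * a ^+ k) in
    [/\ X y, c * (- [<y, e>]) <= - [<y *m b, q>] & c * L * (- [<x, e>]) <= - [<y, e>]].
  move=> Xx xK y; have Xy : X y by apply: isol_hyp.
  have XY : X (x *m b) by apply: isol_hyp.
  have yq : [<y, q>] = L * [<x *m b, q>].
    rewrite /y actM lf_moveV; last exact: isolX.
    by rewrite qk lfZr.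
  have yp : [<y, p>] = L^-1 * [<x *m b, p>].
    rewrite /y actM lf_moveV; last exact: isolX.
    by rewrite pk lfZr.
  have A0 := hyp_causal_gt0 XY (null_causal nq).
  have B0 := hyp_causal_gt0 XY (null_causal np).
  have x0 := hyp_ge1 Xx Xe.
  have tri := causal_triangle (hyp_causal Xx) Xe (hyp_causal (isol_hyp ibV Xe)).
  have ye : - [<y, e>] = L * (- [<x *m b, q>]) + L^-1 * (- [<x *m b, p>]).
    by rewrite eE lfDr yq yp; clear; lra.
  have Ye : [<x, e *m b^-1>] = [<x *m b, p>] + [<x *m b, q>].
    by rewrite -lf_moveV// eE lfDr.
  rewrite Ye in tri.
  have CS := perp_lf_CS y (q *m b^-1) npq.
  have yr : - [<y *m b, q>] = - perp_lf p q y (q *m b^-1) +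
     2 * (L * (- [<x *m b, q>]) * M0) + 2 * (L^-1 * (- [<x *m b, p>]) * RQ).
    by rewrite lf_moveV// -rp /perp_lf /RQ yq yp; clear; lra.
  move: CS; set W := perp_lf p q y _ in yr *.
  have -> : perp_lf p q y y = 4 * ((L * L^-1) * ([<x *m b, q>] * [<x *m b, p>])) - 1.
    by rewrite /perp_lf (hyp_self Xy) yq yp; clear; lra.
  rewrite divff ?gt_eqF ?mul1r//; last by lra.
  have -> : perp_lf p q (q *m b^-1) (q *m b^-1) = 4 * (M0 * RQ).
    by rewrite /perp_lf -rp /RQ; case: nr => -> _; clear; lra.
  rewrite yr ye => CS; split => //.
    move: CS A0 B0 x0 tri xK; rewrite -/CC.
    have {}CC0 : [<e, e *m b^-1>] = - CC by rewrite opprK.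
    rewrite CC0; move: L^-1 iL => iL0 /andP[iL1 iL2].
    have C3E : c * C3 = 2 * CC by rewrite /C3 mulrC divfK ?gt_eqF.
    move: [<x *m b, q>] [<x *m b, p>] [<x, e>] => A B xe CS A0 B0 x0 tri xK.
    have B1 : - B <= C3 * - A.
      have : c * - B <= c * (C3 * - A).
        have : 2 * CC * (c * - xe) <= 2 * CC * - A by apply: ler_wpM2l; [clear -C2; lra|exact: xK].
        have -> : c * (C3 * - A) = 2 * CC * - A by rewrite mulrA C3E.
        by have := ler_wpM2l (ltW c0) tri; have := mulr_ge0 (ltW c0) (ltW A0); clear; lra.
      by rewrite ler_pM2l.
    have hW : W ^+ 2 <= (C4 * - A) ^+ 2.
      apply: le_trans CS _.
      have h1 : 0 <= M0 * RQ by apply: mulr_ge0 => //; exact: ltW.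
      have h2 : 16 * (M0 * RQ) * (- A * - B) <= 16 * (M0 * RQ) * (- A * (C3 * - A)).
        by apply: ler_wpM2l; [clear -h1; lra|apply: ler_wpM2l => //; exact: ltW].
      have h3 : 16 * C3 * M0 * RQ <= C4 ^+ 2 by rewrite /C4; move: C40; move: (16 * C3 * M0 * RQ); clear => a0 a1; nra.
      have h4 := ler_wpM2r (sqr_ge0 A) h3.
      by clear -h1 h2 h4; lra.
    have C4A : 0 <= C4 * - A by apply: mulr_ge0; [rewrite /C4; clear -C40; lra|exact: ltW].
    have [_ hW2] := sqr_le_abs C4A hW.
    have h5 : 0 <= iL0 * - B * RQ by rewrite !mulr_ge0// ltW.
    have h6 : (C4 + c * C3) * - A <= L * M0 * - A by apply: ler_wpM2r => //; exact: ltW.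
    have h7 : c * (iL0 * - B) <= c * (C3 * - A).
      by apply: ler_wpM2l; [exact: ltW|]; have : iL0 * - B <= 1 * - B by [apply: ler_wpM2r => //; exact: ltW]; clear -B1; lra.
    have h8 : c * (L * - A) <= M0 * (L * - A) by apply: ler_wpM2r => //; apply: mulr_ge0; [clear -L1; lra|exact: ltW].
    by clear -hW2 h5 h6 h7 h8; lra.
  have : L * (c * - [<x, e>]) <= L * - [<x *m b, q>] by apply: ler_wpM2l => //; clear -L1; lra.
  by have : 0 <= L^-1 * - [<x *m b, p>] by [apply: mulr_ge0; [case/andP: iL => /ltW|exact: ltW]]; clear; lra.
have [npq' l1' _ _] := ax'.
have l0' : 0 < l' by lra.
pose g := 4 * ([<e, p'>] * [<e, q'>]).
apply: (@pow_le_base _ _ _ (2 * g)) => [||i]; [|by []|].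
  by rewrite mulr_gt0//; clear -L1; lra.
have it : [/\ X (e *m (b * a ^+ k) ^+ i),
   c * (- [<e *m (b * a ^+ k) ^+ i, e>]) <= - [<e *m (b * a ^+ k) ^+ i *m b, q>] &
   (c * L) ^+ i <= - [<e *m (b * a ^+ k) ^+ i, e>]].
  elim: i => [|i [IH1 IH2 IH3]].
    by rewrite !expr0 act1 (hyp_self Xe); split=> //; rewrite -/M1; lra.
  have [s1 s2 s3] := step _ IH1 IH2.
  rewrite exprSr actM; split=> //; apply: le_trans s3; rewrite exprS.
  by apply: ler_wpM2l => //; rewrite mulr_ge0//; [exact: ltW|clear -L1; lra].
have [_ _ it3] := it; apply: (le_trans it3).
case: i {it it3} => [|i].
  by have [] := displacement iw ax' Xe; rewrite -/g !expr0 act1 (hyp_self Xe); lra.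
have [e1 _ H] := displacement (isolX i.+1 iw) (axisX (ltn0Sn i) ax') Xe.
apply: (le_trans H); rewrite -/g in e1 *.
have m1' : 1 <= l' ^+ i.+1 by rewrite exprn_ege1// ltW.
have : (l' ^+ i.+1)^-1 <= 1 by rewrite invf_le1; lra.
by move: (l' ^+ i.+1) (_ ^-1) m1' => P Q P1 Q1; nra.
Qed.

End Displacement.

Section EndBounds.
Context {R : realType} {n : nat}.
Local Notation V := 'rV[R]_n.+1.
Local Notation X := (@hyperbolic_space R n).
Implicit Types (x y z u v p q P Q : V) (l s t m : R) (a b g h w : 'M[R]_n.+1).

Lemma lf_end p q : null_pair p q ->
  [<gpt p q 1, p>] = - 2^-1 /\ [<gpt p q 1, q>] = - 2^-1.
Proof.
move=> [[pp _] [qq _] pq].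
by rewrite gpt1 !lfE pp qq (lfC q) pq add0r addr0.
Qed.

(** The geodesic of [P], [Q] passes near the base point at [t0] and near its translate by [a ^+ k]
    at [t1], with [H] bounding the cosines. The translate sees [p] and [q] scaled by powers of
    [l ^+ k]; each product is estimated at whichever of the two points makes it small. *)
Lemma end_bounds a p q l k P Q t0 t1 H : isol a -> axis a p q l -> null_pair P Q ->
  0 < t0 -> t0 <= t1 ->
  - [<gpt P Q t0, gpt p q 1>] <= H ->
  - [<gpt P Q t1, gpt p q 1 *m a ^+ k>] <= H ->
  [/\ l ^+ k * t0 <= 8 * H ^+ 2 * t1,
      t1 * - [<P, p>] * l ^+ k <= H, t1 * - [<P, q>] <= H * l ^+ k,
      - [<Q, p>] <= H * t0 & - [<Q, q>] <= H * t0].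
Proof.
move=> ia ax nPQ t00 t01 H0 H1; have [npq l1 pa qa] := ax.
have l0 : l != 0 by rewrite gt_eqF//; lra.
have t10 : 0 < t1 by lra.
have Xe := gpt_hyp npq ltr01; have Xx := isol_hyp (isolX k ia) Xe.
have ex : - [<gpt p q 1, gpt p q 1 *m a ^+ k>] = (1 / l ^+ k + l ^+ k) / 2.
  have lk : 0 < l ^+ k by rewrite exprn_gt0//; lra.
  have qak : q *m a ^+ k = (l ^+ k)^-1 *: q by rewrite (eig_act k qa) exprVn.
  by rewrite (gpt_act 1 (eig_act k pa) qak) mul1r lf_gpt// divr1.
have [ep eq] := lf_end npq.
have [np nq _] := npq; have [nP nQ _] := nPQ.
have pk := eig_inv (isolX k ia) (expf_neq0 k l0) (eig_act k pa).
have qk := eig_inv (isolX k ia) (expf_neq0 k (invr_neq0 l0)) (eig_act k qa).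
rewrite exprVn invrK in qk.
have xp : [<gpt p q 1 *m a ^+ k, p>] = (l ^+ k)^-1 * - 2^-1.
  by rewrite lf_moveV ?pk ?lfZr ?ep//; exact: isolX.
have xq : [<gpt p q 1 *m a ^+ k, q>] = l ^+ k * - 2^-1.
  by rewrite lf_moveV ?qk ?lfZr ?eq//; exact: isolX.
have g01 := lf_gpt nPQ t00 t10.
have Xg0 := gpt_hyp nPQ t00; have Xg1 := gpt_hyp nPQ t10.
have c0p := causal_triangle (hyp_causal Xg0) Xe (null_causal np).
have c0q := causal_triangle (hyp_causal Xg0) Xe (null_causal nq).
have c1p := causal_triangle (hyp_causal Xg1) Xx (null_causal np).
have c1q := causal_triangle (hyp_causal Xg1) Xx (null_causal nq).
have cex := causal_triangle (hyp_causal Xe) Xg0 (hyp_causal Xx).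
have cgx := causal_triangle (hyp_causal Xg0) Xg1 (hyp_causal Xx).
have L1 : 1 <= l ^+ k by rewrite exprn_ege1// ltW.
rewrite ep in c0p; rewrite eq in c0q; rewrite xp in c1p; rewrite xq in c1q.
have gx0 := causal_ge0 (hyp_causal Xg0) (hyp_causal Xx).
have h1 := hyp_ge1 Xg0 Xe; have h2 := hyp_ge1 Xg1 Xx.
rewrite (lfC (gpt p q 1) (gpt P Q t0)) in cex.
have P1 := causal_ge0 (null_causal nP) (null_causal np).
have P2 := causal_ge0 (null_causal nP) (null_causal nq).
have Q1 := causal_ge0 (null_causal nQ) (null_causal np).
have Q2 := causal_ge0 (null_causal nQ) (null_causal nq).
have i0 : 0 < t0^-1 by rewrite invr_gt0.
have i1 : 0 < t1^-1 by rewrite invr_gt0.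
have e0 : t0 * t0^-1 = 1 by rewrite divff// gt_eqF.
have e1 : t1 * t1^-1 = 1 by rewrite divff// gt_eqF.
have iL : 0 < (l ^+ k)^-1 by rewrite invr_gt0; clear -L1; lra.
have eL : l ^+ k * (l ^+ k)^-1 = 1 by rewrite divff// gt_eqF//; clear -L1; lra.
have H00 : 0 <= H by clear -h1 H0; lra.
clear pk qk xp xq ep eq Xe Xx Xg0 Xg1 nPQ npq ax pa qa ia.
have Hp : - [<gpt P Q t0, p>] <= H by clear -c0p H0; lra.
have Hq : - [<gpt P Q t0, q>] <= H by clear -c0q H0; lra.
have Hp1 : - [<gpt P Q t1, p>] <= H * (l ^+ k)^-1.
  by have := ler_wpM2r (ltW iL) H1; clear -c1p; lra.
have Hq1 : - [<gpt P Q t1, q>] <= H * l ^+ k.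
  by have := ler_wpM2r (le_trans ler01 L1) H1; clear -c1q; lra.
move: Hp Hq Hp1 Hq1; rewrite /gpt !lfE => Hp Hq Hp1 Hq1.
split.
- have k1 : - [<gpt P Q t0, gpt p q 1 *m a ^+ k>] <= 2 * H * - [<gpt P Q t0, gpt P Q t1>].
    apply: (le_trans cgx); have : 0 <= - [<gpt P Q t0, gpt P Q t1>].
      by rewrite g01; apply: mulr_ge0 => //; apply: addr_ge0; apply: mulr_ge0; exact: ltW.
    by move=> hh1; have := ler_wpM2r hh1 H1; clear; lra.
  have k2 : l ^+ k <= 4 * (H * - [<gpt P Q t0, gpt p q 1 *m a ^+ k>]).
    by have := ler_wpM2r gx0 H0; clear -cex ex iL; lra.
  have k3 : - [<gpt P Q t0, gpt P Q t1>] <= t1 / t0.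
    rewrite g01; have : t0 / t1 <= t1 / t0; last by clear; lra.
    have : t0 / t1 <= 1 by rewrite ler_pdivrMr// mul1r.
    by have : 1 <= t1 / t0; [rewrite ler_pdivlMr// mul1r|clear; lra].
  have k4 : l ^+ k <= 8 * H ^+ 2 * (t1 / t0).
    have := ler_wpM2l H00 k1; have := ler_wpM2l (sqr_ge0 H) k3; clear -k2; lra.
  by rewrite mulrA in k4; rewrite -ler_pdivlMr.
- have : 0 <= t1^-1 * - [<Q, p>] by apply: mulr_ge0 => //; exact: ltW.
  move=> hh; have : t1 * - [<P, p>] <= H * (l ^+ k)^-1 by clear -hh Hp1; lra.
  by move=> hh2; rewrite -ler_pdivlMr//; clear -L1 hh2; lra.
- by have : 0 <= t1^-1 * - [<Q, q>] by [apply: mulr_ge0 => //; exact: ltW]; clear -Hq1; lra.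
- have : 0 <= t0 * - [<P, p>] by apply: mulr_ge0 => //; exact: ltW.
  move=> hh; have : t0^-1 * - [<Q, p>] <= H by clear -hh Hp; lra.
  by rewrite mulrC ler_pdivrMr.
- have : 0 <= t0 * - [<P, q>] by apply: mulr_ge0 => //; exact: ltW.
  move=> hh; have : t0^-1 * - [<Q, q>] <= H by clear -hh Hq; lra.
  by rewrite mulrC ler_pdivrMr.
Qed.

End EndBounds.

Section GoodEnds.
Context {R : realType} {n : nat}.
Local Notation V := 'rV[R]_n.+1.
Local Notation X := (@hyperbolic_space R n).
Implicit Types (x y z u v p q P Q : V) (l s t m : R) (a b g h w : 'M[R]_n.+1).

(** Cutting a factor [Z] off both ends of [[t0, t1]] makes the errors of [shadow_core] small. The
    rest still covers half a period: [t1 / t0] is at least of order [l ^+ k] while [m] is at most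
    [M * l ^+ k], and squaring the former leaves a spare factor [l ^+ k] that absorbs [Z] and the
    constants. *)
Lemma good_ends a p q l k P Q t0 t1 H M m Z eps : isol a -> axis a p q l ->
  null_pair P Q -> 0 < t0 -> t0 <= t1 -> 0 < eps -> 0 < H -> 0 < M -> 0 < m ->
  - [<gpt P Q t0, gpt p q 1>] <= H ->
  - [<gpt P Q t1, gpt p q 1 *m a ^+ k>] <= H ->
  m <= M * l ^+ k -> 1 <= Z -> 64 * l ^+ 2 * H ^+ 2 <= eps * Z ->
  32 * l ^+ 2 * H ^+ 2 <= eps * l ^+ k ->
  64 * H ^+ 4 * Z ^+ 4 * M <= l ^+ k ->
  exists u v : R, [/\ 0 < u, 0 < v, u ^+ 2 * m <= v ^+ 2 & forall s, u <= s -> s <= v ->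
    - [<gpt P Q s *m a, gpt P Q (s * l)>] <= 1 + eps].
Proof.
move=> ia ax nPQ t00 t01 eps0 H0 M0 m0 e0 e1 mM Z1 Ze Le LZ.
have [b1 b2 b3 b4 b5] := end_bounds ia ax nPQ t00 t01 e0 e1.
have [npq l1 _ _] := ax.
have L1 : 1 <= l ^+ k by rewrite exprn_ege1// ltW.
have t10 : 0 < t1 by lra.
have Z0 : 0 < Z by lra.
have [np nq _] := npq; have [nP nQ _] := nPQ.
have P1 := causal_ge0 (null_causal nP) (null_causal np).
have P2 := causal_ge0 (null_causal nP) (null_causal nq).
have Q1 := causal_ge0 (null_causal nQ) (null_causal np).
have Q2 := causal_ge0 (null_causal nQ) (null_causal nq).
exists (Z * t0), (t1 / Z); split.
- by rewrite mulr_gt0.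
- by rewrite divr_gt0.
- rewrite exprMn expr_div_n ler_pdivlMr ?exprn_gt0//.
  set L := l ^+ k in b1 b2 b3 mM Le LZ L1.
  have c1 : (L * t0) ^+ 2 <= (8 * H ^+ 2 * t1) ^+ 2.
    by rewrite ler_pXn2r ?nnegrE//; [apply: mulr_ge0; [clear -L1; lra|exact: ltW]|rewrite mulr_ge0//; [rewrite mulr_ge0// sqr_ge0|exact: ltW]].
  have H4 : 0 < 64 * H ^+ 4 by rewrite mulr_gt0// exprn_gt0.
  rewrite -(ler_pM2l H4).
  have c2 : 64 * H ^+ 4 * (Z ^+ 2 * t0 ^+ 2 * m * Z ^+ 2) <= t0 ^+ 2 * (64 * H ^+ 4 * Z ^+ 4 * M) * L.
    have hh : 0 <= 64 * H ^+ 4 * Z ^+ 4 * t0 ^+ 2.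
      by rewrite mulr_ge0 ?sqr_ge0// mulr_ge0 ?exprn_ge0//; clear -H4 Z0 H0; lra.
    by have := ler_wpM2l hh mM; clear; lra.
  have c3 : t0 ^+ 2 * (64 * H ^+ 4 * Z ^+ 4 * M) * L <= t0 ^+ 2 * L * L.
    by apply: ler_wpM2r; [clear -L1; lra|apply: ler_wpM2l => //; rewrite sqr_ge0].
  by clear -c1 c2 c3; lra.
move=> s s0 s1; have s00 : 0 < s by apply: lt_le_trans s0; rewrite mulr_gt0.
apply: (le_trans (shadow_core ia ax nPQ s00)); rewrite lerD2l.
set L := l ^+ k in b1 b2 b3 mM Le LZ L1.
move: b2 b3 b4 b5 P1 P2 Q1 Q2.
rewrite -[[<P, p>] * [<P, q>]]mulrNN -[[<Q, p>] * [<Q, q>]]mulrNN.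
rewrite -[[<P, p>] * [<Q, q>]]mulrNN.
move: (- [<P, p>]) (- [<P, q>]) (- [<Q, p>]) (- [<Q, q>]) => p1 p2 q1 q2.
move=> b2 b3 b4 b5 P1 P2 Q1 Q2.
have sZ : s * Z <= t1 by move: s1; rewrite ler_pdivlMr.
have H20 : 0 <= H ^+ 2 by rewrite sqr_ge0.
have d1 : t1 ^+ 2 * (p1 * p2) <= H ^+ 2.
  have : (t1 * p1 * L) * (t1 * p2) <= H * (H * L).
    apply: ler_pM => //; first by rewrite !mulr_ge0//; clear -L1 t10; lra.
    by rewrite mulr_ge0//; clear -L1 t10 H0; lra.
  have -> : (t1 * p1 * L) * (t1 * p2) = t1 ^+ 2 * (p1 * p2) * L by clear; lra.
  have -> : H * (H * L) = H ^+ 2 * L by clear; lra.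
  by rewrite ler_pM2r//; clear -L1; lra.
have d1' : s ^+ 2 * (p1 * p2) * Z ^+ 2 <= H ^+ 2.
  apply: le_trans d1.
  have -> : s ^+ 2 * (p1 * p2) * Z ^+ 2 = (s * Z) ^+ 2 * (p1 * p2) by clear; lra.
  apply: ler_wpM2r; first by rewrite mulr_ge0.
  by rewrite ler_pXn2r ?nnegrE//; [apply: mulr_ge0; exact: ltW|exact: ltW].
have d2 : q1 * q2 <= H ^+ 2 * t0 ^+ 2.
  have -> : H ^+ 2 * t0 ^+ 2 = (H * t0) * (H * t0) by clear; lra.
  exact: ler_pM.
have d2' : s^-1 ^+ 2 * (q1 * q2) * Z ^+ 2 <= H ^+ 2.
  have -> : s^-1 ^+ 2 * (q1 * q2) * Z ^+ 2 = (q1 * q2 * Z ^+ 2) / s ^+ 2.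
    by rewrite exprVn; clear; lra.
  rewrite ler_pdivrMr ?exprn_gt0//.
  apply: (@le_trans _ _ (H ^+ 2 * t0 ^+ 2 * Z ^+ 2)).
    by apply: ler_wpM2r => //; rewrite sqr_ge0.
  have -> : H ^+ 2 * t0 ^+ 2 * Z ^+ 2 = H ^+ 2 * (Z * t0) ^+ 2 by clear; lra.
  apply: ler_wpM2l => //.
  by rewrite ler_pXn2r ?nnegrE//; [apply: mulr_ge0; exact: ltW|exact: ltW].
have d3 : p1 * q2 * L <= H ^+ 2.
  have k1 : p1 * q2 <= p1 * (H * t1).
    by apply: ler_wpM2l => //; apply: (le_trans b5); apply: ler_wpM2l => //; exact: ltW.
  have L0 : 0 <= L by clear -L1; lra.
  by have := ler_wpM2r L0 k1; have := ler_wpM2l (ltW H0) b2; clear; lra.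
have Z2 : Z <= Z ^+ 2 by rewrite expr2 ler_peMr//; exact: ltW.
have l20 : 0 < l ^+ 2 by rewrite exprn_gt0//; clear -l1; lra.
have bnd A : 0 <= A -> A * Z ^+ 2 <= H ^+ 2 -> 64 * l ^+ 2 * A <= eps.
  move=> A0 AZ; have : 64 * l ^+ 2 * A * Z <= eps * Z.
    have : A * Z <= A * Z ^+ 2 by apply: ler_wpM2l.
    move=> AZ2; apply: le_trans Ze.
    have -> : 64 * l ^+ 2 * A * Z = 64 * l ^+ 2 * (A * Z) by clear; lra.
    by apply: ler_wpM2l; [apply: mulr_ge0 => //; exact: ltW|exact: (le_trans AZ2 AZ)].
  by rewrite ler_pM2r.
(* Each of the two end terms uses a quarter of [eps] and the mixed term a half. *)
have f1 := bnd _ _ d1'; have f2 := bnd _ _ d2'.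
have {}f1 : 64 * l ^+ 2 * (s ^+ 2 * (p1 * p2)) <= eps.
  by apply: f1; rewrite mulr_ge0 ?sqr_ge0// mulr_ge0.
have {}f2 : 64 * l ^+ 2 * (s^-1 ^+ 2 * (q1 * q2)) <= eps.
  by apply: f2; rewrite mulr_ge0 ?sqr_ge0// mulr_ge0.
have f3 : 32 * l ^+ 2 * (p1 * q2) <= eps.
  have : 32 * l ^+ 2 * (p1 * q2) * L <= eps * L.
    apply: le_trans Le.
    have -> : 32 * l ^+ 2 * (p1 * q2) * L = 32 * l ^+ 2 * (p1 * q2 * L) by clear; lra.
    by apply: ler_wpM2l => //; apply: mulr_ge0 => //; exact: ltW.
  by rewrite ler_pM2r//; clear -L1; lra.
by clear -f1 f2 f3; lra.
Qed.

End GoodEnds.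

Section LongStretch.
Context {R : realType} {n : nat}.
Local Notation V := 'rV[R]_n.+1.
Local Notation X := (@hyperbolic_space R n).
Implicit Types (x y z u v p q P Q : V) (l s t m : R) (a b g h w : 'M[R]_n.+1).

(** [b * a ^+ k] displaces both the base point and its translate by [a ^+ k] by a cosine of order
    [l ^+ k], which is also the order of [m]; hence both lie at bounded distance from its axis. The
    inverse is taken when the axis passes them in the opposite order. *)
Lemma good_interval a b p q l eps : isol a -> isol b -> axis a p q l ->
  0 < - [<p *m b, q>] -> 0 < eps ->
  exists K, forall k, (K <= k)%N -> forall p' q' m, axis (b * a ^+ k) p' q' m ->
  exists W P Q (u v : R), [/\ W = b * a ^+ k \/ W = (b * a ^+ k)^-1, axis W P Q m,
    0 < u /\ 0 < v, u ^+ 2 * m <= v ^+ 2 & forall s, u <= s -> s <= v ->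
    - [<gpt P Q s *m a, gpt P Q (s * l)>] <= 1 + eps].
Proof.
move=> ia ib ax pbq eps0; have [npq l1 pa qa] := ax.
have l0 : 0 < l by lra.
have ibV := isolV ib; have Xe := gpt_hyp npq ltr01.
have [c c0 [K1 K1P]] := translation_ge ia ib ax pbq.
have C1 := hyp_ge1 Xe (isol_hyp ibV Xe).
set C := - [<gpt p q 1, gpt p q 1 *m b^-1>] in C1.
(* [H] is the bound [4 * D / m] of [close_to_axis] for [D = 2 * C * l ^+ k] and [m = c * l ^+ k];
   [M] comes from [m <= 2 * D]. *)
pose H := 8 * C / c; pose M := 4 * C.
have H0 : 0 < H by rewrite divr_gt0//; lra.
have M0 : 0 < M by rewrite /M; lra.
pose Z := 64 * l ^+ 2 * H ^+ 2 / eps + 1.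
have Z1 : 1 <= Z.
  rewrite lerDr divr_ge0//; last exact: ltW.
  by apply: mulr_ge0; [apply: mulr_ge0 => //; exact: sqr_ge0|exact: sqr_ge0].
have [K2 K2P] := pow_large (4 / c) l1.
have [K3 K3P] := pow_large (32 * l ^+ 2 * H ^+ 2 / eps) l1.
have [K4 K4P] := pow_large (64 * H ^+ 4 * Z ^+ 4 * M) l1.
exists (K1 + K2 + K3 + K4)%N => k kK p' q' m axw.
have k1 : (K1 <= k)%N by apply: leq_trans kK; rewrite -!addnA leq_addr.
have k2 : (K2 <= k)%N by apply: leq_trans kK; rewrite -!addnA addnCA leq_addr.
have k3 : (K3 <= k)%N by apply: leq_trans kK; rewrite addnAC leq_addl.
have k4 : (K4 <= k)%N by apply: leq_trans kK; rewrite leq_addl.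
have iw : isol (b * a ^+ k) by apply: isolM => //; apply: isolX.
have cL := K1P k k1 _ _ _ axw.
have := K2P k k2; rewrite ler_pdivrMr// => L4.
have m4 : 4 <= m by lra.
have := K3P k k3; rewrite ler_pdivrMr// (mulrC _ eps) => Le.
have LZ := K4P k k4.
have Ze : 64 * l ^+ 2 * H ^+ 2 <= eps * Z.
  by rewrite /Z; have := divfK (lt0r_neq0 eps0) (64 * l ^+ 2 * H ^+ 2); lra.
have L1 : 1 <= l ^+ k by rewrite exprn_ege1// ltW.
have iL : (l ^+ k)^-1 <= 1 by rewrite invf_le1//; lra.
have Xx := isol_hyp (isolX k ia) Xe.
have exle : - [<gpt p q 1 *m a ^+ k, gpt p q 1>] <= l ^+ k.
  have qak : q *m a ^+ k = (l ^+ k)^-1 *: q by rewrite (eig_act k qa) exprVn.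
  rewrite (gpt_act 1 (eig_act k pa) qak) mul1r lf_gpt//; last by lra.
  by rewrite divr1 div1r; lra.
have ex0 := causal_ge0 (hyp_causal Xx) (hyp_causal Xe).
have D0 : - [<gpt p q 1 *m (b * a ^+ k), gpt p q 1>] <= 2 * C * l ^+ k.
  rewrite actM lf_moveV; last exact: isolX.
  have := causal_triangle (hyp_causal (isol_hyp ib Xe)) Xe
    (hyp_causal (isol_hyp (isolV (isolX k ia)) Xe)).
  rewrite -lf_moveV; last exact: isolX.
  rewrite [X in 2 * (X * _)]lf_moveV// -[X in 2 * (X * _)]opprK -/C.
  rewrite -(lf_moveV _ _ (isolX k ia)).
  by have := ler_wpM2l (le_trans ler01 C1) exle; lra.
have D1 : - [<gpt p q 1 *m a ^+ k *m (b * a ^+ k), gpt p q 1 *m a ^+ k>] <=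
    2 * C * l ^+ k.
  rewrite actM isol_lf; last exact: isolX.
  rewrite lf_moveV//.
  have := causal_triangle (hyp_causal Xx) Xe (hyp_causal (isol_hyp ibV Xe)).
  rewrite -[X in 2 * (_ * X)]opprK -/C.
  by have := ler_wpM2l (le_trans ler01 C1) exle; lra.
have mM : m <= M * l ^+ k.
  by have := translation_le iw axw Xe; rewrite /M; lra.
have HD D : D <= 2 * C * l ^+ k -> 4 * D / m <= H.
  move=> DL; rewrite ler_pdivrMr; last by lra.
  have : H * (c * l ^+ k) <= H * m by apply: ler_wpM2l => //; exact: ltW.
  have -> : H * (c * l ^+ k) = 8 * C * l ^+ k by rewrite mulrA divfK// gt_eqF.
  by lra.
have [s0 s00 e0] := close_to_axis iw axw Xe m4.
have [s1 s10 e1] := close_to_axis iw axw Xx m4.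
have {}e0 := le_trans e0 (HD _ D0).
have {}e1 := le_trans e1 (HD _ D1).
have [npq' m1 _ _] := axw.
have m0 : 0 < m by clear -m4; lra.
have [s01|s10'] := leP s0 s1.
  have [u [v [u0 v0 uv uvP]]] := good_ends ia ax npq' s00 s01 eps0 H0 M0 m0 e0 e1 mM Z1 Ze Le LZ.
  by exists (b * a ^+ k), p', q', u, v; split=> //; left.
have s00' : 0 < s0^-1 by rewrite invr_gt0.
have s01 : s0^-1 <= s1^-1 by rewrite lef_pV2 ?posrE//; exact: ltW.
have [u [v [u0 v0 uv uvP]]] := @good_ends _ _ a p q l k q' p' s0^-1 s1^-1 H M m Z eps
  ia ax (null_pairC npq') s00' s01 eps0 H0 M0 m0
  (ltac:(by rewrite gptC invrK)) (ltac:(by rewrite gptC invrK)) mM Z1 Ze Le LZ.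
exists (b * a ^+ k)^-1, q', p', u, v; split=> //; first by right.
exact: axisV.
Qed.

End LongStretch.

(** * Uniform lattices and their normalizers *)

Section Lattice.
Context {R : realType} {n : nat}.
Local Notation V := 'rV[R]_n.+1.
Local Notation X := (@hyperbolic_space R n).
Implicit Types (x y z u v p q P Q o : V) (l s t m : R) (a b g h w E : 'M[R]_n.+1).

(** Discreteness and freeness are one clause: a nontrivial element moves every point by at least
    [arcosh k0]. The last clause is cocompactness. *)
Definition uniform_lattice (G : set 'M[R]_n.+1) (k0 : R) :=
  [/\ [/\ forall g, G g -> isol g, G 1, forall g h, G g -> G h -> G (g * h) &
          forall g, G g -> G g^-1],
      1 < k0, forall g x, G g -> X x -> - [<x, x *m g>] < k0 -> g = 1 &
      exists (o : V) (D : R), X o /\ forall x, X x -> exists2 g, G g & - [<o, x *m g>] <= D].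

Definition normalizes (G : set 'M[R]_n.+1) E :=
  isol E /\ forall g, G g -> G (E^-1 * g * E) /\ G (E * g * E^-1).

Section Theory.
Variables (G : set 'M[R]_n.+1) (k0 : R).
Hypothesis HG : uniform_lattice G k0.

Lemma G_isol g : G g -> isol g. Proof. by case: HG => -[H _ _ _] _ _ _ /H. Qed.
Lemma G_1 : G 1. Proof. by case: HG => -[]. Qed.
Lemma G_M g h : G g -> G h -> G (g * h). Proof. by case: HG => -[_ _ H _] _ _ _; exact: H. Qed.
Lemma G_V g : G g -> G g^-1. Proof. by case: HG => -[_ _ _ H] _ _ _; exact: H. Qed.
Lemma G_unit g : G g -> g \is a GRing.unit. Proof. by move=> /G_isol/isol_unit. Qed.
Lemma G_free g x : G g -> X x -> - [<x, x *m g>] < k0 -> g = 1.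
Proof. by case: HG => _ _ H _; exact: H. Qed.
Lemma k0_gt1 : 1 < k0. Proof. by case: HG. Qed.

Lemma G_X g k : G g -> G (g ^+ k).
Proof.
move=> Gg; elim: k => [|k IH]; first by rewrite expr0; exact: G_1.
by rewrite exprS; apply: G_M.
Qed.

Lemma G_exprz g (j : int) : G g -> G (g ^ j).
Proof.
move=> Gg; case: j => k; first exact: G_X.
by rewrite NegzE -exprnN; apply/G_V/G_X.
Qed.

Lemma G_fix g x : G g -> X x -> x *m g = x -> g = 1.
Proof.
move=> Gg Xx xg; apply: (G_free Gg Xx).
by rewrite xg (hyp_self Xx) opprK k0_gt1.
Qed.

Lemma G_eq g h x : G g -> G h -> X x -> x *m g = x *m h -> g = h.
Proof.
move=> Gg Gh Xx xgh; have : g * h^-1 = 1.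
  by apply: (G_fix (G_M Gg (G_V Gh)) Xx); rewrite actM xgh actK//; exact: G_isol.
by move/(congr1 (fun zz => zz * h)); rewrite divrK ?mul1r// G_unit.
Qed.

Lemma G_normalizes g : G g -> normalizes G g.
Proof.
move=> Gg; split; first exact: G_isol.
move=> h Gh; split; last by apply: G_M; [exact: G_M|exact: G_V].
by apply: G_M => //; apply: G_M => //; exact: G_V.
Qed.

Lemma normalizes_isol E : normalizes G E -> isol E. Proof. by case. Qed.

Lemma normalizesM E F : normalizes G E -> normalizes G F -> normalizes G (E * F).
Proof.
move=> [iE HE] [iF HF]; split; first exact: isolM.
have uE := isol_unit iE; have uF := isol_unit iF.
move=> g Gg; rewrite !invrM//; split.
  have [] := HF _ (HE _ Gg).1; rewrite !mulrA => H _; exact: H.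
have [_] := HE _ (HF _ Gg).2; rewrite !mulrA => H; exact: H.
Qed.

Lemma normalizesV E : normalizes G E -> normalizes G E^-1.
Proof.
move=> [iE HE]; split; first exact: isolV.
by move=> g /HE[? ?]; rewrite invrK.
Qed.

(** The commutator fixes the vector [p], so it moves points far out towards [p] arbitrarily little,
    and freeness makes it trivial. At parameter [c + 1] the cosine of its displacement is 1 + c (k0
    - 1) / (c + 1)^2, which is below [k0]. *)
Lemma share_end_commute a b p q l m : G a -> G b -> axis a p q l ->
  p *m b = m *: p -> a * b = b * a.
Proof.
move=> Ga Gb [npq l1 pa qa] pb; have [np nq pq] := npq.
have ia := G_isol Ga; have ib := G_isol Gb.
have ua := G_unit Ga; have ub := G_unit Gb.
have m0 : m != 0.
  apply/eqP => m0; have [_] := isol_null ib np.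
  by rewrite pb m0 scale0r mxE ltxx.
have l0 : l != 0 by rewrite gt_eqF//; lra.
pose u := a * b * a^-1 * b^-1.
have Gu : G u by rewrite /u; repeat apply: G_M => //; exact: G_V.
have pu : p *m u = p.
  rewrite /u !actM pa -!scalemxAl pb -!scalemxAl (eig_inv ia l0 pa) -scalemxAl.
  rewrite (eig_inv ib m0 pb) !scalerA; set c := (X in X *: _).
  have -> : c = (l * l^-1) * (m * m^-1) by rewrite /c; lra.
  by rewrite !mulfV// mulr1 scale1r.
have iu := G_isol Gu; have k01 := k0_gt1.
have qu : [<p, q *m u>] = - 2^-1 by rewrite -pu isol_lf.
have qqu := causal_ge0 (null_causal nq) (null_causal (isol_null iu nq)).
pose c := - [<q, q *m u>] / (k0 - 1).
have c0 : 0 <= c by rewrite divr_ge0//; lra.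
have s0 : 0 < c + 1 by lra.
suff : u = 1.
  rewrite /u => /(congr1 (fun zz => zz * b)); rewrite divrK// mul1r.
  by move/(congr1 (fun zz => zz * a)); rewrite divrK.
apply: (G_free Gu (gpt_hyp npq s0)).
have -> : gpt p q (c + 1) *m u = (c + 1) *: p + (c + 1)^-1 *: (q *m u).
  by rewrite /gpt mulmxDl -!scalemxAl pu.
rewrite /gpt !lfE qu (lfC q p) pq; case: np => -> _.
have ss : (c + 1) * (c + 1)^-1 = 1 by rewrite divff// gt_eqF.
rewrite [X in X < _](_ : _ =
  (c + 1) * (c + 1)^-1 + (c + 1)^-1 ^+ 2 * (- [<q, q *m u>])); last by lra.
rewrite ss -ltrBrDl exprVn mulrC ltr_pdivrMr ?exprn_gt0//.
have -> : - [<q, q *m u>] = c * (k0 - 1) by rewrite /c divfK// gt_eqF//; lra.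
rewrite mulrC ltr_pM2l; last by lra.
by nra.
Qed.

Lemma share_end_commute_q a b p q l m : G a -> G b -> axis a p q l ->
  q *m b = m *: q -> a * b = b * a.
Proof.
move=> Ga Gb ax qb.
have H := share_end_commute (G_V Ga) Gb (axisV (G_isol Ga) ax) qb.
have ua := G_unit Ga.
have : a * (a^-1 * b) * a = a * (b * a^-1) * a by rewrite H.
by rewrite !mulrA divrr// mul1r mulrVK// => ->.
Qed.

(** If [b] took the end [p] to [q], the conjugate [a'] would share the end [q] with [a], hence
    commute with [a] and fix both ends. Then [b] would exchange [p] and [q], so it would fix a point
    of the axis and be trivial. *)
Lemma no_end_swap a b p q l : G a -> G b -> axis a p q l -> 0 < - [<p *m b, q>].
Proof.
move=> Ga Gb ax; have [npq l1 pa qa] := ax; have [np nq pq] := npq.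
have ia := G_isol Ga; have ib := G_isol Gb.
rewrite lt_neqAle (causal_ge0 (null_causal (isol_null ib np)) (null_causal nq)) andbT.
apply/eqP => H.
have [|m m0 pb] := null_orth nq (isol_null ib np); first by rewrite lfC; lra.
have l0 : l != 0 by rewrite gt_eqF//; lra.
have ub := G_unit Gb; have ua := G_unit Ga.
pose a' := b^-1 * a * b.
have Ga' : G a' by rewrite /a'; apply: G_M => //; apply: G_M => //; exact: G_V.
have qa' : q *m a' = l *: q.
  have qbV : q *m b^-1 = m^-1 *: p.
    by apply: (can_inj (fun x => actK x ib)); rewrite actVK// -scalemxAl pb scalerA mulVf ?scale1r// gt_eqF.
  rewrite /a' !actM qbV -!scalemxAl pa -scalemxAl pb !scalerA.
  by congr (_ *: _); rewrite mulrAC mulVf ?mul1r// gt_eqF.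
have ca : a * a' = a' * a := share_end_commute_q Ga Ga' ax qa'.
have [t t0 [pa' qa'']] := commute_axis ia (G_isol Ga') ax ca.
have tl : t^-1 = l.
  have : (t^-1 - l) *: q = 0 by rewrite scalerBl -qa'' qa' subrr.
  move=> /eqP; rewrite scaler_eq0 subr_eq0 => /orP[/eqP//|/eqP q0].
  by case: nq => _; rewrite q0 mxE ltxx.
have lt : l^-1 = t by rewrite -tl invrK.
have [||m' m0' pbV] := @eig_q _ _ a p q l (p *m b^-1) l^-1 ia ax (isol_null (isolV ib) np).
- apply: (can_inj (fun x => actK x ib)).
  by rewrite -scalemxAl actVK// lt -pa' /a' !actM.
- by rewrite lt_eqF//; apply: (@lt_trans _ _ 1) => //; rewrite invf_lt1//; lra.
have qb : q *m b = m'^-1 *: p.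
  by rewrite -[p](actVK _ ib) pbV -scalemxAl scalerA mulVf ?scale1r// gt_eqF.
have mm := act_pair ib npq (null_pairC npq) pb qb; rewrite mm in qb.
have [s s0 ss] : exists2 s, 0 < s & s ^+ 2 = m^-1.
  exists (Num.sqrt m^-1); first by rewrite sqrtr_gt0 invr_gt0.
  by rewrite sqr_sqrtr// invr_ge0 ltW.
have b1 : b = 1.
  apply: (G_fix Gb (gpt_hyp npq s0)).
  rewrite (gpt_act _ pb qb) gptC; congr gpt; rewrite invfM -ss expr2 mulrA mulVf ?mul1r//.
  exact: lt0r_neq0.
by move: H; rewrite b1 act1 pq; lra.
Qed.

End Theory.
End Lattice.

(** * Every nontrivial element of a uniform lattice has an axis *)

Section AxisExistence.
Context {R : realType} {n : nat}.
Local Notation V := 'rV[R]_n.+1.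
Local Notation X := (@hyperbolic_space R n).
Implicit Types (x y z u v p q P Q o : V) (l s t m : R) (a b g h w E F W : 'M[R]_n.+1).

(* At a point [x] of minimal displacement, the displacement of the midpoint of
   [x] and [x a] forces [x], [x a], [x a a] onto one geodesic. *)
Lemma axis_of_min a x : isol a -> X x -> 1 < - [<x, x *m a>] ->
  (forall y, X y -> - [<x, x *m a>] <= - [<y, y *m a>]) ->
  exists p q l, axis a p q l.
Proof.
move=> ia Xx k1 xmin; set k := - [<x, x *m a>] in k1 xmin.
have [y yE] : exists y, y = x *m a := ex_intro _ _ erefl.
have [z zE] : exists z, z = y *m a := ex_intro _ _ erefl.
have Xy : X y by rewrite yE; apply: isol_hyp.
have Xz : X z by rewrite zE; apply: isol_hyp.
have xy : [<x, y>] = - k by rewrite yE opprK.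
have yz : [<y, z>] = - k by rewrite zE {1}yE isol_lf.
pose mid := (Num.sqrt (2 + 2 * k))^-1 *: (x + y).
have s0 : 0 < Num.sqrt (2 + 2 * k) by rewrite sqrtr_gt0; lra.
have ss : (Num.sqrt (2 + 2 * k))^-1 ^+ 2 * (2 + 2 * k) = 1.
  by rewrite exprVn sqr_sqrtr ?mulVf//; [rewrite gt_eqF|]; lra.
have Xmid : X mid.
  rewrite /mid; set s := (Num.sqrt _)^-1 in ss *.
  have sp : 0 < s by rewrite invr_gt0.
  split.
    rewrite !lfE (hyp_self Xx) (hyp_self Xy) (lfC y x) xy.
    by move: ss; lra.
  rewrite !mxE mulr_gt0// addr_gt0//; [by case: Xx|by case: Xy].
have := xmin _ Xmid.
have -> : mid *m a = (Num.sqrt (2 + 2 * k))^-1 *: (y + z).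
  by rewrite /mid -scalemxAl mulmxDl -yE -zE.
rewrite /mid; set s := (Num.sqrt _)^-1 in ss *.
rewrite !lfE xy yz (hyp_self Xy) => H.
have mu : 2 * k ^+ 2 - 1 <= - [<x, z>].
  have s20 : 0 < s ^+ 2 by rewrite exprn_gt0// invr_gt0.
  have : s ^+ 2 * (k * (2 + 2 * k)) <= s ^+ 2 * (2 * k + 1 - [<x, z>]).
    by have : k * (s ^+ 2 * (2 + 2 * k)) = k by [rewrite ss mulr1]; lra.
  by rewrite ler_pM2l//; lra.
have [v vE] : exists v, v = x + z - (2 * k) *: y := ex_intro _ _ erefl.
have yv : [<y, v>] = 0 by rewrite vE !lfE (lfC y x) xy yz (hyp_self Xy); lra.
have vv : [<v, v>] = - 2 + 4 * k ^+ 2 - 2 * - [<x, z>].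
  rewrite vE !lfE (hyp_self Xx) (hyp_self Xy) (hyp_self Xz).
  by rewrite (lfC y x) (lfC z x) (lfC z y) xy yz; lra.
have [v0 v00] := timelike_orth Xy yv.
have {v00} v_eq : v = 0 by apply: v00; lra.
have {}zE' : z = (2 * k) *: y - x.
  move: v_eq; rewrite vE => /eqP; rewrite subr_eq0 => /eqP <-.
  by rewrite addrC addKr.
have kk : 0 < k ^+ 2 - 1 by nra.
pose r := Num.sqrt (k ^+ 2 - 1).
have r0 : 0 < r by rewrite sqrtr_gt0.
have rr : r ^+ 2 = k ^+ 2 - 1 by rewrite sqr_sqrtr// ltW.
have lm : (k + r) * (k - r) = 1 by have := rr; lra.
have lV : (k + r)^-1 = k - r.
  have h : k + r != 0 by rewrite gt_eqF//; lra.
  by apply: (mulfI h); rewrite mulfV// lm.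
have cr : (2 * r)^-1 * (2 * r) = 1 by rewrite mulVf// gt_eqF//; lra.
have c0 : 0 < (2 * r)^-1 by rewrite invr_gt0; lra.
set c := (2 * r)^-1 in cr c0.
have [p pE] : exists p, p = c *: (y - (k - r) *: x) := ex_intro _ _ erefl.
have [q qE] : exists q, q = c *: ((k + r) *: x - y) := ex_intro _ _ erefl.
have xp : [<x, p>] = - 2^-1.
  by rewrite pE !lfE xy (hyp_self Xx); lra.
have xq : [<x, q>] = - 2^-1.
  by rewrite qE !lfE xy (hyp_self Xx); lra.
have pp : [<p, p>] = 0.
  rewrite pE !lfE (lfC y x) xy (hyp_self Xx) (hyp_self Xy).
  transitivity (c ^+ 2 * (k ^+ 2 - 1 - r ^+ 2)); first by lra.
  by rewrite rr subrr mulr0.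
have qq : [<q, q>] = 0.
  rewrite qE !lfE (lfC y x) xy (hyp_self Xx) (hyp_self Xy).
  transitivity (c ^+ 2 * (k ^+ 2 - 1 - r ^+ 2)); first by lra.
  by rewrite rr subrr mulr0.
have xpq : x = p + q.
  apply/rowP => i; have := congr1 (fun zz => zz * x ord0 i) cr.
  by rewrite pE qE !mxE /=; clear; lra.
have pq : [<p, q>] = - 2^-1 by have := xp; rewrite xpq lfDl pp (lfC q) add0r.
exists p, q, (k + r); split; last 2 first.
- rewrite pE -scalemxAl mulmxBl -scalemxAl -yE -zE zE'.
  apply/rowP => i; have := congr1 (fun zz => zz * (c * x ord0 i)) lm.
  by rewrite !mxE /=; clear; lra.
- rewrite qE -scalemxAl mulmxBl -scalemxAl -yE -zE zE' lV.
  apply/rowP => i; have := congr1 (fun zz => zz * (c * x ord0 i)) lm.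
  by rewrite !mxE /=; clear; lra.
- have [| |_ p0] := @causal_sign _ _ x p Xx; [lra|lra|].
  have [| |_ q0] := @causal_sign _ _ x q Xx; [lra|lra|].
  by split.
- by lra.
Qed.

Lemma lorentz_cvg (T : Type) (F : set_system T) (f h : T -> V) x y : Filter F ->
  f @ F --> x -> h @ F --> y -> (fun i => [<f i, h i>]) @ F --> [<x, y>].
Proof.
move=> FF fx hy.
have cf (j : 'I_n.+1) : (fun i => f i ord0 j) @ F --> x ord0 j.
  by apply: (@cvg_comp _ _ _ f (fun M : V => M ord0 j) F (nbhs x)) => //; exact: coord_continuous.
have ch (j : 'I_n.+1) : (fun i => h i ord0 j) @ F --> y ord0 j.
  by apply: (@cvg_comp _ _ _ h (fun M : V => M ord0 j) F (nbhs y)) => //; exact: coord_continuous.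
rewrite /lorentz; apply: cvgB; last exact: cvgM.
by apply: cvg_big => [|i _]; [exact: add_continuous|exact: cvgM].
Qed.

Lemma lorentz_cvgN (T : Type) (F : set_system T) (f h : T -> V) x y : Filter F ->
  f @ F --> x -> h @ F --> y -> (fun i => - [<f i, h i>]) @ F --> - [<x, y>].
Proof. by move=> FF fx hy; apply: cvgN; exact: lorentz_cvg. Qed.

Lemma entry_le x j : X x -> `|x ord0 j| <= x ord0 ord0.
Proof.
move=> [xx x0]; case: (unliftP ord0 j) => [i ->|->]; last by rewrite ger0_norm// ltW.
have : x ord0 (lift ord0 i) ^+ 2 <= x ord0 ord0 ^+ 2.
  move: xx; rewrite /lorentz (bigD1 i)//= => xx.
  have : 0 <= \sum_(k < n | k != i) x ord0 (lift ord0 k) * x ord0 (lift ord0 k).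
    by apply: sumr_ge0 => k _; rewrite -expr2 sqr_ge0.
  by move: xx; rewrite !expr2; lra.
move/(sqr_le_abs (ltW x0)) => [h1 h2].
by rewrite ler_norml h1 h2.
Qed.

Lemma ultra_fmap (T S : Type) (U : set_system T) (f : T -> S) :
  UltraFilter U -> UltraFilter (f @ U).
Proof.
move=> UU; split; first exact: fmap_proper_filter.
move=> H PH fUH; apply/seteqP; split=> // A HA.
have [//|UnA] := in_ultra_setVsetC (f @^-1` A) UU.
have : H (~` A) by apply: fUH.
move=> HnA; exfalso; apply: (@filter_not_empty _ H PH); rewrite -(setICr A).
exact: (@filterI _ H (@filter_filter _ H PH)).
Qed.

(** Compactness of closed balls, stated for ultrafilters so that no subsequences are extracted: the
    time coordinate is bounded by the distance to [o], and it bounds all other coordinates. *)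
Lemma ultra_cvg (T : Type) (U : set_system T) (f : T -> V) o D : UltraFilter U ->
  X o -> (forall i, X (f i)) -> (forall i, - [<o, f i>] <= D) ->
  exists2 y, X y & f @ U --> y.
Proof.
move=> UU Xo Xf fD.
have [e0 Xe0E] : exists e0 : V, X e0 /\ forall y, - [<e0, y>] = y ord0 ord0.
  exists (delta_mx 0 0); have H y : - [<delta_mx 0 0, y>] = y ord0 ord0.
    rewrite /lorentz big1 ?sub0r ?opprK => [|i _]; rewrite !mxE /= ?mul1r// mul0r//.
  split=> //; split; last by rewrite mxE ltr01.
  by apply: oppr_inj; rewrite opprK H mxE.
have [Xe0 e0E] := Xe0E.
pose C := 2 * (- [<e0, o>]) * D.
have box i j : f i ord0 j \in `[- C, C].
  have f0 : f i ord0 ord0 <= C.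
    rewrite -e0E; apply: le_trans (causal_triangle (hyp_causal Xe0) Xo (hyp_causal (Xf i))) _.
    have e0o := hyp_ge1 Xe0 Xo.
    by have := ler_wpM2l (le_trans ler01 e0o) (fD i); rewrite /C; lra.
  have := entry_le j (Xf i); rewrite ler_norml => /andP[h1 h2].
  by rewrite in_itv/=; apply/andP; split; lra.
have cB : compact [set v : V | forall j, `[- C, C]%classic (v ord0 j)].
  by apply: (@rV_compact R n.+1 (fun=> `[- C, C]%classic)) => j; exact: segment_compact.
rewrite compact_ultra in cB.
have UF : Filter U := @filter_filter _ U (@ultra_proper _ U UU).
have [| |y [_ fy]] := cB (f @ U).
- exact: ultra_fmap.
- by apply: (@filterE _ U UF (f @^-1` _)) => i j; have := box i j; rewrite /= in_itv.
exists y => //.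
have yy : [<y, y>] = -1.
  have := lorentz_cvg UF fy fy; under eq_fun do rewrite (hyp_self (Xf _)).
  move=> h; apply: (cvg_unique (@norm_hausdorff _ _) h); exact: cvg_cst.
have oy : [<o, y>] <= -1.
  apply: (cvgr_to_le (lorentz_cvg UF (cvg_cst o) fy)).
  by apply: filterE => i; have := hyp_ge1 Xo (Xf i); lra.
have [_ y0] : causal y by apply: (causal_sign Xo); lra.
by [].
Qed.

Variables (G : set 'M[R]_n.+1) (k0 : R).
Hypothesis HG : uniform_lattice G k0.

(** A minimizing sequence is translated by [g i] into a bounded region, at the cost of replacing [a]
    by conjugates [b i]. Points and images converge along an ultrafilter, so by discreteness the
    [b i] are eventually one element; the limit minimizes its displacement and is carried back. *)
Lemma displacement_min a : G a ->
  exists2 x, X x & forall y, X y -> - [<x, x *m a>] <= - [<y, y *m a>].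
Proof.
move=> Ga; have [_ k01 _ [e [D [Xe eD]]]] := HG; have ia := G_isol HG Ga.
pose S := [set - [<x, x *m a>] | x in X].
have lbS : has_lbound S.
  by exists 1 => _ [x Xx <-]; apply: hyp_ge1 => //; exact: isol_hyp.
have infS : has_inf S by split=> //; exists (- [<e, e *m a>]), e.
have Sle y : X y -> inf S <= - [<y, y *m a>] by move=> Xy; apply: ge_inf => //; exists y.
have seq i : exists xg : V * 'M[R]_n.+1, [/\ X xg.1, G xg.2,
    - [<xg.1, xg.1 *m a>] < inf S + i.+1%:R^-1 & - [<e, xg.1 *m xg.2>] <= D].
  have [|_ [x Xx <-] xS] := @inf_adherent _ S i.+1%:R^-1 _ infS; first by rewrite invr_gt0.
  by have [g Gg gD] := eD x Xx; exists (x, g).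
have [xg xgP] := choice seq.
pose g i := (xg i).2; pose y i := (xg i).1 *m g i.
pose b i := (g i)^-1 * a * g i; pose u i := y i *m b i.
have Gg i : G (g i) by have [] := xgP i.
have Gb i : G (b i) by apply: (G_M HG) => //; apply: (G_M HG) => //; exact: (G_V HG).
have Xy i : X (y i) by have [h _ _ _] := xgP i; apply: isol_hyp => //; exact: (G_isol HG).
have Xu i : X (u i) by apply: isol_hyp => //; exact: (G_isol HG).
have yu i : [<y i, u i>] = [<(xg i).1, (xg i).1 *m a>].
  have igi := G_isol HG (Gg i).
  by rewrite /u /b /y !actM actK// isol_lf.
have yD i : - [<e, y i>] <= D by have [] := xgP i.
have yuS i : - [<y i, u i>] < inf S + i.+1%:R^-1 by rewrite yu; have [] := xgP i.
have uD i : - [<e, u i>] <= 2 * (D * (inf S + 1)).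
  apply: le_trans (causal_triangle (hyp_causal Xe) (Xy i) (hyp_causal (Xu i))) _.
  have i1 : i.+1%:R^-1 <= 1 :> R by rewrite invf_le1// ler1n.
  have h1 := hyp_ge1 Xe (Xy i); have h2 := hyp_ge1 (Xy i) (Xu i).
  have h3 := yD i; have h4 := yuS i.
  rewrite ler_pM2l// -mulrNN; apply: ler_pM => //.
  - exact: le_trans ler01 h1.
  - exact: le_trans ler01 h2.
  - by apply: (le_trans (ltW h4)); rewrite lerD2l.
have [U [UU ooU]] := @ultraFilterLemma nat \oo _.
have UF : Filter U := @filter_filter _ U (@ultra_proper _ U UU).
have UP : ProperFilter U by exact: ultra_proper.
have [ys Xys cy] := ultra_cvg UU Xe Xy yD.
have [us Xus cu] := ultra_cvg UU Xe Xu uD.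
(* Two applications of [hyp_close] to distances of cosine at most [1 + d] lead to at most 1 + 96 d,
   which is below [k0]. *)
pose d := Num.min 1 ((k0 - 1) / 100).
have d0 : 0 < d by rewrite lt_min; apply/andP; split; lra.
have d1 : d <= 1 by rewrite ge_min lexx.
have d2 : d <= (k0 - 1) / 100 by rewrite ge_min lexx orbT.
have near_lt (f : nat -> V) z : (forall i, X (f i)) -> X z -> f @ U --> z ->
    \forall i \near U, - [<f i, z>] <= 1 + d.
  move=> Xf Xz fz; have := cvgr_le _ ((lorentz_cvgN UF fz (cvg_cst z))).
  by rewrite (hyp_self Xz) opprK; apply; lra.
have ny := near_lt _ _ Xy Xys cy; have nu := near_lt _ _ Xu Xus cu.
have [i0 [yi0 ui0]] := filter_ex (filterI ny nu).
have bE i : - [<y i, ys>] <= 1 + d -> - [<u i, us>] <= 1 + d -> b i = b i0.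
  move=> yi ui.
  have yy : - [<y i0, y i>] <= 2 * (1 + d) ^+ 2 - 1.
    by apply: (hyp_close (Xy i0) Xys (Xy i)) => //; rewrite lfC.
  have uu : - [<u i, u i0>] <= 2 * (1 + d) ^+ 2 - 1.
    by apply: (hyp_close (Xu i) Xus (Xu i0)) => //; rewrite lfC.
  have ibi := G_isol HG (Gb i).
  have yy' : - [<y i0 *m b i, u i>] <= 2 * (1 + d) ^+ 2 - 1 by rewrite isol_lf.
  have Xyb := isol_hyp ibi (Xy i0).
  have := hyp_close Xyb (Xu i) (Xu i0) yy' uu => h.
  have : (b i)^-1 * b i0 = 1.
    apply: (G_free HG (G_M HG (G_V HG (Gb i)) (Gb i0)) Xyb).
    rewrite actM actK//; apply: le_lt_trans h _.
    have d3 : (1 + d) ^+ 2 <= 1 + 3 * d by nra.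
    have d4 : (2 * (1 + d) ^+ 2 - 1) ^+ 2 <= (1 + 6 * d) ^+ 2.
      by rewrite ler_pXn2r ?nnegrE//; clear -d3 d0; nra.
    nra.
  move/(congr1 (fun zz => b i * zz)).
  by rewrite mulrA divrr ?mul1r ?mulr1// (G_unit HG).
have nb : \forall i \near U, b i = b i0.
  by apply: filterS2 ny nu => i; exact: bE.
have ib := G_isol HG (Gb i0).
have usE : us = ys *m b i0.
  have Xyb := isol_hyp ib Xys.
  apply: hyp_eq1 => //; apply/eqP; rewrite eq_le hyp_ge1// andbT.
  have c1 := (lorentz_cvgN UF cu (cvg_cst (ys *m b i0))).
  have c2 := (lorentz_cvgN UF cy (cvg_cst ys)).
  rewrite (hyp_self Xys) opprK in c2.
  apply/ler_addgt0Pl => eps eps0; rewrite addrC.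
  apply: (cvgr_to_le (c1 UF)).
  have := cvgr_le _ (c2 UF) (1 + eps); rewrite ltrDl => /(_ UF eps0) c3.
  by apply: filterS2 nb c3 => i bi; rewrite /u bi isol_lf.
have min : - [<ys, ys *m b i0>] <= inf S.
  rewrite -usE; apply/ler_addgt0Pl => eps eps0; rewrite addrC.
  apply: (cvgr_to_le ((lorentz_cvgN UF cy cu))).
  have ne : \forall i \near U, i.+1%:R^-1 < eps by apply: ooU; exact: (near_infty_natSinv_lt (PosNum eps0)).
  by apply: filterS ne => i ie; apply/ltW/(lt_trans (yuS i)); rewrite ltrD2l.
have ig := G_isol HG (Gg i0).
exists (ys *m (g i0)^-1); first by apply: isol_hyp => //; exact: isolV.
move=> z Xz; apply: le_trans (Sle z Xz); apply: le_trans min.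
rewrite lf_moveV; last exact: isolV.
by rewrite invrK /b !actM.
Qed.

Lemma G_axis a : G a -> a <> 1 -> exists p q l, axis a p q l.
Proof.
move=> Ga a1; have [x Xx xmin] := displacement_min Ga.
have ia := G_isol HG Ga.
apply: (axis_of_min ia Xx _ xmin).
rewrite lt_neqAle hyp_ge1 ?andbT//; last exact: isol_hyp.
apply/eqP => xa; apply: a1; apply: (G_fix HG Ga Xx).
by apply/esym/hyp_eq1 => //; exact: isol_hyp.
Qed.

End AxisExistence.

(** * From symmetries of b a^k to symmetries of a *)

Section KeyLemma.
Context {R : realType} {n : nat}.
Local Notation V := 'rV[R]_n.+1.
Local Notation X := (@hyperbolic_space R n).
Implicit Types (x y z u v p q P Q o : V) (l s t m : R) (a b g h w E F W : 'M[R]_n.+1).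

Lemma eig_actz g v t (j : int) : isol g -> t != 0 -> v *m g = t *: v ->
  v *m g ^ j = t ^ j *: v.
Proof.
move=> ig t0 H; case: j => k; first exact: eig_act.
rewrite NegzE -!exprnN; apply: eig_inv; [exact: isolX|by rewrite expf_neq0|].
exact: eig_act.
Qed.

Lemma commute_inv w E : isol w -> isol E -> w * E = E * w^-1 -> w^-1 * E = E * w.
Proof.
move=> /isol_unit uw /isol_unit uE H.
have := congr1 (fun zz => w^-1 * zz * w) H.
by rewrite mulKr// !mulrA mulrVK// => <-.
Qed.

Section Theory.
Variables (G : set 'M[R]_n.+1) (k0 : R).
Hypothesis HG : uniform_lattice G k0.

(** At the parameter [s * t] both [a] and its conjugate by [E] nearly advance by [l]: the former by
    assumption, the latter because [E] shifts the good point [s] there. *)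
Lemma close_commute a E l P Q s t eps : G a -> normalizes G E ->
  0 < s -> 0 < t -> 0 < l -> null_pair P Q ->
  2 * (1 + eps) ^+ 2 - 1 < k0 ->
  P *m E = t *: P -> Q *m E = t^-1 *: Q ->
  - [<gpt P Q s *m a, gpt P Q (s * l)>] <= 1 + eps ->
  - [<gpt P Q (s * t) *m a, gpt P Q (s * t * l)>] <= 1 + eps ->
  a * E = E * a.
Proof.
move=> Ga NE s0 t0 l0 nPQ ek PE QE H1 H2.
have iE := normalizes_isol NE; have ia := G_isol HG Ga.
have uE := isol_unit iE; have ua := isol_unit ia.
pose F := E^-1 * a * E.
have GF : G F by have [_ /(_ a Ga)[]] := NE.
have iF := G_isol HG GF.
have EF : E * F = a * E by rewrite /F !mulrA divrr// mul1r.
have gE r : gpt P Q r *m E = gpt P Q (r * t) := gpt_act r PE QE.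
have st0 : 0 < s * t by rewrite mulr_gt0.
have Xst := gpt_hyp nPQ st0.
have Xstl : X (gpt P Q (s * t * l)) by apply: gpt_hyp; rewrite // mulr_gt0.
have d1 : - [<gpt P Q (s * t) *m F, gpt P Q (s * t * l)>] <= 1 + eps.
  rewrite -gE -actM EF actM (mulrAC s t l) -gE isol_lf//.
have d2 : - [<gpt P Q (s * t * l), gpt P Q (s * t) *m a>] <= 1 + eps by rewrite lfC.
have := hyp_close (isol_hyp iF Xst) Xstl (isol_hyp ia Xst) d1 d2.
move=> /le_lt_trans /(_ ek) d3.
have : a^-1 * F = 1.
  apply: (G_free HG (G_M HG (G_V HG Ga) GF) (isol_hyp ia Xst)).
  by rewrite actM actK// lfC.
move/(congr1 (fun zz => a * zz)); rewrite mulrA divrr// mul1r mulr1 => Fa.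
by rewrite -EF Fa.
Qed.

(** The condition on [s] centres the reflection between [s] and [s * l], so [E] exchanges these two
    points and the conjugate of [a] nearly undoes [a]. A single good parameter is enough. *)
Lemma close_invert a E l P Q s t eps : G a -> normalizes G E ->
  0 < s -> 0 < t -> 0 < l -> null_pair P Q ->
  2 * (1 + eps) ^+ 2 - 1 < k0 ->
  P *m E = t *: Q -> Q *m E = t^-1 *: P -> s ^+ 2 * t * l = 1 ->
  - [<gpt P Q s *m a, gpt P Q (s * l)>] <= 1 + eps ->
  a * E = E * a^-1.
Proof.
move=> Ga NE s0 t0 l0 nPQ ek PE QE stl H1.
have iE := normalizes_isol NE; have ia := G_isol HG Ga.
have uE := isol_unit iE; have ua := isol_unit ia.
pose F := E^-1 * a * E.
have GF : G F by have [_ /(_ a Ga)[]] := NE.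
have iF := G_isol HG GF.
have EF : E * F = a * E by rewrite /F !mulrA divrr// mul1r.
have gE r : gpt P Q r *m E = gpt P Q (r * t)^-1.
  by rewrite (gpt_act r PE QE) gptC.
have st : (s * t)^-1 = s * l.
  have st0 : s * t != 0 by rewrite mulf_neq0// gt_eqF.
  apply: (mulfI st0); rewrite mulfV// -stl; lra.
have slt : (s * l * t)^-1 = s.
  have slt0 : s * l * t != 0 by rewrite !mulf_neq0// gt_eqF.
  apply: (mulfI slt0); rewrite mulfV// -stl; lra.
have Xs := gpt_hyp nPQ s0.
have Xsl : X (gpt P Q (s * l)) by apply: gpt_hyp; rewrite // mulr_gt0.
have d1 : - [<gpt P Q (s * l) *m F *m a, gpt P Q s *m a>] <= 1 + eps.
  by rewrite isol_lf// -st -gE -actM EF actM -[X in [<_, X>]](congr1 (gpt P Q) slt) -gE isol_lf.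
have := hyp_close (isol_hyp ia (isol_hyp iF Xsl)) (isol_hyp ia Xs) Xsl d1 H1.
move=> /le_lt_trans /(_ ek) d3.
have : F * a = 1.
  by apply: (G_free HG (G_M HG GF Ga) Xsl); rewrite actM lfC.
move/(congr1 (fun zz => zz * a^-1)); rewrite mulrK// mul1r => Fa.
by rewrite -EF Fa.
Qed.

Lemma key a b p q l : G a -> G b -> axis a p q l ->
  exists k w p' q' m, [/\ w = b * a ^+ k, G w, axis w p' q' m &
  forall E, normalizes G E ->
  (w * E = E * w -> exists j : int, a * (w ^ j * E) = (w ^ j * E) * a) /\
  (w * E = E * w^-1 -> exists j : int, a * (w ^ j * E) = (w ^ j * E) * a^-1)].
Proof.
move=> Ga Gb ax; have [npq l1 pa qa] := ax.
have ia := G_isol HG Ga; have ib := G_isol HG Gb.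
have k01 := k0_gt1 HG.
have l0 : 0 < l by lra.
pose eps := Num.min 1 ((k0 - 1) / 8).
have eps0 : 0 < eps by rewrite lt_min; apply/andP; split; lra.
have eps1 : eps <= 1 by rewrite ge_min lexx.
have eps2 : eps <= (k0 - 1) / 8 by rewrite ge_min lexx orbT.
have ek : 2 * (1 + eps) ^+ 2 - 1 < k0 by nra.
have [K KP] := good_interval ia ib ax (no_end_swap HG Ga Gb ax) eps0.
(* Two consecutive exponents cannot both fail, because [a] is not trivial. *)
have [k Kk w1] : exists2 k, (K <= k)%N & b * a ^+ k <> 1.
  have [w1|/eqP w1] := eqVneq (b * a ^+ K) 1; last by exists K.
  exists K.+1 => //; rewrite exprSr mulrA w1 mul1r => a1.
  case: npq => [np _ _]; have : (l - 1) *: p = 0.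
    by rewrite scalerBl -pa a1 act1 scale1r subrr.
  move=> /eqP; rewrite scaler_eq0 subr_eq0 gt_eqF//= => /eqP p0.
  by case: np => _; rewrite p0 mxE ltxx.
have Gw : G (b * a ^+ k) by apply: (G_M HG) => //; exact: (G_X HG).
have [p' [q' [m axw]]] := G_axis HG Gw w1.
exists k, (b * a ^+ k), p', q', m; split=> // E NE.
have iw := G_isol HG Gw; have uw := isol_unit iw.
have [W [P [Q [u [v [WE axW [u0 v0] uv uvP]]]]]] := KP k Kk _ _ _ axw.
set w := b * a ^+ k in iw uw WE Gw *.
have iE := normalizes_isol NE.
have [nPQ m1 PW QW] := axW; have m0 : 0 < m by lra.
have GW : G W by case: WE => ->//; exact: (G_V HG).
have iW := G_isol HG GW.
have Wj j : exists i : int, W ^ j = w ^ i.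
  by case: WE => ->; [exists j|exists (- j); rewrite exprz_inv].
have mj0 j : 0 < m ^ j by rewrite exprz_gt0.
have NWE j : normalizes G (W ^ j * E).
  by apply: normalizesM => //; apply: (G_normalizes HG); exact: (G_exprz HG).
split=> [cwE|iwE].
- have cWE : W * E = E * W.
    by case: WE => ->//; apply/commr_sym/commrV/commr_sym.
  have [t t0 [PE QE]] := commute_axis iW iE axW cWE.
  (* A power of [W] reduces the shift to at most half a period in either direction. *)
  have [j [j1 j2]] : exists j : int, m^-1 <= (t * m ^ j) ^+ 2 /\ (t * m ^ j) ^+ 2 < m.
    have [| | |j [j1 j2]] := @pow_adjust _ (m ^+ 2) (t ^+ 2) m^-1.
    + by rewrite expr2; nra.
    + by rewrite exprn_gt0.
    + by rewrite invr_gt0.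
    exists j; move: j1 j2; rewrite !exprnP exprzAC -exprnP exprnP -exprMn expr2 mulKf ?gt_eqF//.
  have [i iE'] := Wj j; exists i; rewrite -iE'.
  set r := t * m ^ j in j1 j2.
  have r0 : 0 < r by rewrite mulr_gt0.
  have PE' : P *m (W ^ j * E) = r *: P.
    by rewrite actM (eig_actz j iW (lt0r_neq0 m0) PW) -scalemxAl PE scalerA mulrC.
  have QE' : Q *m (W ^ j * E) = r^-1 *: Q.
    rewrite actM (eig_actz j iW (invr_neq0 (lt0r_neq0 m0)) QW) -scalemxAl QE scalerA.
    by rewrite exprz_inv -invr_expz -invfM mulrC.
  (* A forward shift is tested at the start [u] of the good stretch, a backward one at its end
     [v]. *)
  have [r1|r1] := leP 1 r.
    apply: (close_commute Ga (NWE j) u0 r0 l0 nPQ ek PE' QE').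
      apply: uvP => //; apply: (sqr_le_abs (ltW v0) _).2.
      by apply: le_trans uv; rewrite ler_peMr ?sqr_ge0// ltW.
    apply: uvP; first by rewrite ler_peMr// ltW.
    apply: (sqr_le_abs (ltW v0) _).2; apply: le_trans uv.
    by rewrite exprMn ler_wpM2l ?sqr_ge0// ltW.
  have ur : u <= v * r.
    apply: (sqr_le_abs _ _).2; first by rewrite ltW// mulr_gt0.
    rewrite exprMn; apply: (@le_trans _ _ (v ^+ 2 * m^-1)).
      by rewrite ler_pdivlMr.
    by rewrite ler_wpM2l ?sqr_ge0.
  have vr : v * r <= v by rewrite ler_piMr// ltW.
  apply: (close_commute Ga (NWE j) v0 r0 l0 nPQ ek PE' QE').
    by apply: uvP => //; apply: le_trans vr.
  exact: uvP.
have iWE : W * E = E * W^-1.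
  by case: WE => ->//; rewrite invrK; exact: commute_inv.
have [t t0 [PE QE]] := invert_axis iW iE axW iWE.
have tl0 : 0 < (t * l)^-1 by rewrite invr_gt0 mulr_gt0.
(* Composing with powers of [W] moves the centre of the reflection by half periods, so the square of
   the required parameter can be placed in [[u ^+ 2, u ^+ 2 * m)], inside the good stretch. *)
have [i [i1 i2]] := pow_adjust m1 tl0 (exprn_gt0 2 u0).
pose j := - i; have [i' iE'] := Wj j; exists i'; rewrite -iE'.
pose r := t * m ^ j.
have r0 : 0 < r by rewrite mulr_gt0.
have PE' : P *m (W ^ j * E) = r *: Q.
  by rewrite actM (eig_actz j iW (lt0r_neq0 m0) PW) -scalemxAl PE scalerA mulrC.
have QE' : Q *m (W ^ j * E) = r^-1 *: P.
  rewrite actM (eig_actz j iW (invr_neq0 (lt0r_neq0 m0)) QW) -scalemxAl QE scalerA.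
  by rewrite exprz_inv -invr_expz -invfM mulrC.
have c0 : 0 < (t * l)^-1 * m ^ i by rewrite mulr_gt0.
have [s s0 ss] : exists2 s, 0 < s & s ^+ 2 = (t * l)^-1 * m ^ i.
  exists (Num.sqrt ((t * l)^-1 * m ^ i)); first by rewrite sqrtr_gt0.
  by rewrite sqr_sqrtr// ltW.
apply: (close_invert Ga (NWE j) s0 r0 l0 nPQ ek PE' QE').
  rewrite ss /r /j -invr_expz.
  have e1 : (t * l)^-1 * (t * l) = 1 by rewrite mulVf// gt_eqF// mulr_gt0.
  have e2 : m ^ i * (m ^ i)^-1 = 1 by rewrite mulfV// gt_eqF.
  transitivity (((t * l)^-1 * (t * l)) * (m ^ i * (m ^ i)^-1)); first by clear; lra.
  by rewrite e1 e2 mulr1.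
apply: uvP.
  by apply: (sqr_le_abs (ltW s0) _).2; rewrite ss.
by apply: (sqr_le_abs (ltW v0) _).2; rewrite ss (le_trans (ltW i2)).
Qed.

End Theory.
End KeyLemma.

(** * Choosing a lattice element whose axis has no symmetry outside the lattice *)

Section Conclusion.
Context {R : realType} {n : nat}.
Local Notation V := 'rV[R]_n.+1.
Local Notation X := (@hyperbolic_space R n).
Implicit Types (x y z u v p q P Q o : V) (l s t m : R) (a b g h w E F W : 'M[R]_n.+1).

Lemma exists_orth p q : (1 < n)%N -> exists z, [/\ z != 0, [<p, z>] = 0 & [<q, z>] = 0].
Proof.
move=> n1.
pose M : 'M[R]_(n.+1, 2) := \matrix_(i, j) [<delta_mx 0 i, if j == 0 then p else q>].
have ME z j : (z *m M) 0 j = [<z, if j == 0 then p else q>].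
  rewrite [in RHS](row_sum_delta z) lf_suml mxE; apply: eq_bigr => i _.
  by rewrite lfZl mxE.
have K0 : kermx M != 0.
  rewrite kermx_eq0 /row_free neq_ltn; apply/orP; left.
  by apply: leq_ltn_trans (rank_leq_col M) _.
exists (nz_row (kermx M)); have zM : nz_row (kermx M) *m M = 0.
  by apply: sub_kermxP; exact: nz_row_sub.
have H j := esym (ME (nz_row (kermx M)) j); rewrite zM in H.
rewrite nz_row_eq0; split=> //; rewrite lfC.
  by rewrite (H 0) mxE.
by rewrite (H 1) mxE.
Qed.

Section Theory.
Variables (G : set 'M[R]_n.+1) (k0 : R).
Hypothesis HG : uniform_lattice G k0.
Hypothesis n1 : (1 < n)%N.

(** Otherwise the geodesic from [x] in the direction [z] leaves every neighbourhood of the orbit: at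
    [s *: x + t *: z] every orbit point has cosine at least [s]. Cocompactness bounds it by [B],
    while [t] is chosen so that [s ^+ 2 = 1 + B ^+ 2]. *)
Lemma orbit_spans x z : X x -> (forall g, G g -> [<x *m g, z>] = 0) -> z = 0.
Proof.
move=> Xx H; have xz : [<x, z>] = 0 by have := H 1 (G_1 HG); rewrite act1.
have [z0 z1] := timelike_orth Xx xz.
have [/z1//|zz] := eqVneq [<z, z>] 0; exfalso.
have {z1} zz0 : 0 < [<z, z>] by rewrite lt_neqAle eq_sym zz z0.
have [_ _ _ [e [D [Xe eD]]]] := HG.
pose B := 2 * D * - [<e, x>]; pose t := B / Num.sqrt [<z, z>].
have tt : t ^+ 2 * [<z, z>] = B ^+ 2.
  by rewrite /t expr_div_n sqr_sqrtr// divfK.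
have := hyp_scale t Xx xz; rewrite tt; set s := Num.sqrt _ => Xy.
have s0 : 0 <= s by rewrite sqrtr_ge0.
have ss : s ^+ 2 = 1 + B ^+ 2 by rewrite sqr_sqrtr// addr_ge0 ?sqr_ge0.
have [g Gg gD] := eD _ Xy; have ig := G_isol HG Gg.
have Xyg := isol_hyp ig Xy.
have c1 := causal_triangle (hyp_causal Xyg) Xe (hyp_causal Xx).
have GgV := G_V HG Gg.
have xgx := hyp_ge1 Xx (isol_hyp (G_isol HG GgV) Xx).
have ex := hyp_ge1 Xe Xx.
have e1 : - [<(s *: x + t *: z) *m g, x>] = s * - [<x, x *m g^-1>].
  by rewrite lf_moveV// lfDl !lfZl (lfC z) (H _ GgV); lra.
rewrite e1 in c1.
have c2 : s <= s * - [<x, x *m g^-1>] by rewrite ler_peMr.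
have c3 : 2 * ([<(s *: x + t *: z) *m g, e>] * [<e, x>]) <= B.
  rewrite /B (lfC _ e); have e0 : 0 <= - [<e, x>] by lra.
  by have := ler_wpM2r e0 gD; lra.
have sB : s <= B by lra.
have : s ^+ 2 <= B ^+ 2 by rewrite ler_pXn2r ?nnegrE//; lra.
by lra.
Qed.

(** If everything commuted with [a], the orbit of a point of the axis would stay in the plane of [p]
    and [q], which has a nonzero orthogonal vector. *)
Lemma exists_noncommuting a p q l : G a -> axis a p q l ->
  exists2 x, G x & a * x <> x * a.
Proof.
move=> Ga ax; apply: contrapT => /forall2NP H.
have [z [z0 pz qz]] := exists_orth p q n1.
have [npq _ _ _] := ax.
move: z0 => /eqP; apply; apply: (orbit_spans (gpt_hyp npq ltr01)) => g Gg.
have [//|/contrapT ag] := H g.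
have [t t0 [pt qt]] := commute_axis (G_isol HG Ga) (G_isol HG Gg) ax ag.
by rewrite (gpt_act 1 pt qt) /gpt !lfE pz qz !mulr0 addr0.
Qed.

Lemma exists_nontrivial : exists2 g, G g & g <> 1.
Proof.
apply: contrapT => /forall2NP H; have [x Xx] := @exists_hyp R n.
have [z [z0 xz _]] := exists_orth x x n1.
move: z0 => /eqP; apply; apply: (orbit_spans Xx) => g Gg.
by have [//|/contrapT ->] := H g; rewrite act1.
Qed.

(** The conjugate of [a] by [E] lies in [G] and agrees with [a] at a point of the axis, so freeness
    identifies them. *)
Lemma fix_axis_commute a p q l E : G a -> axis a p q l -> normalizes G E ->
  p *m E = p -> q *m E = q -> a * E = E * a.
Proof.
move=> Ga [npq _ pa qa] NE pE qE; have uE := isol_unit (normalizes_isol NE).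
have GF : G (E^-1 * a * E) by have [_ /(_ a Ga)[]] := NE.
have EF : E * (E^-1 * a * E) = a * E by rewrite !mulrA divrr// mul1r.
have -> : a * E = E * (E^-1 * a * E) by rewrite EF.
congr (E * _); apply: (G_eq HG GF Ga (gpt_hyp npq ltr01)).
have oE : gpt p q 1 *m E = gpt p q 1 by rewrite gpt1 mulmxDl pE qE.
rewrite -[in LHS]oE -actM EF actM gpt1 !mulmxDl pa qa -!scalemxAl pE qE.
by [].
Qed.

Lemma fix_commute_same a b p q l E : G a -> G b -> axis a p q l -> a * b = b * a ->
  normalizes G E -> p *m E = p -> q *m E = q -> b * E = E * b.
Proof.
move=> Ga Gb ax ab NE pE qE; have [npq _ _ _] := ax.
have [t t0 [pt qt]] := commute_axis (G_isol HG Ga) (G_isol HG Gb) ax ab.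
have uE := isol_unit (normalizes_isol NE).
have GF : G (E^-1 * b * E) by have [_ /(_ b Gb)[]] := NE.
have EF : E * (E^-1 * b * E) = b * E by rewrite !mulrA divrr// mul1r.
rewrite -EF; congr (E * _); apply: (G_eq HG GF Gb (gpt_hyp npq ltr01)).
have oE : gpt p q 1 *m E = gpt p q 1 by rewrite gpt1 mulmxDl pE qE.
by rewrite -[in LHS]oE -actM EF actM gpt1 !mulmxDl pt qt -!scalemxAl pE qE.
Qed.

(** [E] scales both [p] and [p *m b] by the same [t]. Their product is nonzero, since a shared end
    would make [a] and [b] commute; hence [t ^+ 2 = 1]. *)
Lemma commute_both_fix a b p q l E : G a -> G b -> axis a p q l -> a * b <> b * a ->
  isol E -> a * E = E * a -> b * E = E * b -> p *m E = p /\ q *m E = q.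
Proof.
move=> Ga Gb ax ab iE aE bE; have [npq l1 pa qa] := ax.
have [np nq pq] := npq.
have [t t0 [pt qt]] := commute_axis (G_isol HG Ga) iE ax aE.
have pbE : p *m b *m E = t *: (p *m b) by rewrite -actM bE actM pt scalemxAl.
have : [<p, p *m b>] * (t ^+ 2 - 1) = 0.
  by have := isol_lf p (p *m b) iE; rewrite pt pbE !lfE; lra.
move=> /eqP; rewrite mulf_eq0 => /orP[/eqP ppb|].
  have [m m0 pb] := null_orth np (isol_null (G_isol HG Gb) np) ppb.
  by case: ab; exact: (share_end_commute HG Ga Gb ax pb).
rewrite subr_eq0 sqrf_eq1 => /orP[/eqP t1|/eqP t1]; last by move: t0; rewrite t1 oppr_gt0 ltr10.
by rewrite pt qt t1 invr1 !scale1r.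
Qed.

Lemma comm_exprz w E (j : int) : w * E = E * w -> w * (w ^ j * E) = (w ^ j * E) * w.
Proof.
move=> wE; have ww : GRing.comm w (w ^ j) by apply: commrXz; exact: commr_refl.
by apply: (commrM ww); exact: wE.
Qed.

(** A form of [key] that can be iterated. An adjusted lift commutes with [a] and [w], hence with
    [b], so it fixes the axis of [a] pointwise; fixing a point off infinity, it cannot scale [p']
    either. If [E] itself fixes [p'] and [q'], the adjusting power of [w] does too and is
    trivial. *)
Lemma key_fix a b p q l : G a -> G b -> axis a p q l -> a * b <> b * a ->
  exists w p' q' m, [/\ G w, axis w p' q' m,
    forall E, normalizes G E -> p' *m E = p' -> q' *m E = q' ->
      [/\ p *m E = p, q *m E = q & b * E = E * b] &
    forall E, normalizes G E -> w * E = E * w ->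
      exists g, [/\ G g, p' *m (g * E) = p' & q' *m (g * E) = q']].
Proof.
move=> Ga Gb ax ab; have [k [w [p' [q' [m [wE Gw axw H]]]]]] := key HG Ga Gb ax.
have [npq l1 pa qa] := ax; have [npq' m1 pw qw] := axw.
have ua := G_unit HG Ga; have iw := G_isol HG Gw.
have m0 : m != 0 by rewrite gt_eqF//; lra.
have Xe := gpt_hyp npq ltr01.
have [np' nq' _] := npq'.
have step E : normalizes G E -> w * E = E * w -> exists j : int,
    [/\ p *m (w ^ j * E) = p, q *m (w ^ j * E) = q, b * (w ^ j * E) = (w ^ j * E) * b,
     p' *m (w ^ j * E) = p' & q' *m (w ^ j * E) = q'].
  move=> NE cwE; have [/(_ cwE) [j aE] _] := H E NE; exists j.
  have iE : isol (w ^ j * E).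
    by apply: isolM; [exact: isol_exprz|exact: normalizes_isol NE].
  have wE' := comm_exprz j cwE.
  have bw : b = w * (a ^+ k)^-1 by rewrite wE mulrK// unitrX.
  have bE : b * (w ^ j * E) = (w ^ j * E) * b.
    have ca : GRing.comm (w ^ j * E) (a ^+ k)^-1.
      by apply/commrV/commrX; rewrite /GRing.comm aE.
    have cw : GRing.comm (w ^ j * E) w by rewrite /GRing.comm wE'.
    by rewrite bw; apply/commr_sym/commrM.
  have [pE qE] := commute_both_fix Ga Gb ax ab iE aE bE.
  have [t t0 [pt qt]] := commute_axis iw iE axw wE'.
  have eE : gpt p q 1 *m (w ^ j * E) = gpt p q 1 by rewrite gpt1 mulmxDl pE qE.
  have ep := hyp_causal_gt0 Xe (null_causal np').
  have t1 : t = 1.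
    have : [<gpt p q 1, p'>] * (t - 1) = 0.
      by have := isol_lf (gpt p q 1) p' iE; rewrite eE pt lfZr; lra.
    move=> /eqP; rewrite mulf_eq0 => /orP[/eqP ppb|]; first by lra.
    by rewrite subr_eq0 => /eqP.
  by split=> //; [rewrite pt|rewrite qt]; rewrite t1 ?invr1 scale1r.
exists w, p', q', m; split=> // E NE.
  move=> p'E q'E; have cwE := fix_axis_commute Gw axw NE p'E q'E.
  have [j [pE qE bE p'wE q'wE]] := step E NE cwE.
  have iE := normalizes_isol NE.
  suff wj : w ^ j = 1 by rewrite wj mul1r in pE qE bE.
  apply: (G_fix HG (G_exprz HG j Gw) (gpt_hyp npq' ltr01)).
  rewrite gpt1; apply: (can_inj (fun x => actK x iE)).
  by rewrite -actM !mulmxDl p'wE q'wE p'E q'E.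
move=> cwE; have [j [_ _ _ p'wE q'wE]] := step E NE cwE.
by exists (w ^ j); split=> //; exact: (G_exprz HG).
Qed.

(** Each step replaces the current element by one whose pointwise axis stabilizer is smaller; no
    replacement is made when [b] already commutes with it. *)
Lemma fix_list a p q l (bs : seq 'M[R]_n.+1) : G a -> axis a p q l ->
  (forall b, b \in bs -> G b) ->
  exists w p' q' m, [/\ G w, axis w p' q' m &
    forall E, normalizes G E -> p' *m E = p' -> q' *m E = q' ->
      [/\ p *m E = p, q *m E = q & forall b, b \in bs -> b * E = E * b]].
Proof.
move=> Ga ax; elim: bs => [|b bs IH] Gbs; first by exists a, p, q, l; split.
have [|w [p' [q' [m [Gw axw H]]]]] := IH.
  by move=> c cb; apply: Gbs; rewrite in_cons cb orbT.
have Gb : G b by apply: Gbs; rewrite mem_head.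
have [wb|wb] := pselect (w * b = b * w).
  exists w, p', q', m; split=> // E NE pE qE; have [h1 h2 h3] := H E NE pE qE.
  split=> // c; rewrite in_cons => /orP[/eqP ->|]; last exact: h3.
  exact: (fix_commute_same Gw Gb axw wb NE pE qE).
have [w' [p2 [q2 [m' [Gw' axw' H' _]]]]] := key_fix Gw Gb axw wb.
exists w', p2, q2, m'; split=> // E NE pE qE.
have [h1 h2 h3] := H' E NE pE qE; have [h4 h5 h6] := H E NE h1 h2.
by split=> // c; rewrite in_cons => /orP[/eqP ->//|]; exact: h6.
Qed.

(** A finite list whose span has maximal dimension cannot be enlarged by another orbit point. *)
Lemma orbit_finite_span x : exists bs : seq 'M[R]_n.+1, (forall b, b \in bs -> G b) /\
  forall g, G g -> x *m g \in <<[seq x *m b | b <- bs]>>%VS.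
Proof.
pose Q d := `[< exists bs : seq 'M[R]_n.+1, (forall b, b \in bs -> G b) /\
  \dim <<[seq x *m b | b <- bs]>> = d >].
have exQ : exists d, Q d by exists (\dim <<[seq x *m b | b <- [::]]>>); apply/asboolP; exists [::].
have Qle d : Q d -> (d <= \dim {:V})%N.
  by move=> /asboolP[bs [_ <-]]; apply: dimvS; exact: subvf.
case: (ex_maxnP exQ Qle) => d /asboolP[bs [Gbs dbs]] dmax.
exists bs; split=> // g Gg.
have : Q (\dim <<[seq x *m b | b <- g :: bs]>>).
  apply/asboolP; exists (g :: bs); split=> // b.
  by rewrite in_cons => /orP[/eqP ->//|]; exact: Gbs.
move=> /dmax; rewrite -dbs /= => dle.
have sub : (<<[seq x *m b | b <- bs]>> <= <<x *m g :: [seq x *m b | b <- bs]>>)%VS.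
  by apply: sub_span => v vs; rewrite in_cons vs orbT.
have sE : <<[seq x *m b | b <- bs]>>%VS = <<x *m g :: [seq x *m b | b <- bs]>>%VS.
  by apply/eqP; rewrite eqEdim sub.
by rewrite sE; apply: memv_span; rewrite mem_head.
Qed.

Lemma exists_fix_trivial : exists a p q l, [/\ G a, axis a p q l &
  forall E, normalizes G E -> p *m E = p -> q *m E = q -> E = 1].
Proof.
have [a Ga a1] := exists_nontrivial; have [p [q [l ax]]] := G_axis HG Ga a1.
have [npq _ _ _] := ax; have Xe := gpt_hyp npq ltr01.
have [bs [Gbs Hbs]] := orbit_finite_span (gpt p q 1).
have [w [p' [q' [m [Gw axw H]]]]] := fix_list Ga ax Gbs.
exists w, p', q', m; split=> // E NE pE qE; have [h1 h2 h3] := H E NE pE qE.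
have eE : gpt p q 1 *m E = gpt p q 1 by rewrite gpt1 mulmxDl h1 h2.
have fixE g : G g -> gpt p q 1 *m g *m E = gpt p q 1 *m g.
  move=> /Hbs; set s := [seq _ | _ <- _]; have sE v : v \in s -> v *m E = v.
    by move=> /mapP[b bbs ->]; rewrite -actM h3// actM eE.
  move: (_ *m g) => v /(@coord_span _ _ _ (in_tuple s)) ->.
  rewrite mulmx_suml; apply: eq_bigr => i _; rewrite -scalemxAl sE//.
  by apply: mem_nth.
have iE := normalizes_isol NE.
apply/row_matrixP => i; rewrite !rowE; apply/eqP; rewrite -subr_eq0; apply/eqP.
apply: (orbit_spans Xe) => g Gg.
rewrite lfBr act1 -[in X in X - _](fixE _ Gg) isol_lf// subrr//.
Qed.

Lemma torsion_free (u : 'M[R]_n.+1) : G u -> u * u = 1 -> u = 1.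
Proof.
move=> Gu uu; apply: contrapT => u1; have [p [q [l [[[_ p0] _ _] l1 pu _]]]] := G_axis HG Gu u1.
have : (l * l - 1) *: p = 0.
  by rewrite scalerBl scale1r -scalerA -pu scalemxAl -pu -actM uu act1 subrr.
move=> /eqP; rewrite scaler_eq0 subr_eq0 gt_eqF/=; last by nra.
by move=> /eqP pE; move: p0; rewrite pE mxE ltxx.
Qed.

(** A nontrivial [v] commuting with [a] has the same axis, up to orientation, so [u] preserves an
    end of the axis of [a]. *)
Lemma commute_trans a (u v : 'M[R]_n.+1) p q l : G a -> G u -> G v -> axis a p q l -> v <> 1 ->
  a * v = v * a -> v * u = u * v -> a * u = u * a.
Proof.
move=> Ga Gu Gv ax v1 av vu; have [npq _ _ _] := ax.
have iv := G_isol HG Gv; have iu := G_isol HG Gu.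
have [t t0 [pt qt]] := commute_axis (G_isol HG Ga) iv ax av.
have [t1|t1|t1] := ltgtP t 1.
- have axv : axis v q p t^-1.
    split; [exact: null_pairC|by rewrite invf_gt1|by []|by rewrite invrK].
  have [s s0 [qs ps]] := commute_axis iv iu axv vu.
  exact: (share_end_commute HG Ga Gu ax ps).
- have axv : axis v p q t by split.
  have [s s0 [ps qs]] := commute_axis iv iu axv vu.
  exact: (share_end_commute HG Ga Gu ax ps).
- case: v1; apply: (G_fix HG Gv (gpt_hyp npq ltr01)).
  by rewrite gpt1 mulmxDl pt qt t1 invr1 !scale1r.
Qed.

Lemma not_both_inverted a p q l (x : 'M[R]_n.+1) E E1 : G a -> axis a p q l -> G x ->
  a * x <> x * a -> (forall F, normalizes G F -> a * F = F * a -> G F) ->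
  normalizes G E -> normalizes G E1 ->
  a * E = E * a^-1 -> x * E = E * x^-1 -> a * E1 = E1 * a^-1 ->
  (x^-1 * a * x) * E1 = E1 * (x^-1 * a * x)^-1 -> False.
Proof.
move=> Ga ax Gx ac cent NE NE1 aE xE aE1 yE1.
have ua := G_unit HG Ga; have ux := G_unit HG Gx.
have uE := isol_unit (normalizes_isol NE); have uE1 := isol_unit (normalizes_isol NE1).
have aEV : a * E^-1 = E^-1 * a^-1.
  by have := congr1 (fun zz => zz^-1) aE; rewrite !invrM ?unitrV// invrK.
have quot F : normalizes G F -> a * F = F * a^-1 ->
    G (E^-1 * F) /\ a * (E^-1 * F) = (E^-1 * F) * a.
  move=> NF aF; have aEF : a * (E^-1 * F) = (E^-1 * F) * a.
    by rewrite [LHS]mulrA aEV -[LHS]mulrA (commute_inv (G_isol HG Ga) (normalizes_isol NF) aF) mulrA.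
  by split=> //; apply: cent => //; apply: normalizesM => //; exact: normalizesV.
have [Gc ac'] := quot _ NE1 aE1; set c := E^-1 * E1 in Gc ac'.
have E1E : E1 = E * c by rewrite /c mulrA divrr// mul1r.
have NE2 : normalizes G (x * E1 * x^-1).
  apply: normalizesM; last exact/(G_normalizes HG)/(G_V HG).
  by apply: normalizesM => //; exact: (G_normalizes HG).
have yV : (x^-1 * a * x)^-1 = x^-1 * a^-1 * x.
  by rewrite !invrM ?unitrMr ?unitrV// invrK mulrA.
(* Conjugating by [x] turns an inverter of [x^-1 * a * x] into an inverter of [a], which can be
   compared with [E]. *)
have aE2 : a * (x * E1 * x^-1) = (x * E1 * x^-1) * a^-1.
  have := congr1 (fun zz => x * zz * x^-1) yE1; rewrite yV !mulrA divrr// mul1r => ->.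
  by rewrite mulrK.
have [Gd ad] := quot _ NE2 aE2.
have dE : E^-1 * (x * E1 * x^-1) = x^-1 * c * x^-1.
  by rewrite E1E !mulrA -[E^-1 * x * E]mulrA xE mulKr.
rewrite dE in Gd ad.
pose u := c * x^-1; have Gu : G u by apply: (G_M HG) => //; exact: (G_V HG).
have uuE : u * u = c * (x^-1 * c * x^-1) by rewrite /u !mulrA.
have Gv : G (u * u) by apply: (G_M HG).
have av : a * (u * u) = (u * u) * a.
  by rewrite uuE; apply: (commrM (ac' : GRing.comm _ _) ad).
have au : a * u = u * a.
  have [v1|/eqP v1] := eqVneq (u * u) 1.
    by rewrite (torsion_free Gu v1) mulr1 mul1r.
  exact: (commute_trans Ga Gu Gv ax v1 av (esym (mulrA u u u))).
apply: ac; have -> : x = u^-1 * c.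
  by rewrite /u invrM ?unitrV ?(G_unit HG)// invrK -mulrA mulVr ?mulr1// (G_unit HG).
exact: (commrM (commrV (au : GRing.comm _ _)) ac').
Qed.

(** One more use of [key_fix] is needed, since the previous element only controls lifts that fix its
    axis pointwise: for the new [w], a commuting lift becomes such a one after a correction in
    [G]. *)
Lemma centralizer_in_lattice : exists a p q l, [/\ G a, axis a p q l &
  forall E, normalizes G E -> a * E = E * a -> G E].
Proof.
have [a [p [q [l [Ga ax H]]]]] := exists_fix_trivial.
have [x Gx ac] := exists_noncommuting Ga ax.
have [w [p' [q' [m [Gw axw H1 H2]]]]] := key_fix Ga Gx ax ac.
exists w, p', q', m; split=> // E NE wE.
have [g [Gg pgE qgE]] := H2 E NE wE.
have NgE : normalizes G (g * E) by apply: normalizesM => //; exact: (G_normalizes HG).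
have [h1 h2 _] := H1 _ NgE pgE qgE.
have gE1 := H _ NgE h1 h2; have ug := G_unit HG Gg.
have -> : E = g^-1 by rewrite -[LHS](mulKr ug) gE1 mulr1.
exact: (G_V HG).
Qed.

Lemma exists_asymmetric : exists w p q l, [/\ G w, axis w p q l &
  forall E, normalizes G E -> w * E = E * w \/ w * E = E * w^-1 -> G E].
Proof.
have [a [p [q [l [Ga ax cent]]]]] := centralizer_in_lattice.
have ua := G_unit HG Ga.
have [b Gb noinv] : exists2 b, G b &
    forall E, normalizes G E -> a * E = E * a^-1 -> b * E = E * b^-1 -> False.
  have [x Gx ac] := exists_noncommuting Ga ax.
  have [[E [NE aE xE]]|nE] := pselect (exists E,
      [/\ normalizes G E, a * E = E * a^-1 & x * E = E * x^-1]).
    exists (x^-1 * a * x).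
      by apply: (G_M HG) => //; apply: (G_M HG) => //; exact: (G_V HG).
    move=> E1 NE1 aE1 yE1.
    exact: (not_both_inverted Ga ax Gx ac cent NE NE1 aE xE aE1 yE1).
  by exists x => // E NE aE xE; apply: nE; exists E.
have [k [w [p' [q' [m [wE Gw axw H]]]]]] := key HG Ga Gb ax.
exists w, p', q', m; split=> // E NE.
have NwE j : normalizes G (w ^ j * E).
  by apply: normalizesM => //; apply/(G_normalizes HG)/(G_exprz HG).
have uak : a ^+ k \is a GRing.unit by rewrite unitrX.
have ub := G_unit HG Gb.
have [H1 H2] := H E NE.
case=> [/H1[j aE]|wEi]; last (have [j aE] := H2 wEi; exfalso).
  have GwE := cent _ (NwE j) aE.
  have uwj := G_unit HG (G_exprz HG j Gw).
  by rewrite -[E](mulKr uwj); apply: (G_M HG) => //; apply/(G_V HG)/(G_exprz HG).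
set E' := w ^ j * E in aE.
have wE' : w * E' = E' * w^-1.
  by rewrite /E' [LHS]mulrA (commrXz _ (commr_refl w)) -[LHS]mulrA wEi mulrA.
have aVE' := commute_inv (G_isol HG Ga) (normalizes_isol (NwE j)) aE.
have akE' i : a ^- i * E' = E' * a ^+ i.
  by elim: i => [|i IH]; rewrite ?expr0 ?invr1 ?mul1r ?mulr1// exprS invrM ?unitrX// -mulrA aVE' mulrA IH -mulrA -exprSr exprS.
(* [E'] inverts [a] and [w]; multiplied by [a ^- k] it still inverts [a], and it inverts
   [b = w * a ^- k]. *)
apply: (noinv (E' * a ^- k)).
- apply: normalizesM; first exact: NwE.
  by apply/(G_normalizes HG)/(G_V HG)/(G_X HG).
- by rewrite mulrA aE -[LHS]mulrA -[RHS]mulrA; congr (_ * _); exact: (commrV (commrX k (commr_sym (commrV (commr_refl a))))).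
have bw : b = w * a ^- k by rewrite wE mulrK.
have bVw : b^-1 = a ^+ k * w^-1 by rewrite bw invrM ?unitrV ?(G_unit HG Gw)// invrK.
rewrite bVw [RHS]mulrA (mulrVK uak).
transitivity (w * (a ^- k * E') * a ^- k); first by rewrite {1}bw !mulrA.
by rewrite akE' [w * _]mulrA (mulrK uak) wE'.
Qed.

End Theory.
End Conclusion.

(** * The hyperbolic distance *)

Section HyperbolicFunctions.
Context {R : realType}.
Implicit Types s t a b : R.

Definition cosh t := (expR t + expR (- t)) / 2.
Definition sinh t := (expR t - expR (- t)) / 2.

Lemma expRNK t : expR t * expR (- t) = 1.
Proof. by rewrite -expRD subrr expR0. Qed.

Lemma cosh_sinh t : cosh t ^+ 2 - sinh t ^+ 2 = 1.
Proof. by rewrite /cosh /sinh; have := expRNK t; lra. Qed.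

Lemma coshD a b : cosh (a + b) = cosh a * cosh b + sinh a * sinh b.
Proof. by rewrite /cosh /sinh opprD !expRD; lra. Qed.

Lemma coshB a b : cosh (a - b) = cosh a * cosh b - sinh a * sinh b.
Proof. by rewrite /cosh /sinh opprB !expRD; lra. Qed.

Lemma coshN t : cosh (- t) = cosh t.
Proof. by rewrite /cosh opprK addrC. Qed.

Lemma sinh_ge0 t : 0 <= t -> 0 <= sinh t.
Proof.
move=> t0; have : expR (- t) <= expR t by rewrite ler_expR; lra.
by rewrite /sinh; lra.
Qed.

Lemma cosh0 : cosh 0 = 1 :> R.
Proof. by rewrite /cosh oppr0 expR0; lra. Qed.

Lemma sinh0 : sinh 0 = 0 :> R.
Proof. by rewrite /sinh oppr0 expR0; lra. Qed.

Lemma lt_cosh a b : 0 <= a -> a < b -> cosh a < cosh b.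
Proof.
move=> a0 ab; have x1 : 1 <= expR a by rewrite -expR0 ler_expR.
have xy : expR a < expR b by rewrite ltr_expR.
have e1 := expRNK a; have e2 := expRNK b.
have ea : expR (- a) <= 1 by rewrite -expR0 ler_expR; lra.
have eb : expR (- b) < 1 by rewrite -expR0 ltr_expR; lra.
have ea0 := expR_gt0 (- a); have eb0 := expR_gt0 (- b).
have : 0 < (expR b - expR a) * (1 - expR (- a) * expR (- b)).
  by apply: mulr_gt0; nra.
have -> : (expR b - expR a) * (1 - expR (- a) * expR (- b)) =
  expR b - expR a - (expR b * expR (- b)) * expR (- a) + (expR a * expR (- a)) * expR (- b) by lra.
by rewrite e1 e2 /cosh; lra.
Qed.

Lemma lt_sinh a b : a < b -> sinh a < sinh b.
Proof.
move=> ab; have : expR a < expR b by rewrite ltr_expR.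
by have : expR (- b) < expR (- a) by [rewrite ltr_expR; lra]; rewrite /sinh; lra.
Qed.

Lemma le_cosh a b : 0 <= a -> a <= b -> cosh a <= cosh b.
Proof. by move=> a0; rewrite le_eqVlt => /orP[/eqP ->//|/(lt_cosh a0)/ltW]. Qed.

Lemma le_sinh a b : a <= b -> sinh a <= sinh b.
Proof. by rewrite le_eqVlt => /orP[/eqP ->//|/lt_sinh/ltW]. Qed.

Lemma cosh_gt1 a : 0 < a -> 1 < cosh a.
Proof. by move=> a0; rewrite -cosh0 lt_cosh. Qed.

Lemma arcosh_ge0 t : 1 <= t -> 0 <= arcosh t.
Proof. by move=> t1; rewrite /arcosh ln_ge0//; have := sqrtr_ge0 (t ^+ 2 - 1); lra. Qed.

Lemma arcoshK t : 1 <= t -> cosh (arcosh t) = t.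
Proof.
move=> t1; have t2 : 0 <= t ^+ 2 - 1 by nra.
have ss := sqr_sqrtr t2; have s0 := sqrtr_ge0 (t ^+ 2 - 1).
rewrite /arcosh; set s := Num.sqrt _ in ss s0 *.
have ts : 0 < t + s by lra.
rewrite /cosh expRN lnK ?posrE//.
have -> : (t + s)^-1 = t - s.
  by apply: (mulfI (lt0r_neq0 ts)); rewrite mulfV ?lt0r_neq0//; lra.
by lra.
Qed.

Lemma coshK t : 0 <= t -> arcosh (cosh t) = t.
Proof.
move=> t0; have s0 := sinh_ge0 t0; rewrite /arcosh.
have -> : cosh t ^+ 2 - 1 = sinh t ^+ 2 by have := cosh_sinh t; lra.
rewrite sqrtr_sqr ger0_norm//.
by have -> : cosh t + sinh t = expR t by [rewrite /cosh /sinh; lra]; rewrite expRK.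
Qed.

End HyperbolicFunctions.

Section HDist.
Context {R : realType} {n : nat}.
Local Notation V := 'rV[R]_n.+1.
Local Notation X := (@hyperbolic_space R n).
Implicit Types (x y z u v p q o : V) (r s t a b K A B : R).

Lemma hdist_ge0 x y : X x -> X y -> 0 <= hdist x y.
Proof. by move=> Xx Xy; apply/arcosh_ge0/hyp_ge1. Qed.

Lemma cosh_hdist x y : X x -> X y -> cosh (hdist x y) = - [<x, y>].
Proof. by move=> Xx Xy; rewrite arcoshK// hyp_ge1. Qed.

Lemma hdist_sym x y : hdist x y = hdist y x.
Proof. by rewrite /hdist lfC. Qed.

Lemma hdist_lt x y r : X x -> X y -> 0 < r -> (hdist x y < r) = (- [<x, y>] < cosh r).
Proof.
move=> Xx Xy r0; have d0 := hdist_ge0 Xx Xy; rewrite -(cosh_hdist Xx Xy).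
apply/idP/idP => [|]; first exact: lt_cosh.
by apply: contraTT; rewrite -!leNgt; apply: le_cosh; exact: ltW.
Qed.

Lemma hdist_le x y r : X x -> X y -> 0 <= r -> (hdist x y <= r) = (- [<x, y>] <= cosh r).
Proof.
move=> Xx Xy r0; have d0 := hdist_ge0 Xx Xy; rewrite -(cosh_hdist Xx Xy).
apply/idP/idP => [|]; first exact: le_cosh.
by apply: contraTT; rewrite -!ltNge; apply: lt_cosh.
Qed.

Lemma hdistxx x : X x -> hdist x x = 0.
Proof. by move=> Xx; rewrite /hdist (hyp_self Xx) opprK -cosh0 coshK. Qed.

Lemma hdist_le0 x y : X x -> X y -> hdist x y <= 0 -> x = y.
Proof.
move=> Xx Xy; rewrite hdist_le// cosh0 => xy; apply: hyp_eq1 => //.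
by apply/le_anti; rewrite xy hyp_ge1.
Qed.

Lemma hdist_triangle x y z : X x -> X y -> X z -> hdist x z <= hdist x y + hdist y z.
Proof.
move=> Xx Xy Xz; have h1 := hdist_ge0 Xx Xy; have h2 := hdist_ge0 Xy Xz.
rewrite hdist_le// ?addr_ge0// coshD.
have := @lf_perp _ _ x y z Xy; rewrite (hyp_self Xx) (hyp_self Xz).
have c1 := cosh_sinh (hdist x y); have c2 := cosh_sinh (hdist y z).
have s1 := sinh_ge0 h1; have s2 := sinh_ge0 h2.
rewrite !cosh_hdist// in c1 c2 *; clear h1 h2.
move: (sinh (hdist x y)) (sinh (hdist y z)) s1 s2 c1 c2 => s t s1 s2.
move: [<x, z>] [<x, y>] [<y, z>] => xz xy yz c1 c2.
have -> : -1 + xy ^+ 2 = s ^+ 2 by lra.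
have -> : -1 + yz ^+ 2 = t ^+ 2 by lra.
rewrite -exprMn => H; have [|h3 _] := sqr_le_abs _ H; first exact: mulr_ge0.
by clear H c1 c2 s1 s2; lra.
Qed.

Lemma isol_hdist (g : 'M[R]_n.+1) x y : isol g -> hdist (x *m g) (y *m g) = hdist x y.
Proof. by move=> ig; rewrite /hdist isol_lf. Qed.

Lemma hballP x y r : X x -> 0 < r -> hball x r y <-> X y /\ - [<x, y>] < cosh r.
Proof.
move=> Xx r0; split=> [[Xy]|[Xy]]; first by rewrite hdist_lt.
by move=> xy; split=> //; rewrite hdist_lt.
Qed.

(** Radial projection onto the closed ball of radius [K] about [o]; outside the ball, the point at
    distance [K] on the radius through [x]. *)
Definition retract o K x :=
  if hdist o x <= K then x
  else cosh K *: o + (sinh K / sinh (hdist o x)) *: (x - cosh (hdist o x) *: o).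

Lemma retractE o K x : X o -> X x -> 0 <= K -> exists c : R,
  [/\ 0 <= c <= 1, c * sinh (hdist o x) = sinh (Num.min K (hdist o x)) &
   retract o K x = cosh (Num.min K (hdist o x)) *: o + c *: (x - cosh (hdist o x) *: o)].
Proof.
move=> Xo Xx K0; have d0 := hdist_ge0 Xo Xx; rewrite /retract.
have [xK|Kx] := leP (hdist o x) K.
  by exists 1; rewrite lexx ler01 mul1r scale1r addrC subrK; split.
have s0 : 0 < sinh (hdist o x) by rewrite -sinh0; apply: lt_sinh; lra.
exists (sinh K / sinh (hdist o x)); rewrite divfK ?gt_eqF//; split=> //.
rewrite divr_ge0 ?sinh_ge0//= ler_pdivrMr// mul1r.
exact/le_sinh/ltW.
Qed.

Lemma lf_radial o x : X o -> X x ->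
  [<o, x - cosh (hdist o x) *: o>] = 0 /\
  [<x - cosh (hdist o x) *: o, x - cosh (hdist o x) *: o>] = sinh (hdist o x) ^+ 2.
Proof.
move=> Xo Xx; have := cosh_sinh (hdist o x); rewrite cosh_hdist// => H.
by rewrite !lfE (hyp_self Xo) (hyp_self Xx) (lfC x o); split; lra.
Qed.

Lemma retract_hyp o K x : X o -> X x -> 0 <= K ->
  X (retract o K x) /\ hdist o (retract o K x) = Num.min K (hdist o x).
Proof.
move=> Xo Xx K0; have [c [c01 cs rE]] := retractE Xo Xx K0.
have d0 := hdist_ge0 Xo Xx.
have m0 : 0 <= Num.min K (hdist o x) by rewrite le_min K0.
have [ow ww] := lf_radial Xo Xx; rewrite rE.
move: (x - cosh (hdist o x) *: o) ow ww => w ow ww.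
set m := Num.min K _ in cs m0 *.
have [y yE] : exists y, y = cosh m *: o + c *: w := ex_intro _ _ erefl.
have oy : [<o, y>] = - cosh m by rewrite yE lfDr !lfZr ow (hyp_self Xo); lra.
have yy : [<y, y>] = -1.
  have -> : [<y, y>] = - cosh m ^+ 2 + (c * sinh (hdist o x)) ^+ 2.
    by rewrite yE !(lfDl, lfDr, lfZl, lfZr) ow (lfC w o) ow ww (hyp_self Xo); lra.
  by rewrite cs; have := cosh_sinh m; lra.
have cm := le_cosh (lexx 0) m0; rewrite cosh0 in cm.
have [_ y0] : causal y by apply: (causal_sign Xo); lra.
by rewrite -yE; split; [|rewrite /hdist oy opprK coshK].
Qed.

Lemma retract_dist o K x : X o -> X x -> 0 <= K ->
  hdist x (retract o K x) = hdist o x - Num.min K (hdist o x).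
Proof.
move=> Xo Xx K0; have [c [c01 cs rE]] := retractE Xo Xx K0.
have d0 := hdist_ge0 Xo Xx.
have mle : Num.min K (hdist o x) <= hdist o x by rewrite ge_min lexx orbT.
have [ow ww] := lf_radial Xo Xx; rewrite {1}/hdist rE.
have -> : - [<x, cosh (Num.min K (hdist o x)) *: o + c *: (x - cosh (hdist o x) *: o)>] =
   cosh (hdist o x - Num.min K (hdist o x)).
  rewrite coshB -cs.
  have xE : x = cosh (hdist o x) *: o + (x - cosh (hdist o x) *: o) by rewrite addrC subrK.
  have xo : [<x, o>] = - cosh (hdist o x) by rewrite cosh_hdist// lfC opprK.
  have xw : [<x, x - cosh (hdist o x) *: o>] = sinh (hdist o x) ^+ 2.
    by rewrite {1}xE lfDl lfZl ow ww; lra.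
  by rewrite lfDr !lfZr xo xw; lra.
by rewrite coshK// subr_ge0.
Qed.

(* Only the angle between the radii matters; the extreme case is angle zero. *)
Lemma retract_cosh K A B : 0 <= K -> 0 <= A -> 0 <= B ->
  cosh (Num.min K A - Num.min K B) <= cosh (A - B).
Proof.
move=> K0 A0 B0; rewrite /Num.min; case: ltP => h; case: ltP => h' //.
- have [h3|h3] := leP B A; first by apply: le_cosh; lra.
  by rewrite -(coshN (A - B)); apply: le_cosh; lra.
- by apply: le_cosh; lra.
- by rewrite -(coshN (A - K)) -(coshN (A - B)); apply: le_cosh; lra.
Qed.

(** By the law of cosines the cosine of the distance is cosh A cosh B - t with t at most sinh A sinh
    B. Retracting multiplies t by [c * c'], at most 1, which reduces the claim to the largest t. *)
Lemma retract_lip o K x y : X o -> X x -> X y -> 0 <= K ->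
  hdist (retract o K x) (retract o K y) <= hdist x y.
Proof.
move=> Xo Xx Xy K0; have d0 := hdist_ge0 Xx Xy.
have [Xrx _] := retract_hyp Xo Xx K0; have [Xry _] := retract_hyp Xo Xy K0.
rewrite hdist_le// cosh_hdist//.
have [c [/andP[c0 c1] cs ->]] := retractE Xo Xx K0.
have [c' [/andP[c0' c1'] cs' ->]] := retractE Xo Xy K0.
have [ox xx] := lf_radial Xo Xx; have [oy yy] := lf_radial Xo Xy.
have [w wE] : exists w, w = x - cosh (hdist o x) *: o := ex_intro _ _ erefl.
have [w' wE'] : exists w', w' = y - cosh (hdist o y) *: o := ex_intro _ _ erefl.
rewrite -wE in ox xx *; rewrite -wE' in oy yy *.
have xy : [<x, y>] = - (cosh (hdist o x) * cosh (hdist o y)) + [<w, w'>].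
  have xE : x = cosh (hdist o x) *: o + w by rewrite wE addrC subrK.
  have yE : y = cosh (hdist o y) *: o + w' by rewrite wE' addrC subrK.
  rewrite {1}xE {1}yE; move: (hdist o x) (hdist o y) => A B.
  by rewrite !(lfDl, lfDr, lfZl, lfZr) oy (lfC w o) ox (hyp_self Xo); clear; lra.
rewrite xy; clear xy wE wE'.
have CS := orth_CS Xo ox oy.
rewrite !(lfDl, lfDr, lfZl, lfZr) oy (lfC w o) ox (hyp_self Xo).
move: [<w, w>] [<w', w'>] xx yy CS => ww ww' -> ->; rewrite -exprMn => CS.
have a0 := hdist_ge0 Xo Xx; have b0 := hdist_ge0 Xo Xy.
have sa := sinh_ge0 a0; have sb := sinh_ge0 b0.
have [h1 h2] := sqr_le_abs (mulr_ge0 sa sb) CS.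
move: [<w, w'>] h1 h2 {CS} => t h1 h2.
move: (hdist o x) (hdist o y) a0 b0 sa sb cs cs' h1 h2 => A B a0 b0 sa sb cs cs' h1 h2.
clear ox oy w w' Xo Xx Xy Xrx Xry d0.
have := retract_cosh K0 a0 b0; rewrite !coshB -cs -cs'; clear cs cs'.
move: (cosh A) (cosh B) (cosh _) (cosh _) (sinh A) (sinh B) h1 h2 sa sb => {a0 b0}.
move=> cA cB mA mB sA sB h1 h2 sa sb H.
have cc : c * c' <= 1 by rewrite -[leRHS]mulr1; apply: ler_pM.
have : (1 - c * c') * t <= (1 - c * c') * (sA * sB).
  by apply: ler_wpM2l => //; rewrite subr_ge0.
by clear -H; lra.
Qed.

(** Steps of length at most [d / 2] along the geodesic from [x], produced by retractions. *)
Lemma hyp_chain (Q : V -> Prop) d x y : 0 < d ->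
  (forall x y, X x -> X y -> hdist x y < d -> Q x -> Q y) ->
  X x -> X y -> Q x -> Q y.
Proof.
move=> d0 H Xx + Qx.
suff step k : forall y, X y -> hdist x y <= k%:R * (d / 2) -> Q y.
  move=> Xy; apply: (step (Num.bound (hdist x y / (d / 2)))) => //.
  rewrite -ler_pdivrMr; last by lra.
  by apply/ltW/archi_boundP; rewrite divr_ge0 ?hdist_ge0//; lra.
elim: k => [|k IH] {}y Xy.
  by rewrite mul0r => /(hdist_le0 Xx Xy) <-.
rewrite -natr1 mulrDl mul1r; have : 0 <= k%:R * (d / 2) by rewrite mulr_ge0//; lra.
move: (k%:R * (d / 2)) IH => K IH K0 xy.
have [Xr rd] := retract_hyp Xx Xy K0.
apply: (H (retract x K y)) => //; last by apply: IH => //; rewrite rd ge_min lexx.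
rewrite hdist_sym retract_dist//; clear -d0 xy.
by rewrite /Num.min; have [h|h] := ltP K (hdist x y); lra.
Qed.

End HDist.

(** * The developing map and the deck group *)

Section Charts.
Context {R : realType} {n : nat} {M : metricType R}.
Local Notation V := 'rV[R]_n.+1.
Local Notation X := (@hyperbolic_space R n).
Implicit Types (x y z u v p q o : V) (r e s : R) (psi : V -> M) (g : 'M[R]_n.+1).

(** Charts go from hyperbolic space to [M], as total maps of which only the values on the ball
    matter. The last clause makes the image contain the whole ball of radius [r] in [M]. *)
Definition chart r x psi := [/\ X x,
  forall y z, hball x r y -> hball x r z -> mdist (psi y) (psi z) = hdist y z &
  forall m : M, mdist (psi x) m < r -> exists2 y, hball x r y & psi y = m].

Lemma hball_center x r : X x -> 0 < r -> hball x r x.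
Proof. by move=> Xx r0; split=> //; rewrite hdistxx. Qed.

Lemma chart_dist r x psi y : 0 < r -> chart r x psi -> hball x r y ->
  mdist (psi x) (psi y) = hdist x y.
Proof. by move=> r0 [Xx H _] xy; apply: H => //; exact: hball_center. Qed.

Lemma chart_inj r x psi y z : chart r x psi -> hball x r y -> hball x r z ->
  psi y = psi z -> y = z.
Proof.
move=> [Xx H _] xy xz yz; case: (xy) => Xy _; case: (xz) => Xz _.
by apply: hdist_le0 => //; rewrite -H// yz mdistxx.
Qed.

Lemma chart_sub r r' x y psi : 0 < r' -> chart r x psi -> hball x r y ->
  hdist x y + r' <= r -> chart r' y psi.
Proof.
move=> r'0 [Xx H1 H2] [Xy xy] xyr.
have sub z : hball y r' z -> hball x r z.
  by move=> [Xz yz]; split=> //; have := hdist_triangle Xx Xy Xz; lra.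
have xyb : hball x r y by [].
have r0 : 0 < r by have := hdist_ge0 Xx Xy; lra.
split=> // [z w /sub xz /sub xw|m ym]; first exact: H1.
have [|z xz zm] := H2 m.
  have := metric_triangle (psi x) (psi y) m.
  by rewrite (H1 x y)//; [lra|exact: hball_center].
exists z => //; split; first by case: xz.
by rewrite -H1// zm.
Qed.

Lemma chart_ext r x psi psi' : 0 < r -> (forall y, hball x r y -> psi y = psi' y) ->
  chart r x psi -> chart r x psi'.
Proof.
move=> r0 E [Xx H1 H2]; split=> // [y z xy xz|m].
  by rewrite -!E//; exact: H1.
by rewrite -E => [/H2[y xy ym]|]; [exists y => //; rewrite -E|exact: hball_center].
Qed.

Lemma hball_act g x r y : isol g -> hball x r y -> hball (x *m g) r (y *m g).
Proof. by move=> ig [Xy xy]; split; [exact: isol_hyp|rewrite isol_hdist]. Qed.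

Lemma chart_comp g r x psi : isol g -> X x -> chart r (x *m g) psi ->
  chart r x (fun y => psi (y *m g)).
Proof.
move=> ig Xx [Xxg H1 H2]; split=> // [y z xy xz|m /H2[y xy ym]].
  by rewrite H1 ?isol_hdist//; exact: hball_act.
exists (y *m g^-1); last by rewrite actVK.
by have := hball_act (isolV ig) xy; rewrite actK.
Qed.

Lemma chart_iso (f : M -> M) r x psi : isometry_group f -> chart r x psi ->
  chart r x (f \o psi).
Proof.
move=> [[f' fK f'K] fi] [Xx H1 H2]; split=> // [y z xy xz|m fm].
  by rewrite /= fi H1.
have [|y xy ym] := H2 (f' m); first by rewrite -fi f'K.
by exists y => //=; rewrite ym f'K.
Qed.

(* On overlaps a change of charts is linear, so it is determined by any ball. *)
Lemma chart_agree r x y z psi psi' e : 0 < r -> chart r x psi -> chart r y psi' ->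
  0 < e -> X z -> hdist x z < r / 4 -> hdist y z < r / 4 ->
  (forall u, hball z e u -> psi u = psi' u) ->
  forall u, hball y (r / 2) u -> psi u = psi' u.
Proof.
move=> r0 cx cy e0 Xz xz yz E.
have [Xx H1 H2] := cx; have [Xy H1' H2'] := cy.
have r20 : 0 < r / 2 by lra.
have zbx : hball x r z by split=> //; lra.
have zby : hball y r z by split=> //; lra.
have sub u : hball y (r / 2) u -> hball y r u by move=> [? ?]; split=> //; lra.
have hE u : exists v, hball y (r / 2) u -> hball x r v /\ psi v = psi' u.
  have [yu|nyu] := pselect (hball y (r / 2) u); last by exists u.
  have [|v xv vu] := H2 (psi' u); last by exists v.
  have := metric_triangle (psi x) (psi z) (psi' u).
  rewrite (chart_dist r0 cx zbx) (E z (hball_center Xz e0)) (H1' z u zby (sub _ yu)).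
  by case: yu => Xu yu; have := hdist_triangle Xz Xy Xu; rewrite (hdist_sym z y); lra.
have [h hP] := choice hE.
have [||g ig gE] := @rigidity R n h y (cosh (r / 2)) Xy (cosh_gt1 r20).
- move=> u Xu yu; have /hP[[Xhu _] _] : hball y (r / 2) u by apply/hballP.
  exact: Xhu.
- move=> u v Xu Xv yu yv.
  have yu' : hball y (r / 2) u by apply/hballP.
  have yv' : hball y (r / 2) v by apply/hballP.
  have [xhu hu] := hP _ yu'; have [xhv hv] := hP _ yv'.
  have [[Xhu _] [Xhv _]] := (xhu, xhv).
  apply: oppr_inj; rewrite -(cosh_hdist Xhu Xhv) -(cosh_hdist Xu Xv) -H1// hu hv H1' //; exact: sub.
have g1 : g = 1.
  have e'0 : 0 < Num.min e (r / 4) by rewrite lt_min e0; lra.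
  apply: (isol_ext Xz (cosh_gt1 e'0)) => u Xu zu; rewrite act1.
  have [_] : hball z (Num.min e (r / 4)) u by apply/hballP.
  rewrite lt_min => /andP[zue zur].
  have yu : hball y (r / 2) u by split=> //; have := hdist_triangle Xy Xz Xu; lra.
  have xu : hball x r u by split=> //; have := hdist_triangle Xx Xz Xu; lra.
  have [xhu hu] := hP _ yu.
  rewrite -gE//; last by have /(hballP _ Xy r20)[] := yu.
  by apply: (chart_inj cx xhu xu); rewrite hu -E.
move=> u yu; have [_ <-] := hP _ yu.
by have /(hballP _ Xy r20)[Xu yub] := yu; rewrite gE// g1 act1.
Qed.

Lemma chart_transport r x y psi : 0 < r ->
  (forall (m : M) x, X x -> exists2 psi, chart r x psi & psi x = m) ->
  chart r x psi -> X y -> hdist x y < r / 4 ->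
  exists2 psi', chart r y psi' & forall u, hball y (r / 2) u -> psi u = psi' u.
Proof.
move=> r0 H cx Xy xy; have [Xx H1 H2] := cx.
have r20 : 0 < r / 2 by lra.
have [phi cy phiy] := H (psi y) y Xy; have [_ H1' H2'] := cy.
have sub u : hball y (r / 2) u -> hball x r u.
  by move=> [Xu yu]; split=> //; have := hdist_triangle Xx Xy Xu; lra.
have xyb : hball x r y by split=> //; lra.
have hE u : exists v, hball y (r / 2) u -> hball y r v /\ phi v = psi u.
  have [yu|nyu] := pselect (hball y (r / 2) u); last by exists u.
  have [|v yv vu] := H2' (psi u); last by exists v.
  by rewrite phiy (H1 y u xyb (sub _ yu)); case: yu => _ yu; lra.
have [h hP] := choice hE.
have [||g ig gE] := @rigidity R n h y (cosh (r / 2)) Xy (cosh_gt1 r20).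
- move=> u Xu yu; have /hP[[Xhu _] _] : hball y (r / 2) u by apply/hballP.
  exact: Xhu.
- move=> u v Xu Xv yu yv.
  have yu' : hball y (r / 2) u by apply/hballP.
  have yv' : hball y (r / 2) v by apply/hballP.
  have [xhu hu] := hP _ yu'; have [xhv hv] := hP _ yv'.
  have [[Xhu _] [Xhv _]] := (xhu, xhv).
  apply: oppr_inj; rewrite -(cosh_hdist Xhu Xhv) -(cosh_hdist Xu Xv) -H1'// hu hv H1 //; exact: sub.
have yg : y *m g = y.
  have yy := hball_center Xy r20; have [yhy hy] := hP _ yy.
  rewrite -gE//; last by have /(hballP _ Xy r20)[] := yy.
  by apply: (chart_inj cy yhy (hball_center Xy r0)); rewrite hy phiy.
exists (fun u => phi (u *m g)); first by apply: chart_comp => //; rewrite yg.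
move=> u yu; have [_ <-] := hP _ yu.
by have /(hballP _ Xy r20)[Xu yub] := yu; rewrite gE.
Qed.

End Charts.

Section Develop.
Context {R : realType} {n : nat} {M : metricType R}.
Local Notation V := 'rV[R]_n.+1.
Local Notation X := (@hyperbolic_space R n).
Implicit Types (x y z u v p q o : V) (e s : R) (psi : V -> M) (g : 'M[R]_n.+1).

Definition local_isometry e (pi : V -> M) := forall x, X x -> chart e x pi.

(** Analytic continuation of one chart along the radii from [b0], in steps of length at most
    [r / 16]. *)
Lemma develop r : 0 < r ->
  (forall (m : M) x, X x -> exists2 psi, chart r x psi & psi x = m) ->
  (exists m : M, True) -> exists pi : V -> M, local_isometry (r / 16) pi.
Proof.
move=> r0 H [m0 _]; have [b0 Xo] := @exists_hyp R n.
have [psi0 c0 _] := H m0 b0 Xo.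
have e0 : 0 < r / 16 by lra.
have TE (t : (V -> M) * V * V) : exists psi', let: (psi, x, y) := t in
    chart r x psi -> X y -> hdist x y < r / 4 ->
    chart r y psi' /\ forall u, hball y (r / 2) u -> psi u = psi' u.
  case: t => -[psi x] y.
  have [[cx Xy xy]|ncx] := pselect [/\ chart r x psi, X y & hdist x y < r / 4].
    by have [psi' h1 h2] := chart_transport r0 H cx Xy xy; exists psi'.
  by exists psi => cx Xy xy; case: ncx.
have [T TP] := choice TE.
have {TP} TP psi x y : chart r x psi -> X y -> hdist x y < r / 4 ->
    chart r y (T (psi, x, y)) /\ forall u, hball y (r / 2) u -> psi u = T (psi, x, y) u.
  exact: (TP (psi, x, y)).
(* [sg k x] is meant for [x] within [k] steps of [b0]: it transports the chart found at the
   projection [rt] of [x] to the previous ball. *)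
pose rt k x := retract b0 (k%:R * (r / 16)) x.
pose sg := fix sg k x : V -> M :=
  if k is k'.+1 then T (sg k' (rt k' x), rt k' x, x) else psi0.
pose B k x := X x /\ hdist b0 x <= k%:R * (r / 16).
have kr k : 0 <= k%:R * (r / 16) by rewrite mulr_ge0//; lra.
have B_rt k x : B k.+1 x -> B k (rt k x) /\ hdist (rt k x) x < r / 4.
  move=> [Xx]; rewrite -natr1 mulrDl mul1r => ox.
  have [h1 h2] := retract_hyp Xo Xx (kr k); split.
    by split=> //; rewrite h2 ge_min lexx.
  rewrite hdist_sym retract_dist//; move: (k%:R * (r / 16)) ox => K ox.
  by clear -r0 ox; rewrite /Num.min; have [h|h] := ltP K (hdist b0 x); lra.
have B_rt' k x : B k.+1 x -> hdist (rt k x) x <= r / 16.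
  move=> [Xx]; rewrite -natr1 mulrDl mul1r => ox.
  rewrite hdist_sym retract_dist//; move: (k%:R * (r / 16)) ox => K ox.
  by clear -r0 ox; rewrite /Num.min; have [h|h] := ltP K (hdist b0 x); lra.
have B_in k x : B k x -> rt k x = x.
  by move=> [Xx ox]; rewrite /rt /retract ox.
have sg_chart k : forall x, B k x -> chart r x (sg k x).
  elim: k => [|k IH] x Bx.
    by case: Bx => Xx; rewrite mul0r => /(hdist_le0 Xo Xx) <-.
  have [Br rx] := B_rt _ _ Bx; case: Bx => Xx _.
  by have [] := TP _ _ _ (IH _ Br) Xx rx.
have sg_T k x : B k.+1 x -> forall u, hball x (r / 2) u -> sg k (rt k x) u = sg k.+1 x u.
  move=> Bx; have [Br rx] := B_rt _ _ Bx; case: Bx => Xx _.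
  by have [] := TP _ _ _ (sg_chart _ _ Br) Xx rx.
have B_sub k x : B k x -> B k.+1 x.
  by move=> [Xx ox]; split=> //; apply: (le_trans ox); rewrite ler_pM2r// ler_nat.
have sg_step k x : B k x -> forall u, hball x (r / 2) u -> sg k x u = sg k.+1 x u.
  by move=> Bx u xu; rewrite -(sg_T _ _ (B_sub _ _ Bx) _ xu) B_in.
(* Absence of monodromy. Projections of neighbours are neighbours, so their charts agree by
   induction; the transported charts then agree near [x], and [chart_agree] enlarges the ball. *)
have sg_agree k : forall x y, B k x -> B k y -> hdist x y < r / 16 ->
    forall u, hball y (r / 2) u -> sg k x u = sg k y u.
  elim: k => [//|k IH] x y Bx By xy.
  have cx := sg_chart _ _ Bx; have cy := sg_chart _ _ By.
  have [Xx _] := Bx; have [Xy _] := By.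
  have [Brx rx] := B_rt _ _ Bx; have [Bry ry] := B_rt _ _ By.
  have rx' := B_rt' _ _ Bx; have ry' := B_rt' _ _ By.
  have [[Xrx _] [Xry _]] := (Brx, Bry).
  have rr : hdist (rt k x) (rt k y) < r / 16 by apply: le_lt_trans xy; exact: retract_lip.
  have r80 : 0 < r / 8 by lra.
  apply: (@chart_agree _ _ _ r x y x _ _ (r / 8)) => //.
  - by rewrite hdistxx//; clear -r0; lra.
  - by rewrite hdist_sym; clear -r0 xy; lra.
  move=> u [Xu xu].
  have ux : hball x (r / 2) u by split=> //; clear -r0 xu; lra.
  have uy : hball y (r / 2) u.
    by split=> //; have := hdist_triangle Xy Xx Xu; rewrite (hdist_sym y x); clear -r0 xu xy; lra.
  rewrite -(sg_T _ _ Bx _ ux) -(sg_T _ _ By _ uy); apply: IH => //.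
  split=> //; have h1 := hdist_triangle Xry Xrx Xu; have h2 := hdist_triangle Xrx Xx Xu.
  rewrite hdist_sym in rr.
  move: (rt k x) (rt k y) h1 h2 rr rx' => px py h1 h2 h3 rx'.
  by clear -r0 h1 h2 h3 rx' xu; lra.
have sg_add k j x : B k x -> B (k + j)%N x /\ forall u, hball x (r / 2) u -> sg k x u = sg (k + j)%N x u.
  move=> Bx; elim: j => [|j [IH1 IH2]]; first by rewrite addn0.
  by rewrite addnS; split; [exact: B_sub|move=> u xu; rewrite IH2// sg_step].
have sg_le k j x : (k <= j)%N -> B k x -> sg k x x = sg j x x.
  move=> kj Bx; have [_] := sg_add k (j - k)%N x Bx; rewrite subnKC// => -> //.
  by case: Bx => Xx _; apply: hball_center => //; clear -r0; lra.
have B_ex s : exists k, forall x, X x -> hdist b0 x <= s -> B k x.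
  exists (Num.bound (`|s| / (r / 16))) => x Xx xs; split=> //.
  apply: (le_trans xs); apply: (le_trans (ler_norm _)).
  by rewrite -ler_pdivrMr//; apply/ltW/archi_boundP; rewrite divr_ge0// ltW.
have Kex x : exists k, X x -> B k x.
  by have [k kP] := B_ex (hdist b0 x); exists k => Xx; exact: kP.
have [K KP] := choice Kex.
have piE k x : B k x -> sg (K x) x x = sg k x x.
  move=> Bx; have [Xx _] := Bx; have BK := KP x Xx.
  by have [kK|/ltnW kK] := leqP k (K x); [apply/esym/sg_le|apply: sg_le].
exists (fun x => sg (K x) x x) => x Xx.
have [k kP] := B_ex (hdist b0 x + r / 16).
have Bx : B k x by apply: kP => //; clear -r0; lra.
apply: (@chart_ext _ _ _ _ _ (sg k x)) => //.
  move=> y [Xy xy]; have By : B k y.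
    by apply: kP => //; have h := hdist_triangle Xo Xx Xy; clear -h xy; lra.
  rewrite (piE k y By); apply: sg_agree => //.
  by apply: hball_center => //; clear -r0; lra.
apply: (@chart_sub _ _ _ r _ x) => //; first exact: sg_chart.
  exact: hball_center.
by rewrite hdistxx//; clear -r0; lra.
Qed.

End Develop.

Section UniformCharts.
Context {R : realType} {n : nat} {M : metricType R}.
Local Notation V := 'rV[R]_n.+1.
Local Notation X := (@hyperbolic_space R n).
Implicit Types (x y z u v p q : V) (r e s : R) (psi : V -> M) (g : 'M[R]_n.+1).

(** The given chart need not send [m] to the centre [p], so its inverse is restricted to a ball
    around the image of [m], with radius reduced by the offset. *)
Lemma local_chart (m : M) : locally_hyperbolic M n ->
  exists r x psi, [/\ 0 < r, chart r x psi & psi x = m].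
Proof.
move=> /(_ m)[p [r [phi [Xp r0 bij_phi phi_i]]]].
have [phiS phiI phiJ] := bij_phi.
have mm : ball m r m by rewrite ballEmdist /= mdistxx.
have pm := phiS _ mm.
have invE y : exists m', hball p r y -> ball m r m' /\ phi m' = y.
  have [py|npy] := pselect (hball p r y); last by exists m.
  by have [m' mm' m'y] := phiJ _ py; exists m'.
have [psi psiP] := choice invE.
have [Xy0 py0] := pm.
have sub y : hball (phi m) (r - hdist p (phi m)) y -> hball p r y.
  by move=> [Xy yy]; split=> //; have := hdist_triangle Xp Xy0 Xy; lra.
have psim : psi (phi m) = m.
  by have [h1 h2] := psiP _ pm; apply: (phiI _ _ _ _ h2); rewrite inE.
exists (r - hdist p (phi m)), (phi m), psi; split=> //; first by lra.
split=> // [y z /sub yb /sub zb|m'].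
  have [h1 h2] := psiP _ yb; have [h3 h4] := psiP _ zb.
  by rewrite -phi_i// h2 h4.
rewrite psim => mm'; have d0 := hdist_ge0 Xp Xy0.
have bm' : ball m r m' by rewrite ballEmdist /=; lra.
have pm' := phiS _ bm'; have [h1 h2] := psiP _ pm'.
exists (phi m'); first by split; [case: pm'|rewrite phi_i].
by apply: (phiI _ _ _ _ h2); rewrite inE.
Qed.

Lemma uniform_charts : compact [set: M] -> locally_hyperbolic M n ->
  exists2 r : R, 0 < r &
    forall (m : M) x, X x -> exists2 psi, chart r x psi & psi x = m.
Proof.
move=> cM hM.
pose P (r : R) (m : M) := 0 < r -> exists x psi, chart r x psi /\ psi x = m.
have /(_ _ (at_right (0 : R)) P) := (@compact_near_coveringP M [set: M]).1 cM.
case=> [m _|].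
  have [r [x [psi [r0 cx xm]]]] := local_chart m hM.
  have r20 : 0 < r / 2 by lra.
  exists (ball m (r / 2), [set s | 0 < s < r / 2]).
    split; first exact: nbhsx_ballx.
    by near=> s; rewrite /=; apply/andP; split; near: s; [exact: nbhs_right_gt|exact: nbhs_right_lt].
  move=> [m' s] /= [mm' /andP[s0 sr]] _.
  rewrite ballEmdist /= -xm in mm'.
  have [Xx H1 H2] := cx; have [|y [Xy xy] ym'] := H2 m'; first by lra.
  have xyr : hdist x y < r / 2 by rewrite -(chart_dist r0 cx)// ym'.
  exists y, psi; split=> //; apply: (chart_sub s0 cx) => //; lra.
move=> r [/= r0 /= rP].
have r20 : 0 < r / 2 by lra.
exists (r / 2) => // m x Xx.
have [||y [psi [cy ym]]] := rP (r / 2) _ _ m I r20.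
- by rewrite /ball_ /= sub0r normrN gtr0_norm//; lra.
- by [].
have [Xy _ _] := cy; have [g ig xg] := isol_transitive Xx Xy.
exists (fun u => psi (u *m g)); last by rewrite xg.
by apply: chart_comp => //; rewrite xg.
Unshelve. all: by end_near. Qed.

End UniformCharts.

(** * Covering properties and the deck group *)

Section Covering.
Context {R : realType} {n : nat} {M : metricType R}.
Local Notation V := 'rV[R]_n.+1.
Local Notation X := (@hyperbolic_space R n).
Implicit Types (x y z u v p q : V) (r s : R) (psi : V -> M) (g : 'M[R]_n.+1).
Variable (e : R).
Hypothesis e0 : 0 < e.

Lemma unique_continuation (pi1 pi2 : V -> M) q r : local_isometry e pi1 ->
  local_isometry e pi2 -> X q -> 0 < r -> (forall u, hball q r u -> pi1 u = pi2 u) ->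
  forall x, X x -> pi1 x = pi2 x.
Proof.
move=> L1 L2 Xq r0 E x Xx.
have e20 : 0 < e / 2 by rewrite divr_gt0.
pose Q y := forall u, hball y (e / 2) u -> pi1 u = pi2 u.
have Qq : Q q.
  apply: (chart_agree e0 (L1 q Xq) (L2 q Xq) r0 Xq) => //; by rewrite hdistxx// divr_gt0.
suff : Q x by apply; exact: hball_center.
apply: (@hyp_chain R n Q (e / 4) q x) => //; first by rewrite divr_gt0.
move=> y z Xy Xz yz Qy.
by apply: (chart_agree e0 (L1 z Xz) (L2 z Xz) e20 Xy) => //; rewrite hdist_sym.
Qed.

Lemma local_isometry_comp pi g : isol g -> local_isometry e pi ->
  local_isometry e (fun x => pi (x *m g) : M).
Proof. by move=> ig L x Xx; apply: chart_comp => //; apply: L; exact: isol_hyp. Qed.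

Lemma lift_exists (pi1 pi2 : V -> M) p q : local_isometry e pi1 ->
  local_isometry e pi2 -> X p -> X q -> pi1 p = pi2 q ->
  exists g, [/\ isol g, q *m g = p & forall x, X x -> pi1 (x *m g) = pi2 x].
Proof.
move=> L1 L2 Xp Xq pq.
have c1 := L1 p Xp; have c2 := L2 q Xq.
have [_ H1 H2] := c1; have [_ H1' H2'] := c2.
have hE u : exists v, hball q e u -> hball p e v /\ pi1 v = pi2 u.
  have [qu|nqu] := pselect (hball q e u); last by exists u.
  have [|v pv vu] := H2 (pi2 u); last by exists v.
  by rewrite pq (chart_dist e0 c2 qu); case: qu.
have [h hP] := choice hE.
have [||g ig gE] := @rigidity R n h q (cosh e) Xq (cosh_gt1 e0).
- move=> u Xu qu; have /hP[[Xhu _] _] : hball q e u by apply/hballP.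
  exact: Xhu.
- move=> u v Xu Xv qu qv.
  have qu' : hball q e u by apply/hballP.
  have qv' : hball q e v by apply/hballP.
  have [phu hu] := hP _ qu'; have [phv hv] := hP _ qv'.
  have [[Xhu _] [Xhv _]] := (phu, phv).
  by apply: oppr_inj; rewrite -(cosh_hdist Xhu Xhv) -(cosh_hdist Xu Xv) -H1// hu hv H1'.
have hg u : hball q e u -> hball p e (u *m g) /\ pi1 (u *m g) = pi2 u.
  by move=> qu; rewrite -gE; [exact: hP|case: qu|have /(hballP _ Xq e0)[] := qu].
exists g; split=> //.
  have [pqg qg] := hg _ (hball_center Xq e0).
  by apply: (chart_inj c1 pqg (hball_center Xp e0)); rewrite qg.
apply: (unique_continuation (local_isometry_comp ig L1) L2 Xq e0).
by move=> u /hg[].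
Qed.

(** The image contains the ball of the fixed radius [e] about each of its points, so it is open and
    closed. *)
Lemma local_isometry_surj (pi : V -> M) : connected [set: M] -> local_isometry e pi ->
  forall m, exists2 x, X x & pi x = m.
Proof.
move=> cM L m; pose B := [set m' | exists2 x, X x & pi x = m'].
suff sub : B = setT by have : B m by [rewrite sub]; rewrite /B.
have ball_B m' m'' : mdist m' m'' < e -> B m' -> B m''.
  move=> mm [x Xx xm']; have [_ _ H] := L x Xx.
  by have [|y [Xy _] ym] := H m''; [rewrite xm'|exists y].
have oB : open B.
  rewrite openE => m' Bm'; apply/nbhs_ballP; exists e => //= m''; rewrite ballEmdist => mm.
  exact: ball_B mm Bm'.
have cB : closed B.
  rewrite -openC openE => m' nBm'; apply/nbhs_ballP; exists e => //= m''; rewrite ballEmdist /= => mm Bm''.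
  by apply: nBm'; apply: ball_B Bm''; rewrite metric_sym.
apply: cM.
- by have [x Xx] := @exists_hyp R n; exists (pi x), x.
- by exists B => //; rewrite setTI.
- by exists B => //; rewrite setTI.
Qed.

Definition deck (pi : V -> M) : set 'M[R]_n.+1 :=
  [set g | isol g /\ forall x, X x -> pi (x *m g) = pi x].

(** A deck element moving [x] by less than [e] fixes [x], then its whole ball, by injectivity of
    [pi] there. Compactness of [M] bounds the distance from [b] to some preimage of each point. *)
Lemma deck_lattice (pi : V -> M) : compact [set: M] -> connected [set: M] ->
  local_isometry e pi -> uniform_lattice (deck pi) (cosh e).
Proof.
move=> cM coM L; split.
- split.
  + by move=> g [].
  + by split=> [|x Xx]; [exact: isol1|rewrite act1].
  + move=> g h [ig gE] [ih hE]; split=> [|x Xx]; first exact: isolM.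
    by rewrite actM hE ?gE//; exact: isol_hyp.
  + move=> g [ig gE]; split=> [|x Xx]; first exact: isolV.
    by rewrite -[in RHS](actVK x ig) gE//; apply: isol_hyp => //; exact: isolV.
- exact: cosh_gt1.
- move=> g x [ig gE] Xx xg; have Xxg := isol_hyp ig Xx.
  have bxg : hball x e (x *m g) by apply/hballP.
  have xgx : x *m g = x.
    by apply: (chart_inj (L x Xx) bxg (hball_center Xx e0)); rewrite gE.
  apply: (isol_ext Xx (cosh_gt1 e0)) => u Xu xu; rewrite act1.
  have bu : hball x e u by apply/hballP.
  have bug : hball x e (u *m g) by rewrite -xgx; exact: hball_act.
  by apply: (chart_inj (L x Xx) bug bu); rewrite gE.
have [b Xb] := @exists_hyp R n.
pose P (k : nat) (m : M) := exists x, [/\ X x, pi x = m & - [<b, x>] <= k%:R].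
have /(_ _ \oo P) := (@compact_near_coveringP M [set: M]).1 cM.
case=> [m _|k _ kP].
  have [x Xx xm] := local_isometry_surj coM L m.
  exists (ball m e, [set k | (Num.bound (2 * (- [<b, x>] * cosh e)) <= k)%N]).
    by split; [exact: nbhsx_ballx|exact: nbhs_infty_ge].
  move=> [m' k] /= [mm' kb]; rewrite ballEmdist /= -xm in mm'.
  have [_ _ H] := L x Xx; have [y bxy ym'] := H m' mm'.
  have [Xy xy] := (hballP y Xx e0).1 bxy.
  exists y; split=> //.
  apply: (le_trans (causal_triangle (hyp_causal Xb) Xx (hyp_causal Xy))).
  apply: (@le_trans _ _ (2 * (- [<b, x>] * cosh e))).
    rewrite ler_pM2l// -mulrNN; apply: ler_wpM2l; last exact: ltW.
    by apply: le_trans (hyp_ge1 Xb Xx).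
  have c0 : 0 <= 2 * (- [<b, x>] * cosh e).
    rewrite mulr_ge0// mulr_ge0//; last by have := cosh_gt1 e0; lra.
    by apply: le_trans (hyp_ge1 Xb Xx).
  by apply/ltW/(lt_le_trans (archi_boundP c0)); rewrite ler_nat.
exists b, k%:R; split=> // x Xx.
have [y [Xy yx yk]] := kP k (leqnn k) (pi x) I.
have [g [ig xg gE]] := lift_exists L L Xy Xx yx.
by exists g; [split|rewrite xg].
Qed.

(** [f \o pi] is again a local isometry, so it lifts through [pi]; conjugation by the lift respects
    the deck group because [f] is invertible. *)
Lemma isometry_lift (pi : V -> M) (f : M -> M) : connected [set: M] ->
  local_isometry e pi -> isometry_group f ->
  exists2 F, normalizes (deck pi) F & forall x, X x -> pi (x *m F) = f (pi x).
Proof.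
move=> coM L If; have [[f' fK f'K] _] := If.
have [b Xb] := @exists_hyp R n.
have [x Xx xb] := local_isometry_surj coM L (f (pi b)).
have Lf : local_isometry e (f \o pi) by move=> y Xy; apply: chart_iso => //; exact: L.
have [F [iF bF FE]] := lift_exists L Lf Xx Xb xb.
exists F; last by [].
have iFV := isolV iF.
split=> // g [ig gE]; split; split.
- by apply: isolM => //; exact: isolM.
- move=> y Xy; rewrite !actM FE /=; last by apply/(isol_hyp ig)/isol_hyp.
  rewrite gE; last exact: isol_hyp.
  by rewrite -[RHS](congr1 pi (actVK y iF)) FE//; exact: isol_hyp.
- by apply: isolM => //; exact: isolM.
- move=> y Xy; apply: (can_inj fK).
  rewrite !actM -[LHS]/((f \o pi) _) -FE; last first.
    by apply/(isol_hyp iFV)/(isol_hyp ig)/isol_hyp.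
  rewrite actVK// gE; last exact: isol_hyp.
  by rewrite FE.
Qed.

End Covering.

(** * Closed geodesics *)

Section Final.
Context {R : realType} {n : nat}.
Local Notation V := 'rV[R]_n.+1.
Local Notation X := (@hyperbolic_space R n).
Implicit Types (x y z u v p q : V) (r s t l : R) (w E F g : 'M[R]_n.+1).

Lemma hdist_gpt p q a s t : null_pair p q ->
  hdist (gpt p q (expR (a * s))) (gpt p q (expR (a * t))) = `|a * (s - t)|.
Proof.
move=> npq; rewrite /hdist lf_gpt ?expR_gt0//.
have -> : (expR (a * s) / expR (a * t) + expR (a * t) / expR (a * s)) / 2 = cosh (a * (s - t)).
  by rewrite /cosh -!expRB; congr ((expR _ + expR _) / _); lra.
have [h|h] := leP 0 (a * (s - t)); first by rewrite coshK ?ger0_norm.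
by rewrite -coshN coshK ?ltr0_norm//; lra.
Qed.

(** Two distinct points of the line span the plane of [p] and [q], so [E] preserves this plane,
    whose only null lines are those of [p] and [q]. *)
Lemma preserve_line p q E a b a' b' : isol E -> null_pair p q -> 0 < a -> 0 < b ->
  a != b -> gpt p q a *m E = gpt p q a' -> gpt p q b *m E = gpt p q b' ->
  exists t, (p *m E = t *: p /\ q *m E = t^-1 *: q) \/
            (p *m E = t *: q /\ q *m E = t^-1 *: p).
Proof.
move=> iE npq a0 b0 ab aE bE; have [[pp p0] [qq q0] pq] := npq.
have aa : a * a^-1 = 1 by rewrite divff// gt_eqF.
have bb : b * b^-1 = 1 by rewrite divff// gt_eqF.
have comb c d : exists al be, (c *: gpt p q a + d *: gpt p q b) *m E = al *: p + be *: q.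
  exists (c * a' + d * b'), (c * a'^-1 + d * b'^-1).
  rewrite mulmxDl -!scalemxAl aE bE /gpt; apply/rowP => i; rewrite !mxE; lra.
have D0 : a ^+ 2 - b ^+ 2 != 0.
  rewrite subr_sqr mulf_neq0// ?subr_eq0//; apply: lt0r_neq0; lra.
set D := (a ^+ 2 - b ^+ 2)^-1.
have DD : (a ^+ 2 - b ^+ 2) * D = 1 by rewrite /D divff.
have pE : p = (D * a) *: gpt p q a + (- D * b) *: gpt p q b.
  apply/rowP => i; have := congr1 (fun zz => zz * p ord0 i) DD.
  have := congr1 (fun zz => D * zz * q ord0 i) aa; have := congr1 (fun zz => D * zz * q ord0 i) bb.
  by rewrite /gpt !mxE /=; lra.
have qE : q = (D * a ^+ 2 * b) *: gpt p q b + (- D * a * b ^+ 2) *: gpt p q a.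
  apply/rowP => i; have := congr1 (fun zz => zz * q ord0 i) DD.
  have := congr1 (fun zz => D * b ^+ 2 * zz * q ord0 i) aa.
  have := congr1 (fun zz => D * a ^+ 2 * zz * q ord0 i) bb.
  by rewrite /gpt !mxE /=; lra.
have [al [be pE']] : exists al be, p *m E = al *: p + be *: q.
  by rewrite {1}pE; exact: comb.
have [ga [de qE']] : exists ga de, q *m E = ga *: p + de *: q.
  by rewrite {1}qE addrC; exact: comb.
have h1 : al * be = 0.
  have := isol_lf p p iE; rewrite pE' !(lfDl, lfDr, lfZl, lfZr) pp qq (lfC q) pq.
  by lra.
have h2 : ga * de = 0.
  have := isol_lf q q iE; rewrite qE' !(lfDl, lfDr, lfZl, lfZr) pp qq (lfC q) pq.
  by lra.
have h3 : al * de + be * ga = 1.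
  have := isol_lf p q iE; rewrite pE' qE' !(lfDl, lfDr, lfZl, lfZr) pp qq (lfC q) pq.
  by lra.
move: h1 => /eqP; rewrite mulf_eq0 => /orP[/eqP al0|/eqP be0].
  exists be; right; move: h3; rewrite al0 mul0r add0r => h3.
  have be0 : be != 0 by apply: contra_eq_neq h3 => ->; rewrite mul0r eq_sym oner_neq0.
  have ga0 : ga = be^-1 by apply: (mulfI be0); rewrite h3 mulfV.
  have de0 : de = 0.
    by move: h2 => /eqP; rewrite ga0 mulf_eq0 invr_eq0 (negbTE be0) => /eqP.
  by rewrite pE' qE' al0 de0 ga0 !scale0r add0r addr0.
exists al; left; move: h3; rewrite be0 mul0r addr0 => h3.
have al0 : al != 0 by apply: contra_eq_neq h3 => ->; rewrite mul0r eq_sym oner_neq0.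
have de0 : de = al^-1 by apply: (mulfI al0); rewrite h3 mulfV.
have ga0 : ga = 0.
  by move: h2 => /eqP; rewrite de0 mulf_eq0 invr_eq0 (negbTE al0) orbF => /eqP.
by rewrite pE' qE' be0 de0 ga0 !scale0r add0r addr0.
Qed.

Lemma preserve_axis_commute G k0 w p q l E a b a' b' : uniform_lattice G k0 ->
  G w -> axis w p q l -> normalizes G E -> 0 < a -> 0 < b -> a != b ->
  gpt p q a *m E = gpt p q a' -> gpt p q b *m E = gpt p q b' ->
  w * E = E * w \/ w * E = E * w^-1.
Proof.
move=> HG Gw axw NE a0 b0 ab aE bE; have [npq l1 pw qw] := axw.
have iE := normalizes_isol NE; have uE := isol_unit iE; have iw := G_isol HG Gw.
have [_ _ qwV pwV] := axisV iw axw.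
have GF : G (E^-1 * w * E) by have [_ /(_ w Gw)[]] := NE.
have EF : E * (E^-1 * w * E) = w * E by rewrite !mulrA divrr// mul1r.
have Xe := isol_hyp iE (gpt_hyp npq ltr01).
have [t [[pE qE]|[pE qE]]] := preserve_line iE npq a0 b0 ab aE bE.
  left; rewrite -EF; congr (E * _); apply: (G_eq HG GF Gw Xe).
  rewrite -actM EF actM gpt1 !mulmxDl pw qw -!scalemxAl pE qE -!scalemxAl pw qw !scalerA.
  by rewrite (mulrC t) (mulrC t^-1).
right; rewrite -EF; congr (E * _); apply: (G_eq HG GF (G_V HG Gw) Xe).
rewrite -actM EF actM gpt1 !mulmxDl pw qw -!scalemxAl pE qE -!scalemxAl pwV qwV !scalerA.
by rewrite (mulrC t) (mulrC t^-1).
Qed.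

Lemma floor_cell (K : nat) t : (0 < K)%N -> exists (k : int) (i : 'I_K),
  0 <= t - k%:~R - i%:R / K%:R /\ t - k%:~R - i%:R / K%:R < K%:R^-1.
Proof.
move=> K0; have KR : 0 < K%:R :> R by rewrite ltr0n.
pose k := Num.floor t; have f1 : k%:~R <= t by exact: floor_le.
have f2 : t < k%:~R + 1 by rewrite -[1]/(1%:~R) -intrD; exact: floorD1_gt.
pose i := Num.truncn ((t - k%:~R) * K%:R).
have h0 : 0 <= (t - k%:~R) * K%:R by rewrite mulr_ge0 ?subr_ge0// ltW.
have /andP[i1 i2] : i%:R <= (t - k%:~R) * K%:R < i.+1%:R by apply: truncn_itv.
have iK : (i < K)%N.
  rewrite -(ltr_nat R); apply: (le_lt_trans i1).
  by rewrite -[ltRHS]mul1r ltr_pM2r//; lra.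
exists k, (Ordinal iK); split => /=.
  by rewrite subr_ge0 ler_pdivrMr.
have iE : i.+1%:R / K%:R = i%:R / K%:R + K%:R^-1 :> R by rewrite -natr1 mulrDl mul1r.
by rewrite ltrBlDl -iE ltr_pdivlMr.
Qed.

Section Closed.
Context {M : metricType R}.
Variables (e : R) (pi : V -> M).
Hypotheses (e0 : 0 < e) (L : local_isometry e pi).
Let G := deck pi.
Variables (w : 'M[R]_n.+1) (p q : V) (l : R).
Hypotheses (HG : uniform_lattice G (cosh e)) (Gw : G w) (axw : axis w p q l).

(** The factor [ln l] makes the translation [w] advance the time by 1. *)
Let lift_curve (t : R) : V := gpt p q (expR (ln l * t)).
Definition axis_curve (t : R) : M := pi (lift_curve t).

Let npq : null_pair p q. Proof. by case: axw. Qed.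
Let ln0 : 0 < ln l. Proof. by case: axw => _ l1 _ _; exact: ln_gt0. Qed.
Let Xc t : X (lift_curve t). Proof. exact: gpt_hyp npq (expR_gt0 _). Qed.

Let lift_curve_w t : lift_curve t *m w = lift_curve (t + 1).
Proof.
have [_ l1 _ _] := axw; rewrite /lift_curve (gpt_axis _ axw); congr gpt.
by rewrite mulrDr mulr1 expRD lnK// posrE; lra.
Qed.

Let lift_curve_k t (k : int) : lift_curve (t - k%:~R) *m w ^ k = lift_curve t.
Proof.
have iw := G_isol HG Gw.
have H t' (m : nat) : lift_curve t' *m w ^+ m = lift_curve (t' + m%:R).
  elim: m => [|m IH]; first by rewrite expr0 act1 addr0.
  by rewrite exprSr actM IH lift_curve_w -addrA natr1.
case: k => m; first by rewrite H -[m%:~R]/(m%:R) subrK.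
rewrite NegzE -exprnN; apply: (can_inj (fun x => actK x (isolX m.+1 iw))).
rewrite actVK; last exact: isolX.
by rewrite H mulrNz opprK.
Qed.

Lemma axis_curve_immersion : geodesic_immersion_of_circle axis_curve.
Proof.
have [_ Gw2] := Gw.
split=> [t|]; first by rewrite /axis_curve -lift_curve_w Gw2.
exists (ln l) => // t; exists (e / ln l); first exact: divr_gt0.
move=> s u st ut; have [_ H _] := L (Xc t).
have near r : `|r - t| < e / ln l -> hball (lift_curve t) e (lift_curve r).
  move=> rt; split; first exact: Xc.
  by rewrite hdist_gpt// normrM gtr0_norm// distrC mulrC -ltr_pdivlMr.
rewrite /axis_curve H ?hdist_gpt ?normrM ?(gtr0_norm ln0)//; exact: near.
Qed.

(** Each point of the axis is sent by [F] into some [G]-translate of the axis, possibly a different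
    one for each point. Two nearby points going to the same translate are enough, by
    [preserve_axis_commute]. *)
Lemma lift_preserves_axis F (f : M -> M) : normalizes G F ->
  (forall x, X x -> pi (x *m F) = f (pi x)) ->
  f @` range axis_curve = range axis_curve ->
  exists2 g, G g & w * (F * g) = (F * g) * w \/ w * (F * g) = (F * g) * w^-1.
Proof.
move=> NF FE fr; have iF := normalizes_isol NF.
(* Cells of parameter length [K%:R^-1] then have length less than [e / 2]; the successor keeps [K]
   positive. *)
pose K := (Num.bound (2 * ln l / e)).+1.
have KR : 0 < K%:R :> R by rewrite ltr0n.
have lK : ln l / K%:R < e / 2.
  have h0 : 0 <= 2 * ln l / e by rewrite divr_ge0// ?mulr_ge0// ltW.
  have : 2 * ln l / e < K%:R by apply: lt_trans (archi_boundP h0) _; rewrite ltr_nat.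
  by rewrite ltr_pdivrMr// ltr_pdivrMr// => h; have := ln0; lra.
(* One more sample than there are cells, all within an arc as short as a cell. *)
pose s (i : 'I_K.+1) : R := i%:R / (K.+1%:R * K%:R).
have sbound i j : ln l * `|s i - s j| < e / 2.
  have : `|s i - s j| <= K%:R^-1.
    rewrite /s -mulrBl normrM invfM normrM.
    rewrite (ger0_norm (x := K.+1%:R^-1)) ?invr_ge0// (ger0_norm (x := K%:R^-1)) ?invr_ge0//.
    rewrite mulrA -[leRHS]mul1r ler_pM2r ?invr_gt0// ler_pdivrMr// mul1r.
    rewrite ler_norml; have [hi hj] := (ltn_ord i, ltn_ord j).
    have {}hi : i%:R <= K.+1%:R :> R by rewrite ler_nat ltnW.
    have {}hj : j%:R <= K.+1%:R :> R by rewrite ler_nat ltnW.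
    have i0 : 0 <= i%:R :> R by []. have j0 : 0 <= j%:R :> R by [].
    by apply/andP; split; lra.
  by move=> h; apply: le_lt_trans lK; rewrite ler_pM2l.
have cell (i : 'I_K.+1) : exists tg : R * 'M[R]_n.+1 * 'I_K,
    [/\ G tg.1.2, lift_curve tg.1.1 *m tg.1.2 = lift_curve (s i) *m F,
      0 <= tg.1.1 - tg.2%:R / K%:R & tg.1.1 - tg.2%:R / K%:R < K%:R^-1].
  have : range axis_curve (f (axis_curve (s i))) by rewrite -fr; exists (axis_curve (s i)); [exists (s i)|].
  move=> [t _]; rewrite /axis_curve -FE// => tE.
  have [g [ig tg gE]] := lift_exists e0 L L (isol_hyp iF (Xc (s i))) (Xc t) (esym tE).
  have [k [c [c1 c2]]] := floor_cell t (ltn0Sn _ : 0 < K)%N.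
  exists (t - k%:~R, w ^ k * g, c); split=> //=.
    by apply: (G_M HG); [exact: (G_exprz HG)|split].
  by rewrite actM lift_curve_k.
have [tg tgP] := choice cell.
(* Two samples land in the same cell modulo the period. Sources and targets are then both closer
   than [e / 2], so freeness forces the same group element. *)
have [i [j [ij cij]]] : exists i j, i != j /\ (tg i).2 = (tg j).2.
  have [/injectiveP/leq_card|/injectivePn[i [j ij cij]]] :=
    boolP (injectiveb (fun i => (tg i).2)); last by exists i, j.
  by rewrite !card_ord ltnn.
have [Gi iE i1 i2] := tgP i; have [Gj jE j1 j2] := tgP j.
rewrite cij in i1 i2.
set ti := (tg i).1.1 in iE i1 i2; set tj := (tg j).1.1 in jE j1 j2.
set gi := (tg i).1.2 in Gi iE; set gj := (tg j).1.2 in Gj jE.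
have igi := G_isol HG Gi; have igj := G_isol HG Gj.
have gij : gi = gj.
  have d1 : hdist (lift_curve ti *m gi) (lift_curve tj *m gj) < e / 2.
    rewrite iE jE isol_hdist// hdist_gpt// normrM gtr0_norm//.
  have d2 : hdist (lift_curve tj *m gj) (lift_curve ti *m gj) < e / 2.
    rewrite isol_hdist// hdist_gpt// normrM gtr0_norm//.
    apply: le_lt_trans lK; rewrite ler_pM2l// ler_norml.
    by apply/andP; split; lra.
  have Xi := isol_hyp igi (Xc ti); have Xij := isol_hyp igj (Xc ti).
  have d3 := hdist_triangle Xi (isol_hyp igj (Xc tj)) Xij.
  have := le_lt_trans d3 (ltrD d1 d2); rewrite -splitr.
  rewrite hdist_lt// => d4.
  have : gi^-1 * gj = 1.
    by apply: (G_free HG (G_M HG (G_V HG Gi) Gj) Xi); rewrite actM actK.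
  by move/(congr1 (fun zz => gi * zz)); rewrite mulrA divrr ?mul1r ?mulr1// (G_unit HG).
exists gi^-1; first exact: (G_V HG).
apply: (@preserve_axis_commute _ _ _ p q l _ (expR (ln l * s i)) (expR (ln l * s j))
  (expR (ln l * ti)) (expR (ln l * tj)) HG Gw axw) => //.
- by apply: normalizesM => //; apply/(G_normalizes HG)/(G_V HG).
- exact: expR_gt0.
- exact: expR_gt0.
- rewrite (inj_eq (@expR_inj R)) (inj_eq (mulfI (lt0r_neq0 ln0))).
  have h : (K.+1%:R * K%:R)^-1 != 0 :> R by rewrite invr_eq0 mulf_neq0// gt_eqF.
  by rewrite /s (inj_eq (mulIf h)) eqr_nat.
- by rewrite actM -[gpt p q _]/(lift_curve (s i)) -iE actK.
- by rewrite actM -[gpt p q _]/(lift_curve (s j)) -jE gij actK.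
Qed.

End Closed.
End Final.

Theorem theorem3p1 (R : realType) (n : nat) (M : metricType R) (hn : (2 < n)%N)
    (hM : closed_connected_hyperbolic_manifold M n) :
  exists gamma : set M,
    [/\ geometric_closed_geodesic gamma,
        geodesic_order gamma = 1%N &
        geodesic_stabilizer gamma = [set idfun]].
Proof.
have [[m _] cM coM _ lM] := hM.
have [r r0 rP] := uniform_charts cM lM.
have [|pi L] := develop r0 rP; first by exists m.
have e0 : 0 < r / 16 by rewrite divr_gt0.
have HG := deck_lattice e0 cM coM L.
have [w [p [q [l [Gw axw H]]]]] := exists_asymmetric HG (ltnW hn).
pose c := axis_curve pi p q l.
have stab : geodesic_stabilizer (range c) = [set idfun].
  apply/seteqP; split=> [f [If fr]|_ ->] /=; last first.
    split; last by rewrite image_id.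
    by split=> //; exists idfun.
  have [F NF FE] := isometry_lift e0 coM L If.
  have [g Gg comm] := lift_preserves_axis e0 L HG Gw axw NF FE fr.
  have NFg : normalizes (deck pi) (F * g).
    by apply: normalizesM => //; exact: (G_normalizes HG).
  have GF : deck pi F.
    have -> : F = F * g * g^-1 by rewrite mulrK// (G_unit HG).
    by apply: (G_M HG); [exact: H|exact: (G_V HG)].
  apply/funext => m'; have [x Xx <-] := local_isometry_surj e0 coM L m'.
  by have [_ GFE] := GF; rewrite -FE// GFE.
exists (range c); split=> //.
  by exists c => //; exact: (axis_curve_immersion e0 L Gw axw).
by rewrite /geodesic_order stab fset_set1 cardfs1.
Qed.
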